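(* Let $(M,g)$ be a $d$-dimensional Kähler manifold admitting global complex coordinates $\{z_1,\dots,z_d\}$, and suppose that $(M,g)$ is infinite projectively induced through a transversally full map (i.e. there is a transversally full Kähler immersion of $(M,g)$ into $\mathbb{C}\mathrm{P}^\infty$). If there exists $\alpha_0>0$ such that $(M,\alpha\,g)$ is infinite projectively induced for every real $\alpha\geq\alpha_0$, then $(M,g)$ is strongly not relative to any projective Kähler manifold; that is, for every real constant $c>0$, the Kähler manifold $(M,c\,g)$ is not relative to any projective Kähler manifold.
   Context: For $N\le\infty$, $\mathbb{C}\mathrm{P}^N$ is the $N$-dimensional complex projective space (for $N=\infty$, the projectivization of $\ell^2(\mathbb{C})$) endowed with the Fubini–Study metric $g_{FS}$ of holomorphic sectional curvature $4$. Its Kähler form $\omega_{FS}$ is given on the affine chart $\{Z_0\neq0\}$, with coordinates $z_j=Z_j/Z_0$, by $\omega_{FS}=\frac i2\partial\bar\partial\log\bigl(1+\sum_{j=1}^N|z_j|^2\bigr)$. A Kähler immersion is a holomorphic and isometric immersion. A Kähler immersion $f:M\to\mathbb{C}\mathrm{P}^N$ is full if $f(M)$ is not contained in any lower dimensional totally geodesic submanifold of $\mathbb{C}\mathrm{P}^N$; for $N=\infty$ this means that $f(M)$ is not contained in any finite dimensional projective subspace. A Kähler manifold is infinite projectively induced if it admits a full Kähler immersion into $\mathbb{C}\mathrm{P}^\infty$. For a $d$-dimensional Kähler manifold $M$ with global coordinates $\{z_1,\dots,z_d\}$, let $M_j=\{z\in M \mid z_1=\dots=z_{j-1}=z_{j+1}=\dots=z_d=0\}$,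 a $1$-dimensional submanifold of $M$. A Kähler immersion $f:M\to\mathbb{C}\mathrm{P}^\infty$ is transversally full if for every $j=1,\dots,d$ the restriction of $f$ to $M_j$ is full into $\mathbb{C}\mathrm{P}^\infty$. Two Kähler manifolds are relatives (one is relative to the other) if they share a common Kähler submanifold of positive dimension, i.e. a complex submanifold of one of them, with the induced metric, is biholomorphically isometric to a complex submanifold of the other one, with the induced metric. A projective Kähler manifold is a Kähler manifold which admits a local holomorphic and isometric immersion into some finite dimensional $(\mathbb{C}\mathrm{P}^n,g_{FS})$. *)

(* Defs.v *)
From HB Require Import structures.
From mathcomp Require Import all_boot all_order all_algebra.
From mathcomp Require Import all_classical all_reals all_analysis complex.
Set Implicit Arguments.
Unset Strict Implicit.
Unset Printing Implicit Defensive.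
Import Order.TTheory GRing.Theory Num.Theory numFieldNormedType.Exports.
Local Open Scope classical_set_scope.
Local Open Scope ring_scope.
Local Open Scope complex_scope.

(* Usual topology of R[i], and through it of C^n = 'rV[R[i]]_n; [differentiable]
   between such spaces is then complex differentiability. *)
HB.instance Definition _ (R : realType) := NormedModule.copy R[i] R[i]^o.

Section Derivatives.
Context {R : realType} {V : lmodType R[i]}.
Implicit Types (phi : V -> R[i]) (u v x : V).

Definition rderivable phi v x : Prop :=
  derivable (fun t : R => complex.Re (phi (x + t%:C *: v)) : R) 0 1 /\
  derivable (fun t : R => complex.Im (phi (x + t%:C *: v)) : R) 0 1.

(* derivative of phi at x along the real direction v *)
Definition rderiv phi v x : R[i] :=
  derive1 (fun t : R => complex.Re (phi (x + t%:C *: v)) : R) 0 +i*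
  derive1 (fun t : R => complex.Im (phi (x + t%:C *: v)) : R) 0.

(* Wirtinger derivatives; for v the j-th basis vector of C^n these are
   d/dz_j and d/d\bar z_j. *)
Definition wderiv phi v x : R[i] :=
  2^-1 * (rderiv phi v x - (0 +i* 1) * rderiv phi ((0 +i* 1) *: v) x).
Definition wderivbar phi v x : R[i] :=
  2^-1 * (rderiv phi v x + (0 +i* 1) * rderiv phi ((0 +i* 1) *: v) x).

(* the coefficients phi_{j \bar k} of (i/2) \partial\bar\partial phi,
   evaluated on u, v: linear in u, antilinear in v *)
Definition ddbar phi x u v : R[i] := wderiv (wderivbar phi v) u x.

End Derivatives.

(* C^oo in the real sense *)
Definition smooth_on (R : realType) n (A : set 'rV[R[i]]_n)
    (phi : 'rV[R[i]]_n -> R[i]) : Prop :=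
  forall (s : seq 'rV[R[i]]_n) (x : 'rV[R[i]]_n), A x ->
    let psi := foldr (fun v f => rderiv f v) phi s in
    {for x, continuous psi} /\ forall v, rderivable psi v x.

(* \sum_(j, k) A_jk u_j \bar v_k *)
Definition herm (R : realType) n (A : 'M[R[i]]_n) (u v : 'rV[R[i]]_n) : R[i] :=
  (u *m A *m (map_mx (@conjc R) v)^T) 0 0.

Record chart (R : realType) (T : topologicalType) (n : nat) := Chart {
  cdom : set T;
  ccoord : T -> 'rV[R[i]]_n;
  cpoint : 'rV[R[i]]_n -> T }.

Definition image_of (R : realType) (T : topologicalType) n (c : chart R T n) :
  set 'rV[R[i]]_n := ccoord c @` cdom c.

Definition is_chart (R : realType) (T : topologicalType) n (c : chart R T n) :
    Prop :=
  [/\ open (cdom c), open (image_of c),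
      forall p, cdom c p -> cpoint c (ccoord c p) = p,
      {within cdom c, continuous (ccoord c)} &
      {within image_of c, continuous (cpoint c)}].

Definition transition (R : realType) (T : topologicalType) n
  (c e : chart R T n) : 'rV[R[i]]_n -> 'rV[R[i]]_n := ccoord e \o cpoint c.

Definition compatible (R : realType) (T : topologicalType) n
    (c e : chart R T n) : Prop :=
  forall p, cdom c p -> cdom e p ->
    differentiable (transition c e) (ccoord c p) /\
    differentiable (transition e c) (ccoord e p).

Record complexManifold (R : realType) (n : nat) := ComplexManifold {
  carrier :> topologicalType;
  atlas : set (chart R carrier n);
  manifold_hausdorff : hausdorff_space carrier;
  manifold_second_countable : @second_countable carrier;
  manifold_nonempty : [set: carrier] !=set0;
  manifold_connected : connected [set: carrier];
  atlas_chart : forall c, atlas c -> is_chart c;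
  atlas_cover : forall p : carrier, exists2 c, atlas c & cdom c p;
  atlas_compatible : forall c e, atlas c -> atlas e -> compatible c e }.

Arguments atlas {R n} _.

Definition global_coordinates (R : realType) n (M : complexManifold R n)
    (z : chart R M n) : Prop :=
  [/\ is_chart z, cdom z = [set: M] &
      forall c, atlas M c -> compatible c z].

(* A Hermitian metric by its components: g c p is the matrix (g_{j \bar k}(p))
   in the chart c; it is only meaningful for c in the atlas and p in cdom c.
   The Kahler form is (i/2) \sum g_{j \bar k} dz_j /\ d\bar z_k and the
   Riemannian metric is Re \sum g_{j \bar k} dz_j d\bar z_k. *)
Definition hmetric (R : realType) n (M : complexManifold R n) : Type :=
  chart R M n -> M -> 'M[R[i]]_n.

Definition metric_entry (R : realType) n (M : complexManifold R n)
    (g : hmetric M) (c : chart R M n) (j k : 'I_n) : 'rV[R[i]]_n -> R[i] :=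
  fun x => g c (cpoint c x) j k.

(* The last field is the closedness of the Kahler form. *)
Record kahler (R : realType) n (M : complexManifold R n) (g : hmetric M) :
    Prop := Kahler {
  kahler_transition : forall c e p, atlas M c -> atlas M e -> cdom c p ->
    cdom e p -> forall u v,
    herm (g c p) u v = herm (g e p) ('d (transition c e) (ccoord c p) u)
                                    ('d (transition c e) (ccoord c p) v);
  kahler_hermitian : forall c p, atlas M c -> cdom c p -> forall j k,
    g c p j k = conjc (g c p k j);
  kahler_posdef : forall c p, atlas M c -> cdom c p -> forall u, u != 0 ->
    0 < herm (g c p) u u;
  kahler_smooth : forall c, atlas M c -> forall j k,
    smooth_on (image_of c) (metric_entry g c j k);
  kahler_closed : forall c p, atlas M c -> cdom c p -> forall j k l,
    wderiv (metric_entry g c j k) (delta_mx 0 l) (ccoord c p) =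
    wderiv (metric_entry g c l k) (delta_mx 0 j) (ccoord c p) }.

Definition scale_metric (R : realType) n (M : complexManifold R n) (a : R)
  (g : hmetric M) : hmetric M := fun c p => a%:C *: g c p.

Definition in_charts (R : realType) m n (M : complexManifold R m)
    (N : complexManifold R n) (c : chart R M m) (e : chart R N n)
    (f : M -> N) : 'rV[R[i]]_m -> 'rV[R[i]]_n := ccoord e \o f \o cpoint c.

Definition holomorphic (R : realType) m n (M : complexManifold R m)
    (N : complexManifold R n) (f : M -> N) : Prop :=
  continuous f /\
  forall c e p, atlas M c -> atlas N e -> cdom c p -> cdom e (f p) ->
    differentiable (in_charts c e f) (ccoord c p).

Definition isometric (R : realType) m n (M : complexManifold R m)
    (N : complexManifold R n) (g : hmetric M) (h : hmetric N) (f : M -> N) :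
    Prop :=
  forall c e p, atlas M c -> atlas N e -> cdom c p -> cdom e (f p) ->
  forall u v,
    herm (g c p) u v = herm (h e (f p)) ('d (in_charts c e f) (ccoord c p) u)
                                        ('d (in_charts c e f) (ccoord c p) v).

(* A common Kahler submanifold is given by its two inclusions. They are
   immersions because they are isometric for positive definite metrics;
   submanifolds are only required to be injectively immersed, which includes
   the embedded ones. *)
Definition relatives (R : realType) m n (M : complexManifold R m)
    (g : hmetric M) (N : complexManifold R n) (h : hmetric N) : Prop :=
  exists (s : nat) (S : complexManifold R s) (k : hmetric S)
         (i1 : S -> M) (i2 : S -> N),
    [/\ (0 < s)%N, kahler k,
        [/\ injective i1, holomorphic i1 & isometric k g i1] &
        [/\ injective i2, holomorphic i2 & isometric k h i2]].

Section ProjectiveSpace.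
Context {R : realType}.

Section AnyDimension.
(* Homogeneous coordinates are indexed by I: CP^N is the case I = 'I_N.+1 and
   CP^oo the case I = nat. *)
Context {I : choiceType}.
Implicit Types (z Z : I -> R[i]).

Definition ell2 : set (I -> R[i]) :=
  [set z | (\esum_(i in [set: I]) ((Normc.normc (z i) ^+ 2)%:E) < +oo)%E].

(* meaningful on ell2 *)
Definition normsq z : R :=
  fine (\esum_(i in [set: I]) ((Normc.normc (z i) ^+ 2)%:E)).

Record cproj := CProj {
  cline : set (I -> R[i]);
  clineP : exists Z, [/\ ell2 Z, Z <> 0 &
                        cline = [set a *: Z | a in [set: R[i]]]] }.

Definition cproj_dom (k : I) : set cproj :=
  [set L | exists2 Z, cline L Z & Z k <> 0].

(* The affine coordinates Z_i / Z_k, i <> k, on {Z_k <> 0}, completed by 0 at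
   the index k. *)
Definition aff_coord (k : I) (L : cproj) : I -> R[i] :=
  let Z := xget 0 [set Z | cline L Z /\ Z k <> 0] in
  fun i => if i == k then 0 else Z i / Z k.

(* potential log (1 + \sum_(i <> k) |z_i|^2) in affine coordinates *)
Definition fs_potential z : R[i] := (ln (1 + normsq z))%:C.

Definition fubini_study z (u v : I -> R[i]) : R[i] := ddbar fs_potential z u v.

(* D is the (Frechet) complex differential at x of F : C^n -> ell2 *)
Definition is_diff_ell2 n (F : 'rV[R[i]]_n -> I -> R[i]) (x : 'rV[R[i]]_n)
    (D : {linear 'rV[R[i]]_n -> (I -> R[i])}) : Prop :=
  (forall v, ell2 (D v)) /\
  forall e : R, 0 < e -> \forall y \near x,
    ell2 (F y) /\
    (Num.sqrt (normsq (F y - F x - D (y - x))))%:C <= e%:C * `|y - x|.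

(* On the open set A, f is holomorphic and pulls the Fubini-Study metric back
   to g; it is then an immersion as soon as g is positive definite. *)
Definition kahler_immersion_on n (M : complexManifold R n) (g : hmetric M)
    (A : set M) (f : M -> cproj) : Prop :=
  forall c k p, atlas M c -> A p -> cdom c p -> cproj_dom k (f p) ->
    (\forall q \near p, cproj_dom k (f q)) /\
    exists D : {linear 'rV[R[i]]_n -> (I -> R[i])},
      is_diff_ell2 (aff_coord k \o f \o cpoint c) (ccoord c p) D /\
      forall u v,
        herm (g c p) u v = fubini_study (aff_coord k (f p)) (D u) (D v).

End AnyDimension.

Arguments cproj : clear implicits.

Definition span_ell2 m (b : 'I_m -> nat -> R[i]) : set (nat -> R[i]) :=
  [set Z | exists a : 'I_m -> R[i], Z = \sum_(l < m) a l *: b l].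

(* f(A) is not contained in a finite dimensional projective subspace *)
Definition full_on (T : Type) (A : set T) (f : T -> cproj nat) : Prop :=
  ~ exists (m : nat) (b : 'I_m -> nat -> R[i]),
      (forall l, ell2 (b l)) /\
      forall p, A p -> cline (f p) `<=` span_ell2 b.

Definition kahler_immersion_CPoo n (M : complexManifold R n) (g : hmetric M)
  (f : M -> cproj nat) : Prop := kahler_immersion_on g [set: M] f.

Definition infinite_projectively_induced n (M : complexManifold R n)
    (g : hmetric M) : Prop :=
  exists f : M -> cproj nat, kahler_immersion_CPoo g f /\ full_on [set: M] f.

(* the submanifold M_j *)
Definition axis n (M : complexManifold R n) (z : chart R M n) (j : 'I_n) :
  set M := [set p | forall k, k != j -> ccoord z p 0 k = 0].

Definition transversally_full n (M : complexManifold R n) (z : chart R M n)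
    (f : M -> cproj nat) : Prop :=
  forall j, full_on (axis z j) f.

Definition projective_kahler n (M : complexManifold R n) (g : hmetric M) :
    Prop :=
  kahler g /\
  exists N : nat, forall p : M, exists2 U, open_nbhs p U &
    exists f : M -> cproj 'I_N.+1, kahler_immersion_on g U f.

End ProjectiveSpace.

(* Main.v *)
Require Import Defs.
From mathcomp Require Import all_boot all_order all_algebra.
From mathcomp Require Import all_classical all_reals all_analysis complex.
From mathcomp Require Import ring lra.
Set Implicit Arguments.
Unset Strict Implicit.
Unset Printing Implicit Defensive.
Import Order.TTheory GRing.Theory Num.Theory numFieldNormedType.Exports.
Local Open Scope classical_set_scope.
Local Open Scope ring_scope.
Local Open Scope complex_scope.

(** A common submanifold of (M, c g) and of a projective manifold contains a
    holomorphic disc. On that disc let lam be the conformal factor of the induced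
    metric. The immersions of (M, alpha g), for alpha >= alpha0, and the one of
    the projective manifold are read along the disc as holomorphic curves H_beta
    of square-summable sequences (homogeneous coordinates), for all
    beta >= b := alpha0 / c, and P of finitely many coordinates; the
    Fubini-Study metric pulls back to beta lam along H_beta and to lam along P.

    Write K(z, w) = <H_beta(z), H_beta(w)>, and let A_beta be this kernel
    rescaled so that A_beta(z, 0) = A_beta(0, w) = 1 (Calabi's diastasis in
    Bochner's gauge). Polarization of the metric identity determines the mixed
    logarithmic derivative of K, hence the logarithmic derivative in z of A_beta
    is beta times a function e that does not depend on beta
    ([bochner_logder_eq]). It follows that A_beta A_gamma = A_1 ^ m when
    beta + gamma = m is an integer ([normalized_kernel_mul]), and that
    A_beta / A_b is a power of one function Q when beta - b is a multiple of
    some fixed delta.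

    All the A_beta are positive kernels, and A_1 ^ m is a sum of D rank one
    kernels since P has finitely many coordinates ([finite_rank]). Choose D + 1
    points and a vector v <> 0 annihilating these D functions. By Schur's product
    theorem applied to A_beta (A_gamma - 1) >= 0, the vector v is isotropic for
    A_beta as well ([isotropic_factor]): it kills A_beta(., w) for every w and
    all beta in [b, m - b]. So it kills the powers A_b Q ^ q, q = 0, ..., D, at
    points where Q takes distinct values, and a Vandermonde determinant gives
    v = 0 ([no_continuum_of_exponents]).

    The analysis behind this is the following. A complex differentiable function
    with a bounded derivative satisfies Cauchy's formula, the integrals over
    homotopic circles being compared by differentiation under the integral sign
    ([integral_homotopy], [cauchy_Re]). Cauchy's formula yields estimates that
    depend on a bound of the function only ([regularity]); by duality they pass
    to curves of square-summable sequences ([curve_regularity]), which are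
    therefore twice differentiable with uniform quadratic remainders. With such
    remainders the chain of arguments above needs no power series: functions
    with zero derivative are constant ([qdiff_const]) and functions vanishing on
    a real segment vanish ([qdiff_identity]). *)

(** * The real modulus *)

(** The norm of a complex number is itself an element of R[i]; all estimates
    are made on this real number instead. *)
Definition cmod (R : realType) (x : R[i]) : R := Normc.normc x.
Local Notation Rec := complex.Re.
Local Notation Imc := complex.Im.

Local Notation "x ^bar" := (conjc x) (at level 2, format "x ^bar") : ring_scope.

Local Notation ci := (Complex 0 1).

Section Modulus.
Context {R : realType}.
Implicit Types (x y z : R[i]) (r : R).

Lemma cmod0 : cmod (0 : R[i]) = 0.
Proof. exact: Normc.normc0. Qed.

Lemma cmod1 : cmod (1 : R[i]) = 1.
Proof. exact: Normc.normc1. Qed.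

Lemma cmodM x y : cmod (x * y) = cmod x * cmod y.
Proof. exact: Normc.normcM. Qed.

Lemma cmodV x : cmod x^-1 = (cmod x)^-1.
Proof. exact: Normc.normcV. Qed.

Lemma cmodX x n : cmod (x ^+ n) = cmod x ^+ n.
Proof. by elim: n => [|n IHn]; rewrite ?expr0 ?cmod1// !exprS cmodM IHn. Qed.

Lemma cmodN x : cmod (- x) = cmod x.
Proof. exact: normcN. Qed.

Lemma cmodD x y : cmod (x + y) <= cmod x + cmod y.
Proof. exact: le_normcD. Qed.

Lemma cmodB x y : cmod (x - y) <= cmod x + cmod y.
Proof. by rewrite (le_trans (cmodD _ _))// cmodN. Qed.

Lemma cmodC x y : cmod (x - y) = cmod (y - x).
Proof. by rewrite -cmodN opprB. Qed.

Lemma cmod_ge0 x : 0 <= cmod x.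
Proof. by rewrite /cmod; case: x => a b; exact: sqrtr_ge0. Qed.

Lemma cmod_eq0 x : (cmod x == 0) = (x == 0).
Proof.
by apply/eqP/eqP => [/(@Normc.eq0_normc R)|->]; rewrite ?cmod0.
Qed.

Lemma cmod_gt0 x : (0 < cmod x) = (x != 0).
Proof. by rewrite lt0r cmod_ge0 andbT cmod_eq0. Qed.

Lemma cmod_real r : cmod r%:C = `|r|.
Proof. by rewrite /cmod /= expr0n/= addr0 sqrtr_sqr. Qed.

Lemma cmod_sqr x : cmod x ^+ 2 = Rec x ^+ 2 + Imc x ^+ 2.
Proof. by rewrite /cmod; case: x => a b /=; rewrite sqr_sqrtr// addr_ge0 ?sqr_ge0. Qed.

Lemma Re_le_cmod x : `|Rec x| <= cmod x.
Proof.
by rewrite -(@ler_pXn2r _ 2)// ?nnegrE ?cmod_ge0// cmod_sqr real_normK ?num_real// lerDl sqr_ge0.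
Qed.

Lemma Im_le_cmod x : `|Imc x| <= cmod x.
Proof.
by rewrite -(@ler_pXn2r _ 2)// ?nnegrE ?cmod_ge0// cmod_sqr real_normK ?num_real// lerDr sqr_ge0.
Qed.

Lemma cmod_le_ReIm x : cmod x <= `|Rec x| + `|Imc x|.
Proof.
rewrite -(@ler_pXn2r _ 2)// ?nnegrE ?cmod_ge0 ?addr_ge0// cmod_sqr sqrrD !real_normK ?num_real//.
by rewrite -addrA lerD2l lerDr mulrn_wge0// mulr_ge0.
Qed.

Lemma cmodJ x : cmod x^bar = cmod x.
Proof. by rewrite /cmod; case: x => a b /=; rewrite sqrrN. Qed.

Lemma cJK x : x^bar^bar = x. Proof. exact: conjcK. Qed.

Lemma cJM x y : (x * y)^bar = x^bar * y^bar. Proof. exact: rmorphM. Qed.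

Lemma cJV x : (x^-1)^bar = (x^bar)^-1. Proof. exact: fmorphV. Qed.

Lemma mulcJ x : x * x^bar = (cmod x ^+ 2)%:C.
Proof. by rewrite cmod_sqr; case: x => a b; congr (_ +i* _) => /=; ring. Qed.

Lemma cmod_normr x : `|x| = (cmod x)%:C.
Proof. by case: x. Qed.

Lemma cmod_sum (I : Type) (s : seq I) (P : pred I) (F : I -> R[i]) :
  cmod (\sum_(i <- s | P i) F i) <= \sum_(i <- s | P i) cmod (F i).
Proof.
elim/big_ind2 : _ => [|x1 x2 y1 y2 h1 h2|//]; first by rewrite cmod0.
by rewrite (le_trans (cmodD _ _))// lerD.
Qed.

Lemma cmodBD x y z : cmod (x - z) <= cmod (x - y) + cmod (y - z).
Proof. by rewrite (le_trans _ (cmodD _ _))// addrA subrK. Qed.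

Lemma cReD x y : Rec (x + y) = Rec x + Rec y. Proof. by case: x; case: y. Qed.
Lemma cImD x y : Imc (x + y) = Imc x + Imc y. Proof. by case: x; case: y. Qed.
Lemma cReN x : Rec (- x) = - Rec x. Proof. by case: x. Qed.
Lemma cImN x : Imc (- x) = - Imc x. Proof. by case: x. Qed.
Lemma cReB x y : Rec (x - y) = Rec x - Rec y. Proof. by rewrite cReD cReN. Qed.
Lemma cImB x y : Imc (x - y) = Imc x - Imc y. Proof. by rewrite cImD cImN. Qed.
Lemma cReM x y : Rec (x * y) = Rec x * Rec y - Imc x * Imc y.
Proof. by case: x; case: y. Qed.
Lemma cImM x y : Imc (x * y) = Rec x * Imc y + Imc x * Rec y.
Proof. by case: x; case: y. Qed.
Lemma cReZ r x : Rec (r%:C * x) = r * Rec x.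
Proof. by rewrite cReM mul0r subr0. Qed.
Lemma cImZ r x : Imc (r%:C * x) = r * Imc x.
Proof. by rewrite cImM mul0r addr0. Qed.
Lemma cReJ x : Rec x^bar = Rec x. Proof. by case: x. Qed.
Lemma cImJ x : Imc x^bar = - Imc x. Proof. by case: x. Qed.
Lemma cIm_i x : Imc (ci * x) = Rec x.
Proof. by rewrite cImM /=; ring. Qed.
Lemma cRe_i x : Rec (ci * x) = - Imc x.
Proof. by rewrite cReM /=; ring. Qed.

Lemma cRe_real r : Rec r%:C = r. Proof. by []. Qed.

Lemma cIm_real r : Imc r%:C = 0. Proof. by []. Qed.

Lemma rcM r (t : R) : (r * t)%:C = r%:C * t%:C :> R[i]. Proof. exact: rmorphM. Qed.
Lemma rcN r : (- r)%:C = - r%:C :> R[i]. Proof. exact: rmorphN. Qed.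
Lemma rcV r : (r^-1)%:C = (r%:C)^-1 :> R[i]. Proof. exact: fmorphV. Qed.
Lemma rc_nat n : (n%:R : R)%:C = n%:R :> R[i]. Proof. exact: rmorph_nat. Qed.

Lemma complex_ext x y : Rec x = Rec y -> Imc x = Imc y -> x = y.
Proof. by case: x => a b; case: y => a' b' /= -> ->. Qed.

Lemma cRe_sum (I : Type) (s : seq I) (P : pred I) (F : I -> R[i]) :
  Rec (\sum_(i <- s | P i) F i) = \sum_(i <- s | P i) Rec (F i).
Proof. by apply: (big_morph _ cReD). Qed.

Lemma cIm_sum (I : Type) (s : seq I) (P : pred I) (F : I -> R[i]) :
  Imc (\sum_(i <- s | P i) F i) = \sum_(i <- s | P i) Imc (F i).
Proof. by apply: (big_morph _ cImD). Qed.

Lemma cmod_eq0P x : (forall e : R, 0 < e -> cmod x <= e) -> x = 0.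
Proof.
move=> h; apply/eqP; rewrite -cmod_eq0 eq_le cmod_ge0 andbT.
apply/ler_addgt0Pr => e /h; by rewrite add0r.
Qed.

Lemma cmod_eq0_quad x (C d : R) : 0 < d ->
  (forall t : R, 0 < t -> t < d -> t * cmod x <= C * t ^+ 2) -> x = 0.
Proof.
move=> d0 h; apply: cmod_eq0P => e e0.
have C1 : 0 < `|C| + 1 by rewrite ltr_pwDr.
pose t := Num.min (d / 2) (e / (`|C| + 1)).
have t0 : 0 < t by rewrite lt_min !divr_gt0.
have td : t < d by rewrite gt_min; apply/orP; left; lra.
have := h t t0 td; rewrite expr2 mulrCA -subr_ge0 -mulrBr pmulr_rge0// subr_ge0 => /le_trans; apply.
have : C * t <= (`|C| + 1) * t by rewrite ler_pM2r//; have := ler_norm C; lra.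
move/le_trans; apply.
by rewrite mulrC -ler_pdivlMr// ge_min lexx orbT.
Qed.

End Modulus.

(** * Integrals over a period *)

Section RealDerivatives.
Context {R : realType}.
Implicit Types (f g : R -> R) (t l : R).

(** The Frechet form of the derivative in one real variable, which composes
    with complex differentiability without dividing by increments. *)
Lemma is_deriveP f t l : is_derive t 1 f l <->
  (forall e : R, 0 < e -> exists2 d : R, 0 < d & forall s, `|s - t| < d ->
     `|f s - f t - (s - t) * l| <= e * `|s - t|).
Proof.
split=> [[df dfl] e e0|h].
  have /cvgrPdist_le /(_ e e0) : h^-1 *: (f (h *: 1 + t) - f t) @[h --> 0^'] --> l.
    by rewrite -dfl; exact: df.
  move=> [d /= d0 hd]; exists d => // s sd.
  have [->|st] := eqVneq s t; first by rewrite !subrr mul0r subr0 normr0 mulr0.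
  have st0 : s - t != 0 by rewrite subr_eq0.
  have := hd (s - t); rewrite /= sub0r normrN => /(_ sd st0).
  rewrite /GRing.scale /= mulr1 subrK => H.
  rewrite -[f s - f t](mulVKf st0) -mulrBr normrM mulrC ler_wpM2r//.
  by rewrite distrC.
have dl : h^-1 *: (f (h *: 1 + t) - f t) @[h --> 0^'] --> l.
  apply/cvgrPdist_le => e e0; have [d d0 hd] := h e e0.
  exists d => //= s; rewrite /= sub0r normrN => sd s0.
  have := hd (s + t); rewrite addrK => /(_ sd).
  rewrite /GRing.scale /= mulr1 => H.
  rewrite distrC -(ler_pM2r (x := `|s|)) ?normr_gt0// -normrM mulrBl mulrAC mulVf// mul1r.
  by rewrite [l * _]mulrC.
apply: DeriveDef; first by apply/cvg_ex; exists l.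
exact/cvg_lim.
Qed.

End RealDerivatives.

Section PeriodicIntegral.
Context {R : realType}.
Implicit Types (g : R -> R).
Local Notation mu := (@lebesgue_measure R).
Local Notation T := (pi *+ 2 : R).

Lemma twopi_gt0 : 0 < T.
Proof. by rewrite mulrn_wgt0// pi_gt0. Qed.

Lemma cont_integrable g a b : continuous g -> mu.-integrable `[a, b] (EFin \o g).
Proof.
move=> cg; apply: continuous_compact_integrable; first exact: segment_compact.
exact: continuous_subspaceT.
Qed.

Lemma integral_shift g s a b : a <= b -> continuous g ->
  \int[mu]_(x in `[(a + s)%R, (b + s)%R]) g x = \int[mu]_(x in `[a, b]) g (x + s).
Proof.
move=> ab cg; rewrite /Rintegral.
have dF (x : R) : is_derive x (1 : R) (fun x : R => x + s) (1 : R).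
  by rewrite -[X in is_derive _ _ _ X]addr0; apply: is_deriveD.
have F' : derive1 (fun x : R => x + s) = cst 1.
  by apply/funext => x; rewrite derive1E; case: (dF x).
have cF : continuous (fun x : R => x + s).
  by move=> x; apply: cvgD; [exact: cvg_id|exact: cvg_cst].
rewrite (@integration_by_substitution_increasing R (fun x => x + s) g a b)//.
- by congr fine; apply: eq_integral => x _; rewrite F' /= mulr1.
- by move=> x y _ _ xy; rewrite ltrD2r.
- by rewrite F' => x _; exact: cvg_cst.
- by rewrite F'; exact: is_cvg_cst.
- by rewrite F'; exact: is_cvg_cst.
- split; first by move=> x _; case: (dF x).
  + by apply: cvg_at_right_filter; exact: cF.
  + by apply: cvg_at_left_filter; exact: cF.
- exact: continuous_subspaceT.
Qed.

Lemma integral_split g a b c : a <= b -> b <= c -> continuous g ->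
  \int[mu]_(x in `[a, c]) g x =
  \int[mu]_(x in `[a, b]) g x + \int[mu]_(x in `[b, c]) g x.
Proof.
move=> ab bc cg.
have := @Rintegral_itvB R g (BLeft a) (BRight c) b (cont_integrable a c cg).
rewrite !bnd_simp => /(_ ab bc) h.
have e : \int[mu]_(x in `]b, c]) g x = \int[mu]_(x in `[b, c]) g x.
  apply: Rintegral_itv_obnd_cbnd.
  apply: integrableS (cont_integrable b c cg) => //.
  by apply: subset_itvr; rewrite bnd_simp.
by rewrite -e -h addrC subrK.
Qed.

Lemma integral_periodic_shift g s : continuous g -> (forall x, g (x + T) = g x) ->
  \int[mu]_(x in `[0, T]) g (x + s) = \int[mu]_(x in `[0, T]) g x.
Proof.
have T0 := ltW twopi_gt0.
suff main (h : R -> R) (r : R) : 0 <= r -> continuous h -> (forall x, h (x + T) = h x) ->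
    \int[mu]_(x in `[0, T]) h (x + r) = \int[mu]_(x in `[0, T]) h x.
  move=> cg gT; have [s0|s0] := leP 0 s; first exact: main.
  have := main (fun x => g (x + s)) (- s); rewrite oppr_ge0 => /(_ (ltW s0)).
  under eq_Rintegral do rewrite subrK.
  move=> <- //; first by move=> x; apply: continuous_comp; [apply: cvgD; [exact: cvg_id|exact: cvg_cst]|exact: cg].
  by move=> x; rewrite addrAC gT.
move=> r0 ch hT.
rewrite -(@integral_shift h r 0 T)// add0r.
have := integral_split T0 (_ : T <= T + r) ch; rewrite lerDl => /(_ r0).
have rT : r <= T + r by rewrite lerDr.
rewrite (integral_split r0 rT ch).
have -> : \int[mu]_(x in `[T, (T + r)%R]) h x = \int[mu]_(x in `[0, r]) h x.
  rewrite -[X in `[X, _]](add0r T) [T + r]addrC integral_shift//.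
  by apply: eq_Rintegral => x _; rewrite hT.
by rewrite [RHS]addrC => /addrI.
Qed.

Lemma is_derive_continuous g g' : (forall x : R, is_derive x 1 g (g' x)) -> continuous g.
Proof.
by move=> dg x; apply: differentiable_continuous; apply/derivable1_diffP; case: (dg x).
Qed.

(** The integrals of the difference quotients vanish by translation invariance,
    and the bound on the derivative lets them pass to the limit. *)
Lemma integral_derive_periodic g g' B : (forall x : R, is_derive x 1 g (g' x)) ->
  (forall x, `|g' x| <= B) -> (forall x, g (x + T) = g x) ->
  \int[mu]_(x in `[0, T]) g' x = 0.
Proof.
move=> dg Bg' gT; have cg := is_derive_continuous dg.
have shc s : continuous (fun x => g (x + s)).
  by move=> x; apply: continuous_comp; [apply: cvgD; [exact: cvg_id|exact: cvg_cst]|exact: cg].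
have dgs (y s : R) : is_derive s 1 (fun s => g (y + s)) (g' (y + s)).
  apply/is_deriveP => e e0; have [d d0 hd] := (is_deriveP _ _ _).1 (dg (y + s)) e e0.
  exists d => // r rs; have E : r - s = (y + r) - (y + s) by ring.
  by rewrite E; apply: hd; rewrite -E.
pose f s x := g (x + s).
have d1f s x : partial1of2 f s x = g' (x + s).
  by rewrite partial1of2E /f; case: (dgs x s).
have := @cvg_differentiation_under_integral R _ _ mu f `[0, T] (measurable_itv _) 0 (-1) 1.
have I0 : `]-1, 1[%classic (0 : R) by rewrite /= in_itv/= ltrN10 ltr01.
have B0 : 0 <= B by rewrite (le_trans _ (Bg' 0)).
move=> /(_ I0 _ _ (cst B)) H.
have {}H := H (fun s _ => cont_integrable 0 T (shc s)) (fun s x _ _ => (dgs x s).(ex_derive)) (fun=> B0).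
have cB : continuous (cst B : R -> R) by move=> x; exact: cvg_cst.
have {}H := H (cont_integrable 0 T cB).
have /H/cvg_lim {}H : forall s x, `]-1, 1[%classic s -> `[0, T]%classic x ->
    `|partial1of2 f s x| <= cst B x by move=> s x _ _; rewrite d1f.
have <- : \int[mu]_(x in `[0, T]) partial1of2 f 0 x = \int[mu]_(x in `[0, T]) g' x.
  by apply: eq_Rintegral => x _; rewrite d1f addr0.
rewrite -H//.
rewrite [X in lim (X @ _)](_ : _ = cst 0) ?lim_cst//.
apply/funext => h; rewrite /f !integral_periodic_shift//.
by rewrite subrr scaler0.
Qed.

(** If the velocity of the homotopy u is an x-derivative of a periodic
    function, then the integral over a period does not move. The parameter
    ranges over a neighbourhood of [0, 1], so that the end points are interior. *)
Lemma integral_homotopy (u v G : R -> R -> R) (B : R) :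
  (forall t x : R, -1 < t < 2 -> is_derive t 1 (u^~ x) (v t x)) ->
  (forall t x : R, -1 < t < 2 -> is_derive x 1 (G t) (v t x)) ->
  (forall t x : R, -1 < t < 2 -> `|v t x| <= B) ->
  (forall t x : R, -1 < t < 2 -> G t (x + T) = G t x) ->
  (forall t : R, -1 < t < 2 -> continuous (u t)) ->
  \int[mu]_(x in `[0, T]) u 0 x = \int[mu]_(x in `[0, T]) u 1 x.
Proof.
move=> du dG vB GT cu.
have B0 : 0 <= B by rewrite (le_trans _ (vB 0 0 _))//; lra.
pose F t := \int[mu]_(x in `[0, T]) u t x.
have dF (t : R) : -1 < t < 2 -> is_derive t 1 F 0.
  move=> tI.
  have d1 (s x : R) : -1 < s < 2 -> partial1of2 u s x = v s x.
    by move=> sI; rewrite partial1of2E; case: (du s x sI).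
  have I0 : `]-1, 2[%classic t by rewrite /= in_itv.
  have := @cvg_differentiation_under_integral R _ _ mu u `[0, T] (measurable_itv _) t (-1) 2 I0.
  have e1 s : `]-1, 2[%classic s -> mu.-integrable `[0, T] (EFin \o u s).
    by rewrite /= in_itv/= => sI; exact: cont_integrable 0 T (cu s sI).
  have e2 s x : `]-1, 2[%classic s -> `[0, T]%classic x -> derivable (u^~ x) s 1.
    by rewrite /= in_itv/= => sI _; case: (du s x sI).
  have cB : continuous (cst B : R -> R) by move=> x; exact: cvg_cst.
  move=> /(_ e1 e2 (cst B) (fun=> B0) (cont_integrable 0 T cB)).
  have e3 s x : `]-1, 2[%classic s -> `[0, T]%classic x -> `|partial1of2 u s x| <= cst B x.
    by rewrite /= in_itv/= => sI _; rewrite d1// vB.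
  move=> /(_ e3).
  have -> : \int[mu]_(x in `[0, T]) partial1of2 u t x = 0.
    have E := @integral_derive_periodic (G t) (v t) B (fun x => dG t x tI)
      (fun x => vB t x tI) (fun x => GT t x tI).
    by rewrite -[RHS]E; apply: eq_Rintegral => x _; rewrite d1.
  move=> H; apply: DeriveDef.
    apply/cvg_ex; exists 0; apply: cvg_trans H.
    by under [X in _ `=>` X @ _]eq_fun do rewrite -[X in X + t](mulr1 _).
  apply/cvg_lim => //; apply: cvg_trans H.
  by under [X in _ `=>` X @ _]eq_fun do rewrite -[X in X + t](mulr1 _).
have dF01 (x : R) : x \in `]0, 1[%R -> is_derive x 1 F (cst 0 x).
  by rewrite in_itv/= => xI; apply: dF; lra.
have cF01 : {within `[0, 1], continuous F}.
  apply: derivable_within_continuous => x; rewrite in_itv/= => xI.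
  by have [] := dF x _; [lra|].
have [c _ /eqP] := MVT ltr01 dF01 cF01.
by rewrite mul0r subr_eq0 => /eqP/esym.
Qed.

End PeriodicIntegral.

(** * Cauchy's formula *)

Section ComplexDerivatives.
Context {R : realType}.
Implicit Types (f : R[i] -> R[i]) (c : R -> R[i]) (t : R) (z d : R[i]).

Definition has_deriv f z d := forall e : R, 0 < e -> exists2 del : R, 0 < del &
  forall w, cmod (w - z) < del -> cmod (f w - f z - (w - z) * d) <= e * cmod (w - z).

Definition path_deriv c t d := is_derive t 1 (fun s => Rec (c s)) (Rec d) /\
  is_derive t 1 (fun s => Imc (c s)) (Imc d).

Lemma path_derivP c t d : path_deriv c t d <-> forall e : R, 0 < e ->
  exists2 del : R, 0 < del & forall s, `|s - t| < del ->
    cmod (c s - c t - (s - t)%:C * d) <= e * `|s - t|.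
Proof.
split=> [[/is_deriveP h1 /is_deriveP h2] e e0|h].
  have e2 : 0 < e / 2 by lra.
  have [d1 d10 {}h1] := h1 _ e2; have [d2 d20 {}h2] := h2 _ e2.
  exists (Num.min d1 d2); first by rewrite lt_min d10.
  move=> s; rewrite lt_min => /andP[/h1 {}h1 /h2 {}h2].
  rewrite (le_trans (cmod_le_ReIm _))// !(cReB, cImB) cReZ cImZ.
  have -> : e * `|s - t| = e / 2 * `|s - t| + e / 2 * `|s - t| by field.
  exact: lerD.
split; apply/is_deriveP => e /h [del del0 H]; exists del => // s /H {}H.
- by apply: le_trans H; rewrite -cReZ -!cReB Re_le_cmod.
- by apply: le_trans H; rewrite -cImZ -!cImB Im_le_cmod.
Qed.

Lemma path_deriv_cst d t : path_deriv (fun=> d) t 0.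
Proof. by split; exact: is_derive_cst. Qed.

Lemma path_derivM c1 c2 t d1 d2 : path_deriv c1 t d1 -> path_deriv c2 t d2 ->
  path_deriv (fun s => c1 s * c2 s) t (d1 * c2 t + c1 t * d2).
Proof.
move=> [a1 b1] [a2 b2]; split.
- rewrite (_ : (fun s => _) = (fun s => Rec (c1 s) * Rec (c2 s) - Imc (c1 s) * Imc (c2 s))); last first.
    by apply/funext => s; rewrite cReM.
  apply: is_derive_eq; rewrite cReD !cReM /GRing.scale/=; ring.
- rewrite (_ : (fun s => _) = (fun s => Rec (c1 s) * Imc (c2 s) + Imc (c1 s) * Rec (c2 s))); last first.
    by apply/funext => s; rewrite cImM.
  apply: is_derive_eq; rewrite cImD !cImM /GRing.scale/=; ring.
Qed.

Lemma path_derivD c1 c2 t d1 d2 : path_deriv c1 t d1 -> path_deriv c2 t d2 ->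
  path_deriv (fun s => c1 s + c2 s) t (d1 + d2).
Proof.
move=> [a1 b1] [a2 b2]; split.
- rewrite (_ : (fun s => _) = (fun s => Rec (c1 s) + Rec (c2 s))); last first.
    by apply/funext => s; rewrite cReD.
  by rewrite cReD; exact: is_deriveD.
- rewrite (_ : (fun s => _) = (fun s => Imc (c1 s) + Imc (c2 s))); last first.
    by apply/funext => s; rewrite cImD.
  by rewrite cImD; exact: is_deriveD.
Qed.

Lemma path_deriv_affine (a b : R[i]) c t d : path_deriv c t d -> path_deriv (fun s => a * c s + b) t (a * d).
Proof.
move=> dc; have := path_derivD (path_derivM (path_deriv_cst a t) dc) (path_deriv_cst b t).
by rewrite mul0r add0r addr0.
Qed.

Lemma path_deriv_real t : path_deriv (fun s => s%:C) t 1.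
Proof. by split; [exact: is_derive_id|exact: is_derive_cst]. Qed.

Lemma path_deriv_ext c c' t d d' : path_deriv c t d -> (forall s, c' s = c s) -> d' = d ->
  path_deriv c' t d'.
Proof. by move=> + /funext-> ->. Qed.

Lemma has_deriv_path f c t d g : has_deriv f (c t) d -> path_deriv c t g ->
  path_deriv (fun s => f (c s)) t (g * d).
Proof.
move=> df /path_derivP dc; apply/path_derivP => e e0.
have nd := cmod_ge0 d; have ng := cmod_ge0 g.
pose e1 := e / 2 / (cmod g + 1); pose e2 := Num.min 1 (e / 2 / (cmod d + 1)).
have e10 : 0 < e1 by rewrite !divr_gt0//; lra.
have e20 : 0 < e2 by rewrite lt_min ltr01 !divr_gt0//; lra.
have [d1 d10 {}df] := df _ e10; have [d2 d20 {}dc] := dc _ e20.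
pose d3 := d1 / (cmod g + 1).
have d30 : 0 < d3 by rewrite divr_gt0//; lra.
exists (Num.min d2 d3); first by rewrite lt_min d20.
move=> s; rewrite lt_min => /andP[/dc {}dc sd3].
have cs : cmod (c s - c t) <= (cmod g + 1) * `|s - t|.
  have -> : c s - c t = (c s - c t - (s - t)%:C * g) + (s - t)%:C * g by ring.
  rewrite (le_trans (cmodD _ _))// cmodM cmod_real.
  have : e2 * `|s - t| <= 1 * `|s - t| by rewrite ler_wpM2r// ge_min lexx.
  by move: dc; lra.
have cs1 : cmod (c s - c t) < d1.
  rewrite (le_lt_trans cs)// mulrC -ltr_pdivlMr//; lra.
have -> : f (c s) - f (c t) - (s - t)%:C * (g * d) =
  (f (c s) - f (c t) - (c s - c t) * d) + (c s - c t - (s - t)%:C * g) * d by ring.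
rewrite (le_trans (cmodD _ _))//.
have A : cmod (f (c s) - f (c t) - (c s - c t) * d) <= e / 2 * `|s - t|.
  rewrite (le_trans (df _ cs1))//.
  rewrite (le_trans (ler_wpM2l (ltW e10) cs))// mulrA /e1 divfK//; lra.
have B : cmod ((c s - c t - (s - t)%:C * g) * d) <= e / 2 * `|s - t|.
  rewrite cmodM (le_trans (ler_wpM2r nd dc))// mulrAC ler_wpM2r//.
  have : e2 * cmod d <= e / 2 / (cmod d + 1) * cmod d by rewrite ler_wpM2r// ge_min lexx orbT.
  move/le_trans; apply; rewrite -mulrA ler_piMr//; first lra.
  by rewrite mulrC ler_pdivrMr; lra.
lra.
Qed.

Lemma has_deriv_inv z : z != 0 -> has_deriv (fun w => w^-1) z (- (z ^- 2)).
Proof.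
move=> z0 e e0; have nz : 0 < cmod z by rewrite cmod_gt0.
pose dl := Num.min (cmod z / 2) (e * cmod z ^+ 3 / 2).
exists dl; first by rewrite lt_min !divr_gt0// mulr_gt0// exprn_gt0.
move=> w; rewrite lt_min => /andP[w1 w2].
have nw : cmod z / 2 <= cmod w.
  have : cmod z <= cmod w + cmod (w - z).
    by have := cmodBD z w 0; rewrite !subr0 (cmodC z w); lra.
  lra.
have w0 : w != 0 by rewrite -cmod_gt0; lra.
have -> : w^-1 - z^-1 - (w - z) * - z ^- 2 = (w - z) * ((w - z) / (w * z ^+ 2)).
  by field; rewrite w0 z0.
rewrite cmodM mulrC ler_wpM2r ?cmod_ge0// cmodM cmodV cmodM cmodX ler_pdivrMr; last by rewrite mulr_gt0 ?exprn_gt0//; lra.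
rewrite (le_trans (ltW w2))//.
have -> : e * cmod z ^+ 3 / 2 = e * (cmod z / 2 * cmod z ^+ 2) by field.
by apply: ler_wpM2l; [exact: ltW|apply: ler_wpM2r => //; rewrite ltW// exprn_gt0].
Qed.

Lemma path_deriv_continuous_Re c (g : R -> R[i]) : (forall t, path_deriv c t (g t)) ->
  continuous (fun t => Rec (c t)).
Proof.
by move=> h; apply: (@is_derive_continuous R _ (fun t => Rec (g t))) => x; case: (h x).
Qed.

Lemma path_deriv_continuous_Im c (g : R -> R[i]) : (forall t, path_deriv c t (g t)) ->
  continuous (fun t => Imc (c t)).
Proof.
by move=> h; apply: (@is_derive_continuous R _ (fun t => Imc (g t))) => x; case: (h x).
Qed.

End ComplexDerivatives.

Section CauchyFormula.
Context {R : realType}.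
Local Notation mu := (@lebesgue_measure R).
Local Notation T := (pi *+ 2 : R).

Definition cis (t : R) : R[i] := cos t +i* sin t.

Lemma cmod_cis t : cmod (cis t) = 1.
Proof. by rewrite /cmod /= cos2Dsin2 sqrtr1. Qed.

Lemma cis_periodic t : cis (t + T) = cis t.
Proof. by rewrite /cis cosD2pi sinD2pi. Qed.

Lemma path_deriv_cis t : path_deriv cis t (ci * cis t).
Proof.
split.
- by rewrite cRe_i /=; exact: is_derive_cos.
- by rewrite cIm_i /=; exact: is_derive_sin.
Qed.

(* The homotopy below has its parameter in ]-1, 2[, so it leaves the disc of
   radius r but stays in the disc of radius 4 r. *)
Variables (f f1 : R[i] -> R[i]) (r B : R).
Hypotheses (r0 : 0 < r)
  (df : forall z, cmod z < 4 * r -> has_deriv f z (f1 z))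
  (Bf1 : forall z, cmod z < 4 * r -> cmod (f1 z) <= B).

Local Notation zeta x := (r%:C * cis x).

Let cmod_zeta x : cmod (zeta x) = r.
Proof. by rewrite cmodM cmod_cis cmod_real mulr1 ger0_norm// ltW. Qed.

Let path_deriv_zeta x : path_deriv (fun x => zeta x) x (ci * zeta x).
Proof.
by apply: (path_deriv_ext (path_deriv_affine r%:C 0 (path_deriv_cis x))) => [s|]; ring.
Qed.

Let I_norm (t : R) : -1 < t < 2 -> `|t| <= 2 /\ `|1 - t| <= 2.
Proof. by move=> ?; rewrite !ler_norml; split; lra. Qed.

Section Point.
Variable z : R[i].
Hypothesis zr : cmod z < r / 2.

Let zeta_z (x t : R) : `|t| <= 2 -> zeta x - t%:C * z != 0.
Proof.
move=> t2; rewrite subr_eq0; apply/eqP => /(congr1 (@cmod R)).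
rewrite cmod_zeta cmodM cmod_real => rE.
have h : r <= 2 * cmod z by rewrite [X in X <= _]rE ler_wpM2r ?cmod_ge0.
have := zr; lra.
Qed.

Let zeta_z1 x : zeta x - z != 0.
Proof. by have := @zeta_z x 1; rewrite normr1 mul1r; apply; lra. Qed.

Let zeta_lb (x t : R) : `|t| <= 2 -> r - 2 * cmod z <= cmod (zeta x - t%:C * z).
Proof.
move=> t2; have := cmodBD (zeta x) (t%:C * z) 0; rewrite !subr0 cmod_zeta cmodM cmod_real.
have : `|t| * cmod z <= 2 * cmod z by rewrite ler_wpM2r ?cmod_ge0.
lra.
Qed.

(** The constant function 1: contract the pole to the centre. *)
Let cauchy_cst w : \int[mu]_(x in `[0, T]) Rec (w * (zeta x / (zeta x - z))) =
  Rec w * T.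
Proof.
pose c (t : R) x := zeta x - t%:C * z.
pose u (t : R) x := Rec (w * (zeta x / c t x)).
pose v (t : R) x := Rec (w * z * zeta x / c t x ^+ 2).
pose G (t : R) x := Imc (- (w * z) / c t x).
have dct t x : path_deriv (fun t => c t x) t (- z).
  by apply: (path_deriv_ext (path_deriv_affine (- z) (zeta x) (path_deriv_real t))) => [s|]; rewrite /c; ring.
have dcx t x : path_deriv (fun x => c t x) x (ci * zeta x).
  by apply: (path_deriv_ext (path_deriv_affine 1 (- (t%:C * z)) (path_deriv_zeta x))) => [s|]; rewrite /c; ring.
have c0 (t x : R) : -1 < t < 2 -> c t x != 0 by move=> /I_norm [? _]; exact: zeta_z.
have dix (t x : R) : -1 < t < 2 ->
    path_deriv (fun x => (c t x)^-1) x (ci * zeta x * (- (c t x ^- 2))).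
  by move=> tI; exact: has_deriv_path (has_deriv_inv (c0 t x tI)) (dcx t x).
have -> : \int[mu]_(x in `[0, T]) Rec (w * (zeta x / (zeta x - z))) = \int[mu]_(x in `[0, T]) u 1 x.
  by apply: eq_Rintegral => x _; rewrite /u /c mul1r.
transitivity (\int[mu]_(x in `[0, T]) u 0 x); last first.
  transitivity (\int[mu]_(x in `[0, T]) Rec w).
    apply: eq_Rintegral => x _; rewrite /u /c mul0r subr0 divff ?mulr1//.
    by rewrite -cmod_gt0 cmod_zeta.
  rewrite Rintegral_cst//= lebesgue_measure_itv/= lte_fin twopi_gt0/=.
  by rewrite oppr0 addr0.
symmetry; apply: (@integral_homotopy R u v G (cmod (w * z) * r / (r - 2 * cmod z) ^+ 2)).
- move=> t x tI.
  have H := path_deriv_affine (w * zeta x) 0 (@has_deriv_path _ _ (c^~ x) t _ _ (has_deriv_inv (c0 t x tI)) (dct t x)).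
  suff : path_deriv (fun t => w * (zeta x / c t x)) t (w * z * zeta x / c t x ^+ 2) by case.
  by apply: (path_deriv_ext H) => [s|]; ring.
- move=> t x tI; have H := path_deriv_affine (- (w * z)) 0 (dix t x tI).
  suff : path_deriv (fun x => - (w * z) / c t x) x (ci * (w * z * zeta x / c t x ^+ 2)).
    by case; rewrite cIm_i.
  by apply: (path_deriv_ext H) => [s|]; ring.
- move=> t x tI; have [t2 _] := I_norm tI; have h := zeta_lb x t2.
  rewrite (le_trans (Re_le_cmod _))// cmodM (cmodM (w * z)) cmod_zeta cmodV cmodX.
  apply: ler_wpM2l; first by rewrite mulr_ge0 ?cmod_ge0 ?(ltW r0).
  have r2 : 0 < r - 2 * cmod z by have := zr; lra.
  by rewrite lef_pV2 ?posrE ?exprn_gt0 ?(lt_le_trans r2)// lerXn2r// nnegrE; [lra|exact: cmod_ge0].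
- by move=> t x tI; rewrite /G /c cis_periodic.
- move=> t tI; rewrite /u.
  apply: (@path_deriv_continuous_Re R) => x.
  exact: path_derivM (path_deriv_cst w x) (path_derivM (path_deriv_zeta x) (dix t x tI)).
Qed.

(** Contract the circle to z along z + t (zeta - z): the t-derivative
    f1 (z + t (zeta - z)) zeta of the integrand is, up to the factor i t, the
    derivative of f (z + t (zeta - z)) along the circle. *)
Lemma cauchy_Re : \int[mu]_(x in `[0, T]) Rec (f (zeta x) * (zeta x / (zeta x - z))) =
  Rec (f z) * T.
Proof.
rewrite -cauchy_cst.
pose c (t : R) x := z + t%:C * (zeta x - z).
pose u (t : R) x := Rec (f (c t x) * (zeta x / (zeta x - z))).
pose v (t : R) x := Rec (f1 (c t x) * zeta x).
(* at t = 0 the path is constant, and the primitive of f1 z * zeta is explicit *)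
pose G (t : R) x := if t == 0 then Imc (f1 z * zeta x) else Imc (f (c t x)) / t.
have cB (t x : R) : -1 < t < 2 -> cmod (c t x) < 4 * r.
  move=> /I_norm[t2 t1]; have -> : c t x = (1 - t)%:C * z + t%:C * zeta x.
    by rewrite rmorphB rmorph1 /c; ring.
  rewrite (le_lt_trans (cmodD _ _))// cmodM (cmodM _ (zeta x)) cmod_zeta !cmod_real.
  have : `|1 - t| * cmod z <= 2 * cmod z by rewrite ler_wpM2r ?cmod_ge0.
  have : `|t| * r <= 2 * r by rewrite ler_wpM2r// ltW.
  have := zr; have := r0; lra.
have dct t x : path_deriv (fun t => c t x) t (zeta x - z).
  by apply: (path_deriv_ext (path_deriv_affine (zeta x - z) z (path_deriv_real t))) => [s|]; rewrite /c; ring.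
have dcx t x : path_deriv (fun x => c t x) x (t%:C * (ci * zeta x)).
  by apply: (path_deriv_ext (path_deriv_affine t%:C (z - t%:C * z) (path_deriv_zeta x))) => [s|]; rewrite /c; ring.
have dfc (t x : R) : -1 < t < 2 -> path_deriv (fun x => f (c t x)) x (t%:C * (ci * zeta x) * f1 (c t x)).
  by move=> tI; apply: has_deriv_path (dcx t x); exact/df/cB.
have -> : \int[mu]_(x in `[0, T]) Rec (f (zeta x) * (zeta x / (zeta x - z))) = \int[mu]_(x in `[0, T]) u 1 x.
  by apply: eq_Rintegral => x _; rewrite /u (_ : c 1 x = zeta x)// /c; ring.
have -> : \int[mu]_(x in `[0, T]) Rec (f z * (zeta x / (zeta x - z))) = \int[mu]_(x in `[0, T]) u 0 x.
  by apply: eq_Rintegral => x _; rewrite /u (_ : c 0 x = z)// /c; ring.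
symmetry; apply: (@integral_homotopy R u v G (B * r)).
- move=> t x tI.
  have H := path_deriv_affine (zeta x / (zeta x - z)) 0 (@has_deriv_path _ _ (c^~ x) t _ _ (df (cB t x tI)) (dct t x)).
  suff : path_deriv (fun t => f (c t x) * (zeta x / (zeta x - z))) t (f1 (c t x) * zeta x) by case.
  by apply: (path_deriv_ext H) => [s|]; [ring|field; exact: zeta_z1].
- move=> t x tI; rewrite /G /v; have [->|t0] := eqVneq t 0.
    have H := path_deriv_affine (f1 z) 0 (path_deriv_zeta x).
    suff : path_deriv (fun x => f1 z * zeta x) x (ci * (f1 (c 0 x) * zeta x)) by case; rewrite cIm_i.
    have -> : c 0 x = z by rewrite /c; ring.
    by apply: (path_deriv_ext H) => [s|]; ring.
  have H := path_deriv_affine (t^-1)%:C 0 (dfc t x tI).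
  suff : path_deriv (fun x => (t^-1)%:C * f (c t x)) x (ci * (f1 (c t x) * zeta x)).
    by case=> _; rewrite cIm_i; under eq_fun do rewrite cImZ mulrC.
  have tt : (t^-1)%:C * t%:C = 1 :> R[i] by rewrite -rmorphM mulVf// rmorph1.
  by apply: (path_deriv_ext H) => [s|]; [rewrite addr0|rewrite !mulrA tt; ring].
- move=> t x tI; rewrite (le_trans (Re_le_cmod _))// cmodM cmod_zeta ler_wpM2r ?(ltW r0)//.
  exact/Bf1/cB.
- by move=> t x tI; rewrite /G /c cis_periodic.
- move=> t tI; apply: (@path_deriv_continuous_Re R) => x.
  apply: path_derivM (dfc t x tI) (path_derivM (path_deriv_zeta x) _).
  apply: has_deriv_path (has_deriv_inv (zeta_z1 x)) _.
  by apply: (path_deriv_ext (path_deriv_affine 1 (- z) (path_deriv_zeta x))) => [s|]; rewrite ?mul1r.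
Qed.

End Point.
End CauchyFormula.

(** * Cauchy estimates and the identity theorem *)

Section CircleMean.
Context {R : realType}.
Local Notation mu := (@lebesgue_measure R).
Local Notation T := (pi *+ 2 : R).
Implicit Types (p q : R -> R[i]) (a z w : R[i]).

Definition path_diff p := forall t, exists d, path_deriv p t d.

(** Contour integrals over a circle are written as means over its angle. *)
Definition cmean p : R[i] :=
  (\int[mu]_(x in `[0, T]) Rec (p x) / T) +i* (\int[mu]_(x in `[0, T]) Imc (p x) / T).

Lemma path_diff_cst a : path_diff (fun=> a).
Proof. by move=> t; exists 0; exact: path_deriv_cst. Qed.

Lemma path_diffM p q : path_diff p -> path_diff q -> path_diff (fun x => p x * q x).
Proof. by move=> h1 h2 t; have [? h3] := h1 t; have [? h4] := h2 t; eexists; exact: (path_derivM h3 h4). Qed.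

Lemma path_diffD p q : path_diff p -> path_diff q -> path_diff (fun x => p x + q x).
Proof. by move=> h1 h2 t; have [? h3] := h1 t; have [? h4] := h2 t; eexists; exact: (path_derivD h3 h4). Qed.

Lemma path_diffX p n : path_diff p -> path_diff (fun x => p x ^+ n).
Proof.
move=> h; elim: n => [|n IHn]; first exact: (path_diff_cst 1).
by under eq_fun do rewrite exprS; exact: (path_diffM h IHn).
Qed.

Lemma path_diffV p : (forall x, p x != 0) -> path_diff p -> path_diff (fun x => (p x)^-1).
Proof.
by move=> p0 h t; have [d dp] := h t; eexists; exact: has_deriv_path (has_deriv_inv (p0 t)) dp.
Qed.

Lemma path_diff_integrable_Re p : path_diff p -> mu.-integrable `[0, T] (EFin \o (fun x => Rec (p x))).
Proof.
move=> /choice[g dg]; apply: cont_integrable; exact: path_deriv_continuous_Re dg.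
Qed.

Lemma path_diff_integrable_Im p : path_diff p -> mu.-integrable `[0, T] (EFin \o (fun x => Imc (p x))).
Proof.
move=> /choice[g dg]; apply: cont_integrable; exact: path_deriv_continuous_Im dg.
Qed.

Lemma cmeanD p q : path_diff p -> path_diff q -> cmean (fun x => p x + q x) = cmean p + cmean q.
Proof.
move=> dp dq; apply: complex_ext => /=.
- under eq_Rintegral do rewrite cReD.
  by rewrite RintegralD ?mulrDl//; exact: path_diff_integrable_Re.
- under eq_Rintegral do rewrite cImD.
  by rewrite RintegralD ?mulrDl//; exact: path_diff_integrable_Im.
Qed.

Lemma cmeanZ a p : path_diff p -> cmean (fun x => a * p x) = a * cmean p.
Proof.
move=> dp; have hr := path_diff_integrable_Re dp; have hi := path_diff_integrable_Im dp.
have h b (g : R -> R) : mu.-integrable `[0, T] (EFin \o g) ->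
    mu.-integrable `[0, T] (EFin \o (fun x => b * g x)).
  by move=> ig; under [X in _.-integrable _ X]eq_fun do rewrite /= EFinM; exact: integrableZl.
apply: complex_ext; rewrite ?cReM ?cImM /=.
- under eq_Rintegral do rewrite cReM.
  by rewrite RintegralB ?RintegralZl//; [ring|exact: h..].
- under eq_Rintegral do rewrite cImM.
  by rewrite RintegralD ?RintegralZl//; [ring|exact: h..].
Qed.

Lemma eq_cmean p q : p =1 q -> cmean p = cmean q.
Proof. by move=> /funext->. Qed.

(** The factor 2 comes from estimating real and imaginary part separately. *)
Lemma cmean_le p (B : R) : path_diff p -> (forall x, cmod (p x) <= B) -> cmod (cmean p) <= 2 * B.
Proof.
move=> dp pB; have T0 := @twopi_gt0 R.
have cB : mu.-integrable `[0, T] (EFin \o cst B).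
  by apply: cont_integrable => x; exact: cvg_cst.
have key (g : R -> R) : mu.-integrable `[0, T] (EFin \o g) -> (forall x, `|g x| <= B) ->
    `|\int[mu]_(x in `[0, T]) g x / T| <= B.
  move=> ig gB; rewrite normrM normfV (gtr0_norm T0) ler_pdivrMr//.
  rewrite (le_trans (le_normr_Rintegral _ _))//.
  have <- : \int[mu]_(x in `[0, T]) (cst B x) = B * T.
    rewrite Rintegral_cst//= lebesgue_measure_itv/= lte_fin T0/=.
    by rewrite oppr0 addr0.
  apply: le_Rintegral => //=.
  exact: (integrable_norm ig).
rewrite (le_trans (cmod_le_ReIm _))//= mulr2n mulrDl mul1r lerD//.
- apply: key; first exact: path_diff_integrable_Re.
  by move=> x; rewrite (le_trans (Re_le_cmod _)).
- apply: key; first exact: path_diff_integrable_Im.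
  by move=> x; rewrite (le_trans (Im_le_cmod _)).
Qed.

End CircleMean.

Section Regularity.
Context {R : realType}.
Local Notation T := (pi *+ 2 : R).
Implicit Types (z w : R[i]).

(** A quadratic remainder is stronger than differentiability, so it identifies
    the derivative. *)
Lemma has_deriv_quad_unique (f : R[i] -> R[i]) z (d d' : R[i]) (C rho : R) :
  0 < rho -> has_deriv f z d ->
  (forall w, cmod (w - z) < rho -> cmod (f w - f z - (w - z) * d') <= C * cmod (w - z) ^+ 2) ->
  d' = d.
Proof.
move=> rho0 df q; apply/eqP; rewrite -subr_eq0; apply/eqP/cmod_eq0P => e e0.
have e2 : 0 < e / 2 by lra.
have [dl dl0 {}df] := df _ e2.
have C1 : 0 < `|C| + 1 by rewrite ltr_pwDr.
pose t := Num.min (Num.min (dl / 2) (rho / 2)) (e / 2 / (`|C| + 1)).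
have t0 : 0 < t by rewrite !lt_min !divr_gt0.
have tdl : t < dl by rewrite !gt_min; apply/orP; left; apply/orP; left; lra.
have trho : t < rho by rewrite !gt_min; apply/orP; left; apply/orP; right; lra.
have tC : C * t <= e / 2.
  have : C * t <= (`|C| + 1) * t by rewrite ler_pM2r//; have := ler_norm C; lra.
  move/le_trans; apply.
  by rewrite mulrC -ler_pdivlMr// ge_min lexx orbT.
have nt : cmod (z + t%:C - z) = t by rewrite addrC addKr cmod_real gtr0_norm.
have := df (z + t%:C); have := q (z + t%:C); rewrite nt => /(_ trho) q1 /(_ tdl) q2.
move: q1 q2; rewrite (addrC z) addrK => q1 q2.
have E : t%:C * (d' - d) = (f (t%:C + z) - f z - t%:C * d) - (f (t%:C + z) - f z - t%:C * d').
  by ring.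
have : t * cmod (d' - d) <= t * e.
  have -> : t * cmod (d' - d) = cmod (t%:C * (d' - d)) by rewrite cmodM cmod_real gtr0_norm.
  rewrite E (le_trans (cmodB _ _))//.
  have : C * t ^+ 2 <= e / 2 * t by rewrite expr2 mulrA ler_wpM2r// ltW.
  lra.
by rewrite ler_pM2l.
Qed.

Section Fix.
Variables (r : R).
Hypothesis r0 : 0 < r.
Local Notation zeta x := (r%:C * cis x).

Let cmod_zeta x : cmod (zeta x) = r.
Proof. by rewrite cmodM cmod_cis cmod_real mulr1 ger0_norm// ltW. Qed.

Let zeta0 x : zeta x != 0.
Proof. by rewrite -cmod_gt0 cmod_zeta. Qed.

Let zeta_lb x z : cmod z < r / 2 -> r / 2 <= cmod (zeta x - z).
Proof.
move=> zr; have := cmodBD (zeta x) z 0; rewrite !subr0 cmod_zeta; have := zr; lra.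
Qed.

Let zeta_ub x z : cmod z < r / 2 -> cmod (zeta x - z) <= 2 * r.
Proof.
move=> zr; have := cmodB (zeta x) z; rewrite cmod_zeta; have := zr; have := r0; lra.
Qed.

Let zeta_z x z : cmod z < r / 2 -> zeta x - z != 0.
Proof. by move=> /(zeta_lb x) h; rewrite -cmod_gt0; have := r0; lra. Qed.

Let dzeta : path_diff (fun x => zeta x).
Proof. by apply: path_diffM (path_diff_cst _) _ => t; exists (ci * cis t); exact: path_deriv_cis. Qed.

Let dzetaz z : path_diff (fun x => zeta x - z).
Proof. exact: path_diffD dzeta (path_diff_cst (- z)). Qed.

Variables (f f1 : R[i] -> R[i]) (B M : R).
Hypotheses
  (df : forall z, cmod z < 4 * r -> has_deriv f z (f1 z))
  (Bf1 : forall z, cmod z < 4 * r -> cmod (f1 z) <= B)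
  (Mf : forall z, cmod z < 4 * r -> cmod (f z) <= M).

Let F x := f (zeta x) * zeta x.

Let FM x : cmod (F x) <= M * r.
Proof.
rewrite cmodM cmod_zeta ler_wpM2r ?(ltW r0)// Mf// cmod_zeta; have := r0; lra.
Qed.

Let M0 : 0 <= M.
Proof. by apply: le_trans (cmod_ge0 (f 0)) (Mf _); rewrite cmod0; have := r0; lra. Qed.

Let dF : path_diff F.
Proof.
apply: path_diffM dzeta => t; have [d dd] := dzeta t; eexists; apply: has_deriv_path dd.
apply: df; rewrite cmod_zeta; have := r0; lra.
Qed.

Lemma cauchy z : cmod z < r / 2 -> f z = cmean (fun x => F x / (zeta x - z)).
Proof.
move=> zr; have T0 := @twopi_gt0 R; have T1 : T != 0 by rewrite gt_eqF.
apply: complex_ext => /=.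
- have H := cauchy_Re r0 df Bf1 zr.
  rewrite -[LHS](mulfK T1) -H; congr (_ / _).
  by apply: eq_Rintegral => x _; rewrite /F mulrA.
- (* the imaginary part of f is the real part of - i f *)
  have df' w : cmod w < 4 * r -> has_deriv (fun w => - ci * f w) w (- ci * f1 w).
    move=> wr e /(df wr)[d d0 hd]; exists d => // y /hd.
    suff -> : - ci * f y - - ci * f w - (y - w) * (- ci * f1 w) =
       - ci * (f y - f w - (y - w) * f1 w) by rewrite cmodM cmodN /cmod /= expr0n expr1n add0r sqrtr1 mul1r.
    by ring.
  have Bf' w : cmod w < 4 * r -> cmod (- ci * f1 w) <= B.
    by move=> /Bf1; rewrite cmodM cmodN /cmod /= expr0n expr1n add0r sqrtr1 mul1r.
  have ImE (x : R[i]) : Rec (- ci * x) = Imc x by rewrite mulNr cReN cRe_i opprK.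
  have := cauchy_Re r0 df' Bf' zr; rewrite ImE => H.
  rewrite -[LHS](mulfK T1) -H; congr (_ / _).
  by apply: eq_Rintegral => x _; rewrite /F -ImE !mulrA.
Qed.

(* the kernels of Cauchy's formula for the first and the second derivative *)
Let c1 z := cmean (fun x => F x / (zeta x - z) ^+ 2).
Let c2 z := cmean (fun x => 2 * F x / (zeta x - z) ^+ 3).

Let dFV z n : cmod z < r / 2 -> path_diff (fun x => F x / (zeta x - z) ^+ n).
Proof.
move=> zr; apply: path_diffM dF (path_diffV _ (path_diffX n (dzetaz z))) => x.
by rewrite expf_neq0// zeta_z.
Qed.

Let d2FV z n : cmod z < r / 2 -> path_diff (fun x => 2 * F x / (zeta x - z) ^+ n).
Proof.
move=> zr; under eq_fun do rewrite -mulrA.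
exact: path_diffM (path_diff_cst 2) (dFV n zr).
Qed.

Let FV_le x z n : cmod z < r / 2 -> cmod (F x / (zeta x - z) ^+ n) <= M * r / (r / 2) ^+ n.
Proof.
move=> zr; have h := zeta_lb x zr; have r2 : 0 < r / 2 by have := r0; lra.
rewrite cmodM cmodV cmodX ler_pM ?cmod_ge0 ?FM// ?invr_ge0 ?exprn_ge0 ?cmod_ge0//.
by rewrite lef_pV2 ?posrE ?exprn_gt0 ?(lt_le_trans r2)// lerXn2r// nnegrE ?cmod_ge0// ltW.
Qed.

Let cmeanB (p q : R -> R[i]) : path_diff p -> path_diff q -> cmean (fun x => p x - q x) = cmean p - cmean q.
Proof.
move=> dp dq; rewrite (@eq_cmean R _ (fun x => p x + -1 * q x)) => [|x]; last by ring.
rewrite cmeanD ?cmeanZ//; first by ring.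
exact: path_diffM (path_diff_cst _) dq.
Qed.

Let quad1 (z w : R[i]) : cmod z < r / 2 -> cmod w < r / 2 ->
  cmod (f w - f z - (w - z) * c1 z) <= 16 / r ^+ 2 * M * cmod (w - z) ^+ 2.
Proof.
move=> zr wr.
have d1 z' : cmod z' < r / 2 -> path_diff (fun x => F x / (zeta x - z')).
  by move=> /(dFV 1); under eq_fun do rewrite expr1.
have dp : path_diff (fun x => F x / (zeta x - z) ^+ 2 / (zeta x - w)).
  by apply: path_diffM (dFV 2 zr) (path_diffV _ (dzetaz w)) => x; exact: zeta_z.
rewrite (cauchy zr) (cauchy wr) /c1 -cmeanB; [|exact: d1..]; rewrite -cmeanZ; last exact: dFV.
rewrite -cmeanB; last 2 first.
- have := path_diffD (d1 w wr) (path_diffM (path_diff_cst (-1)) (d1 z zr)).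
  by under eq_fun do rewrite mulN1r.
- exact: path_diffM (path_diff_cst (w - z)) (dFV 2 zr).
rewrite (@eq_cmean R _ (fun x => (w - z) ^+ 2 * (F x / (zeta x - z) ^+ 2 / (zeta x - w)))); last first.
  by move=> x; field; rewrite !zeta_z.
rewrite cmeanZ// cmodM cmodX mulrC ler_wpM2r ?exprn_ge0 ?cmod_ge0//.
have r2 : 0 < r / 2 by have := r0; lra.
have -> : 16 / r ^+ 2 * M = 2 * (M * r / (r / 2) ^+ 2 / (r / 2)).
  by field; rewrite gt_eqF.
apply: cmean_le => // x; rewrite cmodM cmodV ler_pM ?cmod_ge0 ?invr_ge0 ?cmod_ge0 ?FV_le//.
by rewrite lef_pV2 ?posrE ?zeta_lb// (lt_le_trans r2)// zeta_lb.
Qed.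

Let quad2 (z w : R[i]) : cmod z < r / 2 -> cmod w < r / 2 ->
  cmod (c1 w - c1 z - (w - z) * c2 z) <= 384 / r ^+ 3 * M * cmod (w - z) ^+ 2.
Proof.
move=> zr wr.
have dp : path_diff (fun x => F x / (zeta x - z) ^+ 3 / (zeta x - w) ^+ 2 * (zeta x - z + 2 * (zeta x - w))).
  apply: path_diffM (path_diffM (dFV 3 zr) (path_diffV _ (path_diffX 2 (dzetaz w)))) _.
    by move=> x; rewrite expf_neq0// zeta_z.
  exact: path_diffD (dzetaz z) (path_diffM (path_diff_cst 2) (dzetaz w)).
rewrite /c1 /c2 -cmeanB; [|exact: dFV..]; rewrite -cmeanZ; last exact: d2FV.
rewrite -cmeanB; last 2 first.
- have := path_diffD (dFV 2 wr) (path_diffM (path_diff_cst (-1)) (dFV 2 zr)).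
  by under eq_fun do rewrite mulN1r.
- exact: path_diffM (path_diff_cst _) (d2FV 3 zr).
rewrite (@eq_cmean R _ (fun x => (w - z) ^+ 2 *
  (F x / (zeta x - z) ^+ 3 / (zeta x - w) ^+ 2 * (zeta x - z + 2 * (zeta x - w))))); last first.
  by move=> x; field; rewrite !zeta_z.
rewrite cmeanZ// cmodM cmodX mulrC ler_wpM2r ?exprn_ge0 ?cmod_ge0//.
have r2 : 0 < r / 2 by have := r0; lra.
have -> : 384 / r ^+ 3 * M = 2 * (M * r / (r / 2) ^+ 3 / (r / 2) ^+ 2 * (6 * r)).
  by field; rewrite gt_eqF.
apply: cmean_le => // x; rewrite cmodM ler_pM ?cmod_ge0//.
  rewrite cmodM cmodV cmodX ler_pM ?cmod_ge0 ?invr_ge0 ?exprn_ge0 ?cmod_ge0 ?FV_le//.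
  rewrite lef_pV2 ?posrE ?exprn_gt0 ?(lt_le_trans r2)// ?zeta_lb// lerXn2r ?zeta_lb// nnegrE ?cmod_ge0//.
  exact: ltW.
rewrite (le_trans (cmodD _ _))// cmodM.
have -> : cmod (2 : R[i]) = 2.
  by have := @cmod_real R 2; rewrite rmorphMn rmorph1 => ->; rewrite ger0_norm.
have := zeta_ub x zr; have := zeta_ub x wr; lra.
Qed.

Let c1_le z : cmod z < r / 2 -> cmod (c1 z) <= 8 / r * M.
Proof.
move=> zr; have -> : 8 / r * M = 2 * (M * r / (r / 2) ^+ 2) by field; rewrite gt_eqF.
by apply: cmean_le => [|x]; [exact: dFV|exact: FV_le].
Qed.

Let c2_le z : cmod z < r / 2 -> cmod (c2 z) <= 32 / r ^+ 2 * M.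
Proof.
move=> zr; have -> : 32 / r ^+ 2 * M = 2 * (2 * (M * r / (r / 2) ^+ 3)) by field; rewrite gt_eqF.
apply: cmean_le => [|x]; [exact: d2FV|].
have -> : 2 * F x / (zeta x - z) ^+ 3 = (2%:R : R)%:C * (F x / (zeta x - z) ^+ 3).
  by rewrite rmorphMn rmorph1 mulrA.
by rewrite cmodM cmod_real ger0_norm// ler_wpM2l ?FV_le.
Qed.

Let c1E z : cmod z < r / 2 -> c1 z = f1 z.
Proof.
move=> zr; apply: (@has_deriv_quad_unique f z _ _ (16 / r ^+ 2 * M) (r / 2 - cmod z)).
- by rewrite subr_gt0.
- by apply: df; have := r0; have := zr; lra.
- move=> w wz; apply: quad1 => //.
  have := cmodD (w - z) z; rewrite subrK; have := wz; lra.
Qed.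

(** One constant for the four estimates below: 8 / r and 32 / r ^ 2 bound the two
    derivatives, 16 / r ^ 2 and 384 / r ^ 3 the two quadratic remainders. *)
Definition reg_cst : R := 8 / r + 32 / r ^+ 2 + 384 / r ^+ 3.

(** Cauchy estimates, with a constant that depends on the radius only. *)
Lemma regularity : exists f2 : R[i] -> R[i], forall z w, cmod z < r / 2 -> cmod w < r / 2 ->
  [/\ cmod (f1 z) <= reg_cst * M, cmod (f2 z) <= reg_cst * M,
      cmod (f w - f z - (w - z) * f1 z) <= reg_cst * M * cmod (w - z) ^+ 2 &
      cmod (f1 w - f1 z - (w - z) * f2 z) <= reg_cst * M * cmod (w - z) ^+ 2].
Proof.
exists c2 => z w zr wr; rewrite -!c1E//.
have i0 n : 0 < r ^- n by rewrite invr_gt0 exprn_gt0.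
have le1 a : a <= reg_cst -> a * M <= reg_cst * M by move=> ?; exact: ler_wpM2r.
have i1 : 0 < r^-1 by rewrite invr_gt0.
have := i0 2; have := i0 3 => i3 i2.
split.
- by apply: le_trans (c1_le zr) (le1 _ _); rewrite /reg_cst; lra.
- by apply: le_trans (c2_le zr) (le1 _ _); rewrite /reg_cst; lra.
- apply: le_trans (quad1 zr wr) _; apply: ler_wpM2r; first by rewrite exprn_ge0 ?cmod_ge0.
  by apply: le1; rewrite /reg_cst; lra.
- apply: le_trans (quad2 zr wr) _; apply: ler_wpM2r; first by rewrite exprn_ge0 ?cmod_ge0.
  by apply: le1; rewrite /reg_cst; lra.
Qed.

(* the remainder of the Taylor expansion of f at 0 to order N *)
Let rem N z := cmean (fun x => z ^+ N * (F x / (zeta x - z) / zeta x ^+ N)).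

Let drem N z : cmod z < r / 2 -> path_diff (fun x => F x / (zeta x - z) / zeta x ^+ N).
Proof.
move=> /(dFV 1) h.
have dV : path_diff (fun x => (zeta x ^+ N)^-1).
  by apply: path_diffV (path_diffX N dzeta) => x; rewrite expf_neq0.
exact: path_diffM h dV.
Qed.

Let remS N z : cmod z < r / 2 ->
  rem N z = z ^+ N * cmean (fun x => F x / zeta x ^+ N.+1) + rem N.+1 z.
Proof.
move=> zr; have dp : path_diff (fun x => F x / zeta x ^+ N.+1).
  by apply: path_diffM dF (path_diffV _ (path_diffX _ dzeta)) => x; rewrite expf_neq0.
rewrite -cmeanZ//.
have dz N' : path_diff (fun=> z ^+ N' : R[i]) by exact: path_diff_cst.
rewrite -cmeanD; [|exact: (path_diffM (dz N) dp)|exact: (path_diffM (dz N.+1) (drem N.+1 zr))].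
apply: eq_cmean => x; have := zeta0 x; have := zeta_z x zr.
move: (zeta x) => Z Zz Z0; have ZN : Z ^+ N != 0 by rewrite expf_neq0.
by rewrite !exprS; field; rewrite Z0 ZN Zz.
Qed.

Let rem_le N z : cmod z < r / 2 -> cmod (rem N z) <= 4 * M * (cmod z / r) ^+ N.
Proof.
move=> zr; rewrite /rem cmeanZ; last exact: drem.
have -> : 4 * M * (cmod z / r) ^+ N = cmod z ^+ N * (2 * (M * r / (r / 2) ^+ 1 / r ^+ N)).
  by rewrite expr_div_n; field; rewrite expf_neq0 gt_eqF.
rewrite cmodM cmodX ler_wpM2l ?exprn_ge0 ?cmod_ge0//.
apply: cmean_le => [|x]; first exact: drem.
rewrite cmodM cmodV cmodX cmod_zeta ler_wpM2r ?invr_ge0 ?exprn_ge0 ?(ltW r0)//.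
by rewrite -[X in _ / X]expr1 FV_le.
Qed.

(** The Taylor coefficients at 0 vanish one after the other, as f equals each
    Taylor remainder, which has order N at 0; and the remainders tend to 0. *)
Lemma identity_real : (forall x : R, 0 < x < r / 2 -> f x%:C = 0) ->
  forall z, cmod z < r / 2 -> f z = 0.
Proof.
move=> f0.
have fE N : forall z, cmod z < r / 2 -> f z = rem N z.
  elim: N => [|N IHN] z zr.
    by rewrite (cauchy zr) /rem; apply: eq_cmean => x; rewrite !expr0 mul1r divr1.
  rewrite (IHN z zr) (remS N zr).
  set a := cmean _; suff -> : a = 0 by rewrite mulr0 add0r.
  apply: (@cmod_eq0_quad R _ (4 * M / r ^+ N.+1) (r / 2)); first by have := r0; lra.
  move=> t t0 tr; have nt : cmod (t%:C : R[i]) = t by rewrite cmod_real gtr0_norm.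
  have tr' : cmod (t%:C : R[i]) < r / 2 by rewrite nt.
  have : t%:C ^+ N * a = - rem N.+1 t%:C.
    apply/eqP; rewrite -addr_eq0 -remS// -IHN// f0//.
    by rewrite t0.
  move=> /(congr1 (@cmod R)); rewrite cmodM cmodX cmodN nt => E.
  have := rem_le N.+1 tr'; rewrite -E nt expr_div_n.
  have -> : 4 * M * (t ^+ N.+1 / r ^+ N.+1) = t ^+ N * (4 * M / r ^+ N.+1 * t).
    by rewrite exprS; ring.
  rewrite ler_pM2l ?exprn_gt0// => H.
  rewrite expr2 mulrA mulrC ler_wpM2r// ltW//.
move=> z zr; apply: cmod_eq0P => e e0.
have q1 : `|2^-1 : R| < 1 by rewrite ger0_norm; lra.
have /cvgrPdist_le/(_ e e0) [N _ /(_ N (leqnn N))] := cvg_geometric (4 * M) q1.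
rewrite /= sub0r normrN => h; rewrite (fE N z zr) (le_trans (rem_le N zr))//.
apply: le_trans (le_trans (ler_norm _) h); rewrite /geometric/= ler_wpM2l ?mulr_ge0//.
rewrite lerXn2r// ?nnegrE ?invr_ge0 ?divr_ge0 ?cmod_ge0 ?(ltW r0)//.
by rewrite ler_pdivrMr//; have := zr; lra.
Qed.

End Fix.
End Regularity.

(** * Square-summable sequences *)

Section SquareSummable.
Context {R : realType}.
Implicit Types (x y z : nat -> R[i]) (a b : R) (s t c : R[i]).

(** A bound on the norm, rather than the norm itself: membership in the space
    and estimates are then a single statement about finite sums. *)
Definition l2 x a := 0 <= a /\ forall N, \sum_(i < N) cmod (x i) ^+ 2 <= a ^+ 2.

Definition conj_seq x : nat -> R[i] := fun i => (x i)^bar.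

Lemma conj_seqK x : conj_seq (conj_seq x) = x.
Proof. by apply/funext => i; rewrite /conj_seq conjcK. Qed.

Lemma conj_seqD x y : conj_seq (x + y) = conj_seq x + conj_seq y.
Proof. by apply/funext => i; rewrite /conj_seq !fctE rmorphD. Qed.

Lemma conj_seqN x : conj_seq (- x) = - conj_seq x.
Proof. by apply/funext => i; rewrite /conj_seq !fctE rmorphN. Qed.

Lemma conj_seqZ c x : conj_seq (c *: x) = c^bar *: conj_seq x.
Proof. by apply/funext => i; rewrite /conj_seq !fctE /GRing.scale/= rmorphM. Qed.

Lemma l2_ge0 x a : l2 x a -> 0 <= a. Proof. by case. Qed.

Lemma l2_conj_seq x a : l2 x a -> l2 (conj_seq x) a.
Proof. by move=> [a0 h]; split=> // N; under eq_bigr do rewrite /conj_seq cmodJ. Qed.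

Lemma l2_le x a b : a <= b -> l2 x a -> l2 x b.
Proof.
move=> ab [a0 h]; split; first exact: le_trans ab.
by move=> N; rewrite (le_trans (h N))// lerXn2r// nnegrE// (le_trans a0).
Qed.

Lemma l2_coord x a i : l2 x a -> cmod (x i) <= a.
Proof.
move=> [a0 /(_ i.+1)]; rewrite big_ord_recr /= => h.
rewrite -(@ler_pXn2r _ 2)// ?nnegrE ?cmod_ge0// (le_trans _ h)// lerDr.
by apply: sumr_ge0 => j _; rewrite exprn_ge0 ?cmod_ge0.
Qed.

Lemma l2_0 a : 0 <= a -> l2 0 a.
Proof.
move=> a0; split=> // N; rewrite big1 ?exprn_ge0// => i _.
by rewrite (_ : (0 : nat -> R[i]) i = 0)// cmod0 expr0n.
Qed.

Lemma l2_eq0 x : l2 x 0 -> x = 0.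
Proof.
move=> h; apply/funext => i; apply/eqP; rewrite -cmod_eq0 eq_le cmod_ge0 andbT.
exact: l2_coord h.
Qed.

Lemma cauchy_schwarz_fin (N : nat) (u v : 'I_N -> R) a b : 0 <= a -> 0 <= b ->
  (forall i, 0 <= u i) -> (forall i, 0 <= v i) ->
  \sum_i u i ^+ 2 <= a ^+ 2 -> \sum_i v i ^+ 2 <= b ^+ 2 ->
  \sum_i u i * v i <= a * b.
Proof.
move=> a0 b0 u0 v0 hu hv.
have zero (w : 'I_N -> R) : \sum_i w i ^+ 2 <= 0 ^+ 2 -> forall i, w i = 0.
  rewrite expr0n /= => h i; apply/eqP; rewrite -sqrf_eq0; apply/eqP.
  apply: (@psumr_eq0P R 'I_N xpredT (fun i => w i ^+ 2)) => //; first by move=> *; exact: sqr_ge0.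
  by apply/eqP; rewrite eq_le h sumr_ge0// => *; exact: sqr_ge0.
have [a00|a00] := eqVneq a 0.
  rewrite a00 mul0r big1// => i _; rewrite a00 in hu.
  by rewrite zero// mul0r.
have [b00|b00] := eqVneq b 0.
  rewrite b00 mulr0 big1// => i _; rewrite b00 in hv.
  by rewrite (zero v)// mulr0.
have a1 : 0 < a by rewrite lt0r a00.
have b1 : 0 < b by rewrite lt0r b00.
have k0 : 0 < b / a by rewrite divr_gt0.
have step i : u i * v i <= (b / a * u i ^+ 2 + (b / a)^-1 * v i ^+ 2) / 2.
  rewrite -subr_ge0; set k := b / a.
  have -> : (k * u i ^+ 2 + k^-1 * v i ^+ 2) / 2 - u i * v i =
    (k * u i - v i) ^+ 2 / k / 2 by field; rewrite gt_eqF.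
  by rewrite !divr_ge0 ?sqr_ge0// ltW.
apply: (@le_trans _ _ (\sum_i (b / a * u i ^+ 2 + (b / a)^-1 * v i ^+ 2) / 2)).
  by apply: ler_sum => i _; exact: step.
rewrite -mulr_suml big_split /= -!mulr_sumr ler_pdivrMr//.
have h1 : b / a * (\sum_i u i ^+ 2) <= b / a * a ^+ 2 by rewrite ler_pM2l.
have h2 : (b / a)^-1 * (\sum_i v i ^+ 2) <= (b / a)^-1 * b ^+ 2.
  by rewrite ler_pM2l// invr_gt0.
have e1 : b / a * a ^+ 2 = a * b by field.
have e2 : (b / a)^-1 * b ^+ 2 = a * b by field; rewrite a00 b00.
by rewrite e1 in h1; rewrite e2 in h2; lra.
Qed.

Lemma cauchy_schwarz_sum x y a b N : l2 x a -> l2 y b ->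
  \sum_(i < N) cmod (x i) * cmod (y i) <= a * b.
Proof.
by move=> [a0 hx] [b0 hy]; apply: cauchy_schwarz_fin => // i; exact: cmod_ge0.
Qed.

Lemma l2D x y a b : l2 x a -> l2 y b -> l2 (x + y) (a + b).
Proof.
move=> hx hy; have [a0 hx'] := hx; have [b0 hy'] := hy; split; first exact: addr_ge0.
move=> N; apply: (@le_trans _ _ (\sum_(i < N) (cmod (x i) ^+ 2 + 2 * (cmod (x i) * cmod (y i)) + cmod (y i) ^+ 2))).
  apply: ler_sum => i _; have -> : cmod (x i) ^+ 2 + 2 * (cmod (x i) * cmod (y i)) + cmod (y i) ^+ 2 = (cmod (x i) + cmod (y i)) ^+ 2 by ring.
  by rewrite lerXn2r ?nnegrE ?addr_ge0 ?cmod_ge0// cmodD.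
rewrite !big_split/= -mulr_sumr.
have := cauchy_schwarz_sum N hx hy; have := hx' N; have := hy' N.
rewrite sqrrD -mulr_natl; lra.
Qed.

Lemma l2Z c x a : l2 x a -> l2 (c *: x) (cmod c * a).
Proof.
move=> [a0 h]; split; first by rewrite mulr_ge0 ?cmod_ge0.
move=> N; under eq_bigr do rewrite cmodM exprMn.
by rewrite -mulr_sumr exprMn ler_wpM2l ?exprn_ge0 ?cmod_ge0.
Qed.

Lemma l2N x a : l2 x a -> l2 (- x) a.
Proof. by move=> [a0 h]; split=> // N; under eq_bigr do rewrite cmodN. Qed.

Lemma l2B x y a b : l2 x a -> l2 y b -> l2 (x - y) (a + b).
Proof. by move=> hx /l2N; exact: l2D. Qed.

(** Duality: a sequence is controlled by its pairings with finitely supported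
    unit vectors. *)
Lemma l2_dual x a : 0 <= a -> (forall N (v : nat -> R[i]), \sum_(i < N) cmod (v i) ^+ 2 <= 1 ->
  cmod (\sum_(i < N) v i * x i) <= a) -> l2 x a.
Proof.
move=> a0 h; split=> // N; set S := \sum_(i < N) _.
have S0 : 0 <= S by apply: sumr_ge0 => i _; rewrite exprn_ge0 ?cmod_ge0.
have [->|Sn0] := eqVneq S 0; first by rewrite exprn_ge0.
have S1 : 0 < S by rewrite lt0r Sn0.
pose k := Num.sqrt S; have k0 : 0 < k by rewrite sqrtr_gt0.
have kS : k ^+ 2 = S by rewrite sqr_sqrtr.
have E : \sum_(i < N) (k^-1)%:C * (x i)^bar * x i = k%:C.
  under eq_bigr do rewrite -mulrA [_^bar * _]mulrC mulcJ.
  by rewrite -mulr_sumr -rmorph_sum -/S -kS -rmorphM/= expr2 mulKf// gt_eqF.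
have := h N (fun i => (k^-1)%:C * (x i)^bar); rewrite E cmod_real gtr0_norm//.
rewrite -kS => H; rewrite lerXn2r ?nnegrE ?(ltW k0)//; apply: H.
under eq_bigr do rewrite cmodM cmodJ cmod_real exprMn.
rewrite -mulr_sumr -/S -kS real_normK ?num_real// exprVn mulVf//.
by rewrite expf_neq0// gt_eqF.
Qed.

Definition psum x y N := \sum_(i < N) x i * y i.

(** The bilinear pairing; the Hermitian product of x and y is
    [bilin x (conj_seq y)]. Being bilinear, it keeps kernels holomorphic in
    both variables. *)
Definition bilin x y : R[i] :=
  limn (fun N => Rec (psum x y N)) +i* limn (fun N => Imc (psum x y N)).

Definition ccvg (u : nat -> R[i]) s := forall e : R, 0 < e ->
  exists N0, forall N, (N0 <= N)%N -> cmod (u N - s) <= e.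

Lemma ccvg_unique u s t : ccvg u s -> ccvg u t -> s = t.
Proof.
move=> hs ht; apply/eqP; rewrite -subr_eq0; apply/eqP/cmod_eq0P => e e0.
have e2 : 0 < e / 2 by lra.
have [N1 h1] := hs _ e2; have [N2 h2] := ht _ e2.
have := h1 (maxn N1 N2) (leq_maxl _ _); have := h2 (maxn N1 N2) (leq_maxr _ _).
by have := cmodBD s (u (maxn N1 N2)) t; rewrite (cmodC s (u _)); lra.
Qed.

Lemma ccvgD u v s t : ccvg u s -> ccvg v t -> ccvg (fun N => u N + v N) (s + t).
Proof.
move=> hs ht e e0; have e2 : 0 < e / 2 by lra.
have [N1 h1] := hs _ e2; have [N2 h2] := ht _ e2.
exists (maxn N1 N2) => N; rewrite geq_max => /andP[/h1 {}h1 /h2 {}h2].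
have -> : u N + v N - (s + t) = (u N - s) + (v N - t) by ring.
by rewrite (le_trans (cmodD _ _))//; lra.
Qed.

Lemma ccvg_cst s : ccvg (fun=> s) s.
Proof. by move=> e e0; exists 0%N => N _; rewrite subrr cmod0 ltW. Qed.

Lemma ccvg_bound u s (B : R) : (forall N, cmod (u N) <= B) -> ccvg u s -> cmod s <= B.
Proof.
move=> uB h; apply/ler_addgt0Pr => e /h [N /(_ N (leqnn _))] h'.
by have := cmodBD s (u N) 0; rewrite !subr0 (cmodC s); have := uB N; lra.
Qed.

Lemma ccvgM u v s t : ccvg u s -> ccvg v t -> ccvg (fun N => u N * v N) (s * t).
Proof.
move=> hs ht e e0; have ns := cmod_ge0 s; have nt := cmod_ge0 t.
pose K := cmod s + cmod t + 1; have K0 : 0 < K by rewrite /K; lra.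
pose e1 := Num.min 1 (e / K); have e10 : 0 < e1 by rewrite lt_min ltr01 divr_gt0.
have [N1 h1] := hs _ e10; have [N2 h2] := ht _ e10.
exists (maxn N1 N2) => N; rewrite geq_max => /andP[/h1 {}h1 /h2 {}h2].
have -> : u N * v N - s * t = (u N - s) * (v N - t) + (u N - s) * t + s * (v N - t) by ring.
have e11 : e1 <= 1 by rewrite ge_min lexx.
have e1K : e1 * K <= e by rewrite -ler_pdivlMr// ge_min lexx orbT.
have A : cmod ((u N - s) * (v N - t)) <= e1.
  by rewrite cmodM -[leRHS]mul1r mulrC ler_pM ?cmod_ge0// (le_trans h2).
have B : cmod ((u N - s) * t) <= e1 * cmod t by rewrite cmodM ler_wpM2r.
have D : cmod (s * (v N - t)) <= e1 * cmod s by rewrite cmodM mulrC ler_wpM2r.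
rewrite (le_trans (cmodD _ _))// (le_trans (lerD (cmodD _ _) (lexx _)))//.
by move: e1K; rewrite /K; lra.
Qed.

Lemma ccvgZ c u s : ccvg u s -> ccvg (fun N => c * u N) (c * s).
Proof. by move=> h; exact: ccvgM (ccvg_cst c) h. Qed.

Lemma ccvg_sum (I : finType) (u : I -> nat -> R[i]) (s : I -> R[i]) :
  (forall i, ccvg (u i) (s i)) -> ccvg (fun N => \sum_i u i N) (\sum_i s i).
Proof.
move=> h; have H (r : seq I) : ccvg (fun N => \sum_(i <- r) u i N) (\sum_(i <- r) s i).
  elim: r => [|i r IHr].
    by rewrite big_nil; under eq_fun do rewrite big_nil; exact: ccvg_cst.
  rewrite big_cons; under eq_fun do rewrite big_cons.
  exact: (ccvgD (h i) IHr).
exact: H.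
Qed.

Lemma ccvg_conj u s : ccvg u s -> ccvg (fun N => (u N)^bar) s^bar.
Proof.
by move=> h e /h[N0 hN]; exists N0 => N /hN; rewrite -rmorphB cmodJ.
Qed.

Lemma ccvg_eq u v s : u =1 v -> ccvg u s -> ccvg v s.
Proof. by move=> /funext->. Qed.

Lemma bilin_cvg x y a b : l2 x a -> l2 y b -> ccvg (psum x y) (bilin x y).
Proof.
move=> hx hy.
have key (P : R[i] -> R) : (forall w : R[i], `|P w| <= cmod w) ->
    (forall N, P (psum x y N) = \sum_(i < N) P (x i * y i)) ->
    cvgn (fun N => P (psum x y N)).
  move=> Ple PE.
  suff : cvgn (series (fun i => P (x i * y i))).
    by rewrite (_ : series _ = fun N => P (psum x y N))//; apply/funext => N; rewrite PE /series/= big_mkord.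
  apply: normed_cvg; apply: nondecreasing_is_cvgn.
    by apply: nondecreasing_series => i _ _; exact: normr_ge0.
  exists (a * b) => _ [N _ <-]; rewrite -[X in X <= _]/(\sum_(0 <= i < N) `|P (x i * y i)|) big_mkord.
  apply: le_trans (cauchy_schwarz_sum N hx hy).
  by apply: ler_sum => i _; rewrite -cmodM.
have h1 := key (@Rec R) Re_le_cmod (fun N => cRe_sum _ _ _).
have h2 := key (@Imc R) Im_le_cmod (fun N => cIm_sum _ _ _).
move=> e e0; have e2 : 0 < e / 2 by lra.
have [N1 _ H1] := (cvgrPdist_le _ _).1 h1 _ e2.
have [N2 _ H2] := (cvgrPdist_le _ _).1 h2 _ e2.
exists (maxn N1 N2) => N; rewrite geq_max => /andP[/H1 /= {}H1 /H2 /= {}H2].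
rewrite (le_trans (cmod_le_ReIm _))// cReB cImB /= distrC (distrC (Imc _)); lra.
Qed.

Lemma bilin_eq x y a b s : l2 x a -> l2 y b -> ccvg (psum x y) s -> bilin x y = s.
Proof. by move=> hx hy; exact: ccvg_unique (bilin_cvg hx hy). Qed.

Lemma bilin_le x y a b : l2 x a -> l2 y b -> cmod (bilin x y) <= a * b.
Proof.
move=> hx hy; apply: ccvg_bound (bilin_cvg hx hy) => N.
rewrite (le_trans (cmod_sum _ _ _))//; under eq_bigr do rewrite cmodM.
exact: cauchy_schwarz_sum.
Qed.

Lemma bilinC x y : bilin x y = bilin y x.
Proof.
by rewrite /bilin (_ : psum x y = psum y x)//; apply/funext => N; apply: eq_bigr => i _; rewrite mulrC.
Qed.

Lemma bilinDl x y z a b (c : R) : l2 x a -> l2 y b -> l2 z c -> bilin (x + y) z = bilin x z + bilin y z.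
Proof.
move=> hx hy hz; apply: (bilin_eq (l2D hx hy) hz).
apply: ccvg_eq (ccvgD (bilin_cvg hx hz) (bilin_cvg hy hz)) => N.
by rewrite /psum -big_split; apply: eq_bigr => i _; exact: esym (mulrDl _ _ _).
Qed.

Lemma bilinZl x y a b c : l2 x a -> l2 y b -> bilin (c *: x) y = c * bilin x y.
Proof.
move=> hx hy; apply: (bilin_eq (l2Z c hx) hy).
apply: ccvg_eq (ccvgZ c (bilin_cvg hx hy)) => N.
by rewrite /psum mulr_sumr; apply: eq_bigr => i _; exact: mulrA.
Qed.

Lemma bilinBl x y z a b (c : R) : l2 x a -> l2 y b -> l2 z c -> bilin (x - y) z = bilin x z - bilin y z.
Proof.
move=> hx hy hz; rewrite (bilinDl hx (l2N hy) hz) -scaleN1r (bilinZl _ hy hz).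
by rewrite mulN1r.
Qed.

Lemma bilinDr x y z a b (c : R) : l2 x a -> l2 y b -> l2 z c -> bilin x (y + z) = bilin x y + bilin x z.
Proof. by move=> hx hy hz; rewrite !(bilinC x); exact: bilinDl hy hz hx. Qed.

Lemma bilinZr x y a b c : l2 x a -> l2 y b -> bilin x (c *: y) = c * bilin x y.
Proof. by move=> hx hy; rewrite !(bilinC x); exact: bilinZl hy hx. Qed.

Lemma bilinBr x y z a b (c : R) : l2 x a -> l2 y b -> l2 z c -> bilin x (y - z) = bilin x y - bilin x z.
Proof. by move=> hx hy hz; rewrite !(bilinC x); exact: bilinBl hy hz hx. Qed.

Lemma bilin_conj x y a b : l2 x a -> l2 y b -> bilin (conj_seq x) (conj_seq y) = (bilin x y)^bar.
Proof.
move=> hx hy; apply: (bilin_eq (l2_conj_seq hx) (l2_conj_seq hy)).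
apply: ccvg_eq (ccvg_conj (bilin_cvg hx hy)) => N.
by rewrite /psum rmorph_sum; apply: eq_bigr => i _; rewrite rmorphM.
Qed.

Definition sqnorm x : R := Rec (bilin x (conj_seq x)).

Lemma psum_sqnorm x N : psum x (conj_seq x) N = (\sum_(i < N) cmod (x i) ^+ 2)%:C.
Proof. by rewrite /psum rmorph_sum; apply: eq_bigr => i _; rewrite mulcJ. Qed.

Lemma psum_le_sqnorm x a N : l2 x a -> \sum_(i < N) cmod (x i) ^+ 2 <= sqnorm x.
Proof.
move=> hx; apply/ler_addgt0Pr => e e0.
have [N0 h] := bilin_cvg hx (l2_conj_seq hx) e0.
have := h (maxn N0 N) (leq_maxl _ _); rewrite psum_sqnorm => h1.
have := le_trans (Re_le_cmod _) h1; rewrite cReB -/(sqnorm x) cRe_real ler_norml => /andP[_ h2].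
suff : \sum_(i < N) cmod (x i) ^+ 2 <= \sum_(i < maxn N0 N) cmod (x i) ^+ 2 by lra.
rewrite -!(big_mkord xpredT (fun i => cmod (x i) ^+ 2)).
rewrite [leRHS](big_cat_nat (leq0n N) (leq_maxr _ _))/= lerDl.
by apply: sumr_ge0 => i _; rewrite exprn_ge0 ?cmod_ge0.
Qed.

Lemma sqnorm_ge0 x a : l2 x a -> 0 <= sqnorm x.
Proof. by move=> /(psum_le_sqnorm 0); rewrite big_ord0. Qed.

Lemma sqnorm_le x a : l2 x a -> sqnorm x <= a ^+ 2.
Proof.
move=> hx; rewrite (le_trans (ler_norm _))// (le_trans (Re_le_cmod _))// expr2.
exact: bilin_le (l2_conj_seq hx).
Qed.

Lemma bilin_sqnorm x a : l2 x a -> bilin x (conj_seq x) = (sqnorm x)%:C.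
Proof.
move=> hx; apply: complex_ext => //; rewrite -[RHS]/(0 : R).
have h : bilin x (conj_seq x) = (bilin x (conj_seq x))^bar by rewrite -(bilin_conj hx (l2_conj_seq hx)) conj_seqK bilinC.
have := congr1 (@Imc R) h; rewrite cImJ; lra.
Qed.

Lemma l2_sqrt x a : l2 x a -> l2 x (Num.sqrt (sqnorm x)).
Proof.
move=> hx; split; first exact: sqrtr_ge0.
by move=> N; rewrite sqr_sqrtr ?(sqnorm_ge0 hx)// (psum_le_sqnorm N hx).
Qed.

Lemma sqnorm_eq0 x a : l2 x a -> sqnorm x <= 0 -> x = 0.
Proof.
move=> hx s0; have E : sqnorm x = 0 by apply/eqP; rewrite eq_le s0 (sqnorm_ge0 hx).
by have := l2_sqrt hx; rewrite E sqrtr0; exact: l2_eq0.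
Qed.

Lemma cauchy_schwarz x y a b : l2 x a -> l2 y b ->
  cmod (bilin x (conj_seq y)) ^+ 2 <= sqnorm x * sqnorm y.
Proof.
move=> hx hy; have hx0 := sqnorm_ge0 hx; have hy0 := sqnorm_ge0 hy.
rewrite -(sqr_sqrtr hx0) -(sqr_sqrtr hy0) -exprMn lerXn2r ?nnegrE ?cmod_ge0 ?mulr_ge0 ?sqrtr_ge0//.
by apply: bilin_le; [exact: l2_sqrt hx|exact: l2_conj_seq (l2_sqrt hy)].
Qed.

End SquareSummable.

(** * Differentiability with quadratic remainders *)

Section QuadraticRemainders.
Context {R : realType}.
Implicit Types (f g : R[i] -> R[i]) (z w : R[i]) (r C : R).

(** A quantitative differentiability, uniform on a disc: it is stable under
    products, quotients and pairings by elementary estimates. *)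
Definition qdiff_by C r f f' := forall z w, cmod z < r -> cmod w < r ->
  [/\ cmod (f z) <= C, cmod (f' z) <= C &
      cmod (f w - f z - (w - z) * f' z) <= C * cmod (w - z) ^+ 2].

Definition qdiff r f f' := exists2 C, 0 <= C & qdiff_by C r f f'.

Lemma disc_diam r z w : cmod z < r -> cmod w < r -> cmod (w - z) <= 2 * r.
Proof. by move=> zr wr; rewrite (le_trans (cmodB _ _))//; lra. Qed.

Lemma qdiff_by_lip C r f f' z w : qdiff_by C r f f' -> cmod z < r -> cmod w < r ->
  cmod (f w - f z) <= C * (1 + 2 * r) * cmod (w - z).
Proof.
move=> h zr wr; have [h0 h1 h2] := h z w zr wr.
have C0 : 0 <= C by apply: le_trans h0; exact: cmod_ge0.
have d := disc_diam zr wr; have d0 := cmod_ge0 (w - z).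
have -> : f w - f z = (f w - f z - (w - z) * f' z) + (w - z) * f' z by ring.
rewrite (le_trans (cmodD _ _))// cmodM.
have : cmod (w - z) * cmod (f' z) <= cmod (w - z) * C by rewrite ler_wpM2l.
have : C * cmod (w - z) ^+ 2 <= C * (2 * r) * cmod (w - z).
  by rewrite expr2 mulrA ler_wpM2r// ler_wpM2l.
lra.
Qed.

Lemma qdiff_le r r' f f' : r' <= r -> qdiff r f f' -> qdiff r' f f'.
Proof.
by move=> rr [C C0 h]; exists C => // z w zr wr; apply: h; apply: lt_le_trans rr.
Qed.

Lemma qdiff_ext r f f' g g' : (forall z, cmod z < r -> g z = f z) ->
  (forall z, cmod z < r -> g' z = f' z) -> qdiff r f f' -> qdiff r g g'.
Proof.
by move=> e e' [C C0 h]; exists C => // z w zr wr; rewrite !e// e'//; exact: h.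
Qed.

Lemma qdiff_cst r (a : R[i]) : qdiff r (fun=> a) (fun=> 0).
Proof.
exists (cmod a); first exact: cmod_ge0.
move=> z w _ _; split=> //; first by rewrite cmod0 cmod_ge0.
by rewrite subrr mulr0 subr0 cmod0 mulr_ge0 ?exprn_ge0 ?cmod_ge0.
Qed.

Lemma qdiffD r f f' g g' : qdiff r f f' -> qdiff r g g' ->
  qdiff r (fun z => f z + g z) (fun z => f' z + g' z).
Proof.
move=> [C C0 hf] [D D0 hg]; exists (C + D); first exact: addr_ge0.
move=> z w zr wr; have [f0 f1 f2] := hf z w zr wr; have [g0 g1 g2] := hg z w zr wr.
split.
- by rewrite (le_trans (cmodD _ _))// lerD.
- by rewrite (le_trans (cmodD _ _))// lerD.
- have -> : f w + g w - (f z + g z) - (w - z) * (f' z + g' z) =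
    (f w - f z - (w - z) * f' z) + (g w - g z - (w - z) * g' z) by ring.
  by rewrite (le_trans (cmodD _ _))// [leRHS]mulrDl lerD.
Qed.

Lemma qdiffM r f f' g g' : 0 < r -> qdiff r f f' -> qdiff r g g' ->
  qdiff r (fun z => f z * g z) (fun z => f' z * g z + f z * g' z).
Proof.
move=> r0 [C C0 hf] [D D0 hg].
have CD : 0 <= C * D by rewrite mulr_ge0.
have CDr : 0 <= C * D * r by rewrite mulr_ge0// ltW.
exists (C * D * (3 + 2 * r)); first by rewrite mulr_ge0//; lra.
move=> z w zr wr; have [f0 f1 f2] := hf z w zr wr; have [g0 g1 g2] := hg z w zr wr.
have [gw _ _] := hg w z wr zr; have lg := qdiff_by_lip hg zr wr.
split.
- by rewrite cmodM (le_trans (ler_pM _ _ f0 g0)) ?cmod_ge0//; lra.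
- rewrite (le_trans (cmodD _ _))// !cmodM.
  have := ler_pM (cmod_ge0 _) (cmod_ge0 _) f1 g0; have := ler_pM (cmod_ge0 _) (cmod_ge0 _) f0 g1; lra.
- have -> : f w * g w - f z * g z - (w - z) * (f' z * g z + f z * g' z) =
    (f w - f z - (w - z) * f' z) * g w + f z * (g w - g z - (w - z) * g' z)
    + (w - z) * f' z * (g w - g z) by ring.
  rewrite (le_trans (cmodD _ _))// (le_trans (lerD (cmodD _ _) (lexx _)))// !cmodM.
  have h1 := ler_pM (cmod_ge0 _) (cmod_ge0 _) f2 gw.
  have h2 := ler_pM (cmod_ge0 _) (cmod_ge0 _) f0 g2.
  have h3 := ler_pM (cmod_ge0 _) (cmod_ge0 _) f1 lg.
  have h4 := ler_wpM2l (cmod_ge0 (w - z)) h3.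
  by move: h1 h2 h4; lra.
Qed.

Lemma qdiffB r f f' g g' : 0 < r -> qdiff r f f' -> qdiff r g g' ->
  qdiff r (fun z => f z - g z) (fun z => f' z - g' z).
Proof.
move=> r0 hf hg; apply: qdiff_ext (qdiffD hf (qdiffM r0 (qdiff_cst r (-1)) hg)) => z _; ring.
Qed.

Lemma qdiffV r f f' c : 0 < r -> 0 < c -> (forall z, cmod z < r -> c <= cmod (f z)) ->
  qdiff r f f' -> qdiff r (fun z => (f z)^-1) (fun z => - f' z / f z ^+ 2).
Proof.
move=> r0 c0 fc [C C0 hf].
have V z : cmod z < r -> cmod (f z)^-1 <= c^-1.
  move=> zr; rewrite cmodV lef_pV2 ?posrE ?fc//; exact: lt_le_trans (fc z zr).
have Vp z := cmod_ge0 (f z)^-1.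
have cV0 : 0 <= c^-1 by rewrite invr_ge0 ltW.
pose D1 := c^-1; pose D2 := C * c^-1 ^+ 2; pose D3 := (C * C + C * (C * (1 + 2 * r))) * c^-1 ^+ 3.
have D10 : 0 <= D1 by [].
have D20 : 0 <= D2 by rewrite mulr_ge0 ?exprn_ge0.
have D30 : 0 <= D3 by rewrite mulr_ge0 ?exprn_ge0// addr_ge0 ?mulr_ge0//; lra.
exists (D1 + D2 + D3); first by rewrite !addr_ge0.
move=> z w zr wr; have [f0 f1 f2] := hf z w zr wr; have lf := qdiff_by_lip hf zr wr.
have fz0 : f z != 0 by rewrite -cmod_gt0 (lt_le_trans c0)// fc.
have fw0 : f w != 0 by rewrite -cmod_gt0 (lt_le_trans c0)// fc.
split.
- by have := V z zr; rewrite -/D1; lra.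
- rewrite cmodM cmodN -exprVn cmodX.
  have := ler_pM (cmod_ge0 _) (exprn_ge0 2 (Vp z)) f1 (lerXn2r 2 (Vp z) cV0 (V z zr)).
  by rewrite -/D2; lra.
- have -> : (f w)^-1 - (f z)^-1 - (w - z) * (- f' z / f z ^+ 2) =
    ((w - z) * f' z * (f w - f z) - (f w - f z - (w - z) * f' z) * f z)
      * ((f w)^-1 * (f z)^-1 ^+ 2) by field; rewrite fz0 fw0.
  have n0 := cmod_ge0 (w - z).
  apply: (@le_trans _ _ (D3 * cmod (w - z) ^+ 2)); last first.
    by rewrite ler_wpM2r ?exprn_ge0//; lra.
  have -> : D3 * cmod (w - z) ^+ 2 =
    ((C * C + C * (C * (1 + 2 * r))) * cmod (w - z) ^+ 2) * (c^-1 * c^-1 ^+ 2).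
    by rewrite /D3; ring.
  rewrite cmodM ler_pM ?cmod_ge0//; last first.
    by rewrite cmodM cmodX ler_pM ?cmod_ge0 ?exprn_ge0 ?cmod_ge0 ?V// lerXn2r ?nnegrE ?cmod_ge0 ?V.
  rewrite (le_trans (cmodB _ _))// !cmodM.
  have h1 := ler_pM (cmod_ge0 _) (cmod_ge0 _) f2 f0.
  have h3 := ler_pM (cmod_ge0 _) (cmod_ge0 _) f1 lf.
  have h4 := ler_wpM2l n0 h3.
  by move: h1 h4; lra.
Qed.

Lemma qdiff_has_deriv r f f' z : qdiff r f f' -> cmod z < r -> has_deriv f z (f' z).
Proof.
move=> [C C0 h] zr e e0.
exists (Num.min (r - cmod z) (e / (C + 1))).
  by rewrite lt_min subr_gt0 zr divr_gt0//; lra.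
move=> w; rewrite lt_min => /andP[w1 w2].
have wr : cmod w < r by have := cmodD (w - z) z; rewrite subrK; lra.
have [_ _ h2] := h z w zr wr; rewrite (le_trans h2)// expr2 mulrA ler_wpM2r ?cmod_ge0//.
have : (C + 1) * cmod (w - z) <= e by rewrite mulrC -ler_pdivlMr ?ltW//; lra.
by have := cmod_ge0 (w - z); lra.
Qed.

(** Go from 0 to z in n equal steps: each step contributes O(1 / n^2). *)
Lemma qdiff_const r f f' z : qdiff r f f' -> (forall z, cmod z < r -> f' z = 0) ->
  cmod z < r -> f z = f 0.
Proof.
move=> [C C0 h] f'0 zr.
have step (n k : nat) : (0 < n)%N -> (k <= n)%N ->
    cmod (f ((k%:R / n%:R)%:C * z) - f 0) <= k%:R * (C * (cmod z / n%:R) ^+ 2).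
  move=> n0; have n1 : 0 < n%:R :> R by rewrite ltr0n.
  have inr m : (m <= n)%N -> cmod ((m%:R / n%:R)%:C * z) < r.
    move=> mn; rewrite cmodM cmod_real ger0_norm ?divr_ge0//.
    apply: le_lt_trans zr; rewrite -[leRHS]mul1r ler_wpM2r ?cmod_ge0//.
    by rewrite ler_pdivrMr// mul1r ler_nat.
  elim: k => [|k IHk] kn.
    by rewrite mul0r (_ : 0%:C = 0)// !mul0r subrr cmod0.
  have {}IHk := IHk (ltnW kn); have [_ _] := h _ _ (inr k (ltnW kn)) (inr _ kn).
  rewrite f'0 ?inr ?(ltnW kn)// mulr0 subr0.
  have -> : (k.+1%:R / n%:R)%:C * z - (k%:R / n%:R)%:C * z = (n%:R^-1)%:C * z.
    by rewrite -mulrBl -rmorphB -mulrBl -natrB// subSnn mul1r.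
  rewrite cmodM cmod_real ger0_norm ?invr_ge0// [_ * cmod z]mulrC => h1.
  have := cmodBD (f ((k.+1%:R / n%:R)%:C * z)) (f ((k%:R / n%:R)%:C * z)) (f 0).
  have -> : k.+1%:R * (C * (cmod z / n%:R) ^+ 2) = k%:R * (C * (cmod z / n%:R) ^+ 2) + C * (cmod z / n%:R) ^+ 2.
    by rewrite -natr1 mulrDl mul1r.
  move=> h2; apply: le_trans h2 _; rewrite addrC; exact: lerD.
apply/eqP; rewrite -subr_eq0; apply/eqP/cmod_eq0P => e e0.
pose K := C * cmod z ^+ 2; have K0 : 0 <= K by rewrite mulr_ge0 ?exprn_ge0 ?cmod_ge0.
have [n hn] : exists n : nat, K / e < n%:R.
  by exists (Num.truncn (K / e)).+1; exact: truncnS_gt.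
have n0 : (0 < n)%N.
  by rewrite -(ltr0n R) (le_lt_trans _ hn)// divr_ge0// ltW.
have n1 : 0 < n%:R :> R by rewrite ltr0n.
have := step n n n0 (leqnn n); rewrite divff ?gt_eqF// mul1r => /le_trans; apply.
have -> : n%:R * (C * (cmod z / n%:R) ^+ 2) = K / n%:R by rewrite /K; field; rewrite gt_eqF.
by rewrite ler_pdivrMr// mulrC -ler_pdivrMr// ltW.
Qed.

(** The radius drops from r to r / 4 to stay in the range of Cauchy's formula on
    a circle, and by 2 inside that circle. *)
Lemma qdiff_identity r f f' : 0 < r -> qdiff r f f' ->
  (forall x : R, 0 < x < r -> f x%:C = 0) -> forall z, cmod z < r / 8 -> f z = 0.
Proof.
move=> r0 hf f0 z zr; have [C C0 h] := hf; have r4 : 0 < r / 4 by lra.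
apply: (identity_real r4 (f := f) (f1 := f') (B := C) (M := C)).
- move=> w wr; apply: (qdiff_has_deriv hf); lra.
- by move=> w wr; have [] := h w w; lra.
- by move=> w wr; have [] := h w w; lra.
- by move=> x xr; apply: f0; lra.
- lra.
Qed.

Definition hol r f := exists f', qdiff r f f'.

Lemma hol_cst r (a : R[i]) : hol r (fun=> a).
Proof. by eexists; exact: qdiff_cst. Qed.

Lemma holM r f g : 0 < r -> hol r f -> hol r g -> hol r (fun z => f z * g z).
Proof. by move=> r0 [f' hf] [g' hg]; eexists; exact: qdiffM r0 hf hg. Qed.

Lemma holB r f g : 0 < r -> hol r f -> hol r g -> hol r (fun z => f z - g z).
Proof. by move=> r0 [f' hf] [g' hg]; eexists; exact: qdiffB r0 hf hg. Qed.

End QuadraticRemainders.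

Section Curves.
Context {R : realType}.
Implicit Types (X Y : R[i] -> nat -> R[i]) (z w : R[i]) (r C : R).

Definition l2diff_by C r X X' := forall z w, cmod z < r -> cmod w < r ->
  [/\ l2 (X z) C, l2 (X' z) C &
      l2 (X w - X z - (w - z) *: X' z) (C * cmod (w - z) ^+ 2)].

Definition l2diff r X X' := exists2 C, 0 <= C & l2diff_by C r X X'.

Lemma l2diff_le r r' X X' : r' <= r -> l2diff r X X' -> l2diff r' X X'.
Proof.
by move=> rr [C C0 h]; exists C => // z w zr wr; apply: h; apply: lt_le_trans rr.
Qed.

Lemma l2diff_by_lip C r X X' z w : l2diff_by C r X X' -> cmod z < r -> cmod w < r ->
  l2 (X w - X z) (C * (1 + 2 * r) * cmod (w - z)).
Proof.
move=> h zr wr; have [h0 h1 h2] := h z w zr wr; have C0 := l2_ge0 h0.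
have d := disc_diam zr wr; have d0 := cmod_ge0 (w - z).
have -> : X w - X z = (X w - X z - (w - z) *: X' z) + (w - z) *: X' z by rewrite subrK.
apply: l2_le (l2D h2 (l2Z (w - z) h1)).
have : C * cmod (w - z) ^+ 2 <= C * (2 * r) * cmod (w - z).
  by rewrite expr2 mulrA ler_wpM2r// ler_wpM2l.
lra.
Qed.

Lemma l2diff_affine r r0 X X' (a b : R[i]) : (forall x, cmod x < r0 -> cmod (a * x + b) < r) ->
  l2diff r X X' -> l2diff r0 (fun x => X (a * x + b)) (fun x => a *: X' (a * x + b)).
Proof.
move=> ab [C C0 h]; have na := cmod_ge0 a.
have a2 : 0 <= cmod a ^+ 2 by rewrite exprn_ge0.
have Ca : 0 <= C * cmod a by rewrite mulr_ge0.
have Ca2 : 0 <= C * cmod a ^+ 2 by rewrite mulr_ge0.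
exists (C + C * (cmod a + cmod a ^+ 2)); first by lra.
move=> z w /ab zr /ab wr; have [h0 h1 h2] := h _ _ zr wr; split.
- by apply: l2_le h0; lra.
- by apply: l2_le (l2Z a h1); lra.
- have E : a * w + b - (a * z + b) = a * (w - z) by ring.
  rewrite scalerA [_ * a]mulrC -E; apply: l2_le h2; rewrite E cmodM exprMn mulrA.
  by rewrite ler_wpM2r ?exprn_ge0 ?cmod_ge0//; lra.
Qed.

(** Conjugation in the source and in the target, which is again holomorphic. *)
Definition star X z := conj_seq (X z^bar).

Lemma l2diff_star r X X' : l2diff r X X' -> l2diff r (star X) (star X').
Proof.
move=> [C C0 h]; exists C => // z w zr wr.
have := h z^bar w^bar; rewrite !cmodJ => /(_ zr wr)[h0 h1 h2]; split; [exact: l2_conj_seq..|].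
have E : w^bar - z^bar = (w - z)^bar by rewrite rmorphB.
by have := l2_conj_seq h2; rewrite E cmodJ !(conj_seqD, conj_seqN, conj_seqZ) cJK.
Qed.

Lemma qdiff_bilin r X X' Y Y' : 0 < r -> l2diff r X X' -> l2diff r Y Y' ->
  qdiff r (fun z => bilin (X z) (Y z)) (fun z => bilin (X' z) (Y z) + bilin (X z) (Y' z)).
Proof.
move=> r0 [C C0 hX] [D D0 hY].
have CD : 0 <= C * D by rewrite mulr_ge0.
have CDr : 0 <= C * D * r by rewrite mulr_ge0// ltW.
exists (C * D * (3 + 2 * r)); first by rewrite mulr_ge0//; lra.
move=> z w zr wr; have [x0 x1 x2] := hX z w zr wr; have [y0 y1 y2] := hY z w zr wr.
have [yw _ _] := hY w z wr zr; have ly := l2diff_by_lip hY zr wr.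
have [xw _ _] := hX w z wr zr.
split.
- by rewrite (le_trans (bilin_le x0 y0))//; lra.
- rewrite (le_trans (cmodD _ _))//.
  by have := bilin_le x1 y0; have := bilin_le x0 y1; lra.
- have -> : bilin (X w) (Y w) - bilin (X z) (Y z) - (w - z) * (bilin (X' z) (Y z) + bilin (X z) (Y' z)) =
    bilin (X w - X z - (w - z) *: X' z) (Y w) + bilin (X z) (Y w - Y z - (w - z) *: Y' z)
    + (w - z) * bilin (X' z) (Y w - Y z).
    have xx := l2B xw x0; have zx := l2Z (w - z) x1.
    have yy := l2B yw y0; have zy := l2Z (w - z) y1.
    rewrite (bilinBl xx zx yw) (bilinBl xw x0 yw) (bilinZl _ x1 yw).
    rewrite (bilinBr x0 yy zy) (bilinBr x0 yw y0) (bilinZr _ x0 y1) (bilinBr x1 yw y0).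
    by ring.
  rewrite (le_trans (cmodD _ _))// (le_trans (lerD (cmodD _ _) (lexx _)))//.
  have h1 := bilin_le x2 yw; have h2 := bilin_le x0 y2; have h3 := bilin_le x1 ly.
  have h4 := ler_wpM2l (cmod_ge0 (w - z)) h3.
  by rewrite cmodM; move: h1 h2 h4; lra.
Qed.

(** The components of the curve satisfy the Cauchy estimates uniformly, since
    these only involve a bound on the function; duality turns this into an
    estimate in norm. *)
Lemma curve_regularity (rho C : R) X X1 : 0 < rho ->
  (forall z, cmod z < rho -> l2 (X z) C) -> (forall z, cmod z < rho -> l2 (X1 z) C) ->
  (forall z, cmod z < rho -> forall e : R, 0 < e -> exists2 d : R, 0 < d &
     forall w, cmod (w - z) < d -> l2 (X w - X z - (w - z) *: X1 z) (e * cmod (w - z))) ->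
  exists X2, l2diff (rho / 8) X X1 /\ l2diff (rho / 8) X1 X2.
Proof.
move=> rho0 XC X1C dX; have r0 : 0 < rho / 4 by lra.
have r4 : 4 * (rho / 4) = rho by lra.
have C0 : 0 <= C by apply: l2_ge0 (XC 0 _); rewrite cmod0.
pose f N (v : nat -> R[i]) z := \sum_(i < N) v i * X z i.
pose f1 N (v : nat -> R[i]) z := \sum_(i < N) v i * X1 z i.
have pair_le N (v : nat -> R[i]) (x : nat -> R[i]) a : \sum_(i < N) cmod (v i) ^+ 2 <= 1 -> l2 x a ->
    cmod (\sum_(i < N) v i * x i) <= a.
  move=> v1 [a0 hx]; rewrite (le_trans (cmod_sum _ _ _))// -[leRHS]mul1r.
  under eq_bigr do rewrite cmodM.
  apply: cauchy_schwarz_fin => //; try by move=> i; exact: cmod_ge0.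
  by rewrite expr1n.
(* the components in finitely supported directions v of norm at most 1 *)
have reg N (v : nat -> R[i]) : \sum_(i < N) cmod (v i) ^+ 2 <= 1 -> exists f2 : R[i] -> R[i],
    forall z w, cmod z < rho / 8 -> cmod w < rho / 8 ->
    [/\ cmod (f1 N v z) <= reg_cst (rho / 4) * C, cmod (f2 z) <= reg_cst (rho / 4) * C,
      cmod (f N v w - f N v z - (w - z) * f1 N v z) <= reg_cst (rho / 4) * C * cmod (w - z) ^+ 2 &
      cmod (f1 N v w - f1 N v z - (w - z) * f2 z) <= reg_cst (rho / 4) * C * cmod (w - z) ^+ 2].
  move=> v1; have E : rho / 8 = rho / 4 / 2 by field.
  rewrite E; apply: (regularity r0 (B := C)); rewrite r4.
  - move=> z zr e e0; have [d d0 hd] := dX z zr e e0; exists d => // w /hd h.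
    have := pair_le N v _ _ v1 h; congr (cmod _ <= _).
    rewrite /f /f1 mulr_sumr -!sumrB; apply: eq_bigr => i _.
    by rewrite -[X in X = _]/(_ * (X w i - X z i - (w - z) * X1 z i)); ring.
  - by move=> z zr; apply: pair_le (X1C z zr).
  - by move=> z zr; apply: pair_le (XC z zr).
pose u i : nat -> R[i] := fun j => (j == i)%:R.
have u1 i : \sum_(j < i.+1) cmod (u i j) ^+ 2 <= 1.
  rewrite big_ord_recr /= /u eqxx cmod1 expr1n big1 ?add0r// => j _.
  by rewrite ltn_eqF// cmod0 expr0n.
have uE i (x : nat -> R[i]) : \sum_(j < i.+1) u i j * x j = x i.
  rewrite big_ord_recr /= /u eqxx mul1r big1 ?add0r// => j _.
  by rewrite ltn_eqF// mul0r.
have /choice[g hg] i := reg i.+1 (u i) (u1 i).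
(* the second derivative is built coordinatewise, and f2 above is its v-component *)
pose X2 z i := g i z.
have X2E N (v : nat -> R[i]) z : cmod z < rho / 8 -> \sum_(i < N) cmod (v i) ^+ 2 <= 1 ->
    forall f2, (forall w, cmod w < rho / 8 ->
       cmod (f1 N v w - f1 N v z - (w - z) * f2 z) <= reg_cst (rho / 4) * C * cmod (w - z) ^+ 2) ->
    f2 z = \sum_(i < N) v i * X2 z i :> R[i].
  move=> zr v1 f2 hf2; have k0 : 0 < rho / 8 - cmod z by rewrite subr_gt0.
  have inr w : cmod (w - z) < rho / 8 - cmod z -> cmod w < rho / 8.
    by have := cmodD (w - z) z; rewrite subrK; lra.
  apply: (@has_deriv_quad_unique R (f1 N v) z _ _ (reg_cst (rho / 4) * C) (rho / 8 - cmod z)) => //.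
    pose D := \sum_(i < N) cmod (v i) * (reg_cst (rho / 4) * C).
    have D0 : 0 <= D.
      apply: sumr_ge0 => i _; rewrite mulr_ge0 ?cmod_ge0//.
      by have [h _ _ _] := hg i z z zr zr; exact: le_trans (cmod_ge0 _) h.
    move=> e e0; exists (Num.min (rho / 8 - cmod z) (e / (D + 1))).
      by rewrite lt_min k0 divr_gt0//; lra.
    move=> w; rewrite lt_min => /andP[/inr wr we].
    have -> : f1 N v w - f1 N v z - (w - z) * (\sum_(i < N) v i * X2 z i) =
        \sum_(i < N) v i * (X1 w i - X1 z i - (w - z) * X2 z i).
      by rewrite /f1 mulr_sumr -!sumrB; apply: eq_bigr => i _; ring.
    apply: (@le_trans _ _ (D * cmod (w - z) ^+ 2)).
      rewrite (le_trans (cmod_sum _ _ _))// /D mulr_suml ler_sum// => i _.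
      rewrite cmodM -mulrA ler_wpM2l ?cmod_ge0//.
      by have [_ _ _] := hg i z w zr wr; rewrite /f1 !uE.
    rewrite expr2 mulrA ler_wpM2r ?cmod_ge0//.
    have : (D + 1) * cmod (w - z) <= e by rewrite mulrC -ler_pdivlMr ?ltW//; lra.
    by have := cmod_ge0 (w - z); lra.
  by move=> w /inr; exact: hf2.
have K0 : 0 <= reg_cst (rho / 4) * C.
  have z0 : cmod (0 : R[i]) < rho / 8 by rewrite cmod0; lra.
  by have [h _ _ _] := hg 0%N 0 0 z0 z0; exact: le_trans (cmod_ge0 _) h.
have dual z w : cmod z < rho / 8 -> cmod w < rho / 8 ->
    [/\ l2 (X2 z) (reg_cst (rho / 4) * C),
     l2 (X w - X z - (w - z) *: X1 z) (reg_cst (rho / 4) * C * cmod (w - z) ^+ 2) &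
     l2 (X1 w - X1 z - (w - z) *: X2 z) (reg_cst (rho / 4) * C * cmod (w - z) ^+ 2)].
  move=> zr wr; have k0 : 0 <= reg_cst (rho / 4) * C * cmod (w - z) ^+ 2.
    by rewrite mulr_ge0 ?exprn_ge0 ?cmod_ge0.
  have dualE N (v : nat -> R[i]) (v1 : \sum_(i < N) cmod (v i) ^+ 2 <= 1) := reg N v v1.
  split; apply: l2_dual => // N v /[dup] v1 /(dualE N)[f2 hf2].
  - have E : f2 z = \sum_(i < N) v i * X2 z i.
      by apply: (X2E N v z zr v1) => w' wr'; have [] := hf2 z w' zr wr'.
    by rewrite -E; have [] := hf2 z z zr zr.
  - have [_ _ + _] := hf2 z w zr wr; congr (cmod _ <= _).
    rewrite /f /f1 mulr_sumr -!sumrB; apply: eq_bigr => i _.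
    by rewrite -[X in _ = X]/(_ * (X w i - X z i - (w - z) * X1 z i)); ring.
  - have E : f2 z = \sum_(i < N) v i * X2 z i.
      by apply: (X2E N v z zr v1) => w' wr'; have [] := hf2 z w' zr wr'.
    have [_ _ _] := hf2 z w zr wr; rewrite E.
    congr (cmod _ <= _); rewrite /f1 mulr_sumr -!sumrB; apply: eq_bigr => i _.
    by rewrite -[X in _ = X]/(_ * (X1 w i - X1 z i - (w - z) * X2 z i)); ring.
have le_rho z : cmod z < rho / 8 -> cmod z < rho by lra.
exists X2; split; exists (C + reg_cst (rho / 4) * C); try lra; move=> z w zr wr.
- have [_ h _] := dual z w zr wr; split.
  + by apply: l2_le (XC z (le_rho z zr)); lra.
  + by apply: l2_le (X1C z (le_rho z zr)); lra.
  + by apply: l2_le h; rewrite ler_wpM2r ?exprn_ge0 ?cmod_ge0//; lra.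
- have [h2 _ h] := dual z w zr wr; split.
  + by apply: l2_le (X1C z (le_rho z zr)); lra.
  + by apply: l2_le h2; lra.
  + by apply: l2_le h; rewrite ler_wpM2r ?exprn_ge0 ?cmod_ge0//; lra.
Qed.

End Curves.

(** * Polarization *)

Section Polarization.
Context {R : realType}.
Implicit Types (z w x y : R[i]) (r : R).

Lemma cmod_i : cmod (ci : R[i]) = 1.
Proof. by rewrite /cmod /= expr0n expr1n add0r sqrtr1. Qed.

Lemma mulii : ci * ci = -1 :> R[i].
Proof. exact: (@sqr_i R). Qed.

(** In the coordinates z = x + iy, w = x - iy the diagonal w = conj z becomes
    the real locus, and the identity theorem applies to x, then to y. *)
Lemma polarize (T : R[i] -> R[i] -> R[i]) r : 0 < r ->
  (forall a b a' b', (forall x, cmod x < r / 2 -> cmod (a * x + b) < r) ->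
     (forall x, cmod x < r / 2 -> cmod (a' * x + b') < r) ->
     hol (r / 2) (fun x => T (a * x + b) (a' * x + b'))) ->
  (forall z, cmod z < r -> T z z^bar = 0) ->
  forall z w, cmod z < r / 16 -> cmod w < r / 16 -> T z w = 0.
Proof.
move=> r0 hT T0; have r2 : 0 < r / 2 by lra.
have step1 (y : R) x : `|y| < r / 2 -> cmod x < r / 16 ->
    T (x + ci * y%:C) (x - ci * y%:C) = 0.
  move=> yr xr; have ny : cmod (ci * y%:C) < r / 2 by rewrite cmodM cmod_i cmod_real mul1r.
  have [f' hf] : hol (r / 2) (fun x => T (1 * x + ci * y%:C) (1 * x + - (ci * y%:C))).
    apply: hT => u ur; rewrite mul1r (le_lt_trans (cmodD _ _))// ?cmodN; lra.
  have := qdiff_identity r2 hf _ (_ : cmod x < r / 2 / 8); rewrite !mul1r; apply; last by lra.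
  move=> t tr; rewrite !mul1r.
  have -> : t%:C - ci * y%:C = (t%:C + ci * y%:C)^bar.
    by apply: complex_ext; rewrite /=; ring.
  apply: T0; rewrite (le_lt_trans (cmodD _ _))// cmod_real gtr0_norm; lra.
have step2 x y : cmod x < r / 16 -> cmod y < r / 16 -> T (x + ci * y) (x - ci * y) = 0.
  move=> xr yr.
  have [f' hf] : hol (r / 2) (fun y => T (ci * y + x) ((- ci) * y + x)).
    by apply: hT => u ur; rewrite (le_lt_trans (cmodD _ _))// cmodM ?cmodN cmod_i mul1r; lra.
  have := qdiff_identity r2 hf _ (_ : cmod y < r / 2 / 8).
  rewrite mulNr !(addrC _ x); apply; last by lra.
  move=> t tr; rewrite mulNr !(addrC _ x); apply: step1 => //.
  by rewrite gtr0_norm; lra.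
move=> z w zr wr.
have i2 : 2^-1 = (2^-1 : R)%:C :> R[i] by rewrite fmorphV rmorphMn rmorph1.
have n2 : cmod (2^-1 : R[i]) = 2^-1 by rewrite i2 cmod_real ger0_norm// invr_ge0.
have E1 : z = (z + w) / 2 + ci * ((z - w) / 2 * - ci).
  have -> : ci * ((z - w) / 2 * - ci) = - (ci * ci) * ((z - w) / 2) by ring.
  by rewrite mulii; field.
have E2 : w = (z + w) / 2 - ci * ((z - w) / 2 * - ci).
  have -> : ci * ((z - w) / 2 * - ci) = - (ci * ci) * ((z - w) / 2) by ring.
  by rewrite mulii; field.
rewrite E1 [X in T _ X]E2; apply: step2.
- by rewrite cmodM n2; have := cmodD z w; lra.
- by rewrite !cmodM n2 cmodN cmod_i mulr1; have := cmodB z w; lra.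
Qed.

End Polarization.

(** * Logarithmic derivatives and normalized kernels *)

Section LogarithmicDerivative.
Context {R : realType}.
Implicit Types (f g l : R[i] -> R[i]) (z : R[i]) (r : R).

(** f' = l f. The lower bound on f makes the class stable under inverses. *)
Definition is_logderiv r f l := exists2 f', qdiff r f f' &
  (exists2 c : R, 0 < c & forall z, cmod z < r -> c <= cmod (f z)) /\
  (forall z, cmod z < r -> f' z = l z * f z).

Lemma is_logderiv_neq0 r f l z : is_logderiv r f l -> cmod z < r -> f z != 0.
Proof. by move=> [f' _ [[c c0 h] _]] /h; rewrite -cmod_gt0; exact: lt_le_trans. Qed.

Lemma is_logderiv_ext r f l g k : is_logderiv r f l -> (forall z, cmod z < r -> g z = f z) ->
  (forall z, cmod z < r -> k z = l z) -> is_logderiv r g k.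
Proof.
move=> [f' hf [[c c0 hc] hl]] gf kl; exists f'; first exact: qdiff_ext gf _ hf.
split; first by exists c => // z zr; rewrite gf// hc.
by move=> z zr; rewrite gf// kl// hl.
Qed.

Lemma is_logderiv_le r r' f l : r' <= r -> is_logderiv r f l -> is_logderiv r' f l.
Proof.
move=> rr [f' hf [[c c0 hc] hl]]; exists f'; first exact: qdiff_le rr hf.
split; first by exists c => // z zr; apply: hc; exact: lt_le_trans rr.
by move=> z zr; apply: hl; exact: lt_le_trans rr.
Qed.

Lemma is_logderiv_cst r (a : R[i]) : a != 0 -> is_logderiv r (fun=> a) (fun=> 0).
Proof.
move=> a0; exists (fun=> 0); first exact: qdiff_cst.
by split; [exists (cmod a); rewrite ?cmod_gt0|move=> z _; rewrite mul0r].
Qed.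

Lemma is_logderiv_mul r f l g k : 0 < r -> is_logderiv r f l -> is_logderiv r g k ->
  is_logderiv r (fun z => f z * g z) (fun z => l z + k z).
Proof.
move=> r0 [f' hf [[c c0 hc] hl]] [g' hg [[d d0 hd] hk]].
exists (fun z => f' z * g z + f z * g' z); first exact: qdiffM.
split; last by move=> z zr; rewrite hl// hk//; ring.
exists (c * d); first exact: mulr_gt0.
by move=> z zr; rewrite cmodM ler_pM ?(ltW c0) ?(ltW d0) ?hc ?hd.
Qed.

Lemma is_logderiv_inv r f l : 0 < r -> is_logderiv r f l -> is_logderiv r (fun z => (f z)^-1) (fun z => - l z).
Proof.
move=> r0 /[dup] hLD [f' hf [[c c0 hc] hl]].
exists (fun z => - f' z / f z ^+ 2); first exact: qdiffV hc hf.
have [C C0 hC] := hf.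
split; last by move=> z zr; rewrite hl//; field; exact: is_logderiv_neq0 hLD zr.
exists (C + 1)^-1; first by rewrite invr_gt0; lra.
move=> z zr; have [h _ _] := hC z z zr zr.
have fz : 0 < cmod (f z) by apply: lt_le_trans c0 (hc z zr).
have C1 : 0 < C + 1 by lra.
by rewrite cmodV lef_pV2 ?posrE//; lra.
Qed.

Lemma is_logderiv_exp r f l n : 0 < r -> is_logderiv r f l ->
  is_logderiv r (fun z => f z ^+ n) (fun z => n%:R * l z).
Proof.
move=> r0 h; elim: n => [|n IHn].
  by apply: is_logderiv_ext (is_logderiv_cst r (oner_neq0 _)) _ _ => z _; rewrite ?mul0r.
apply: is_logderiv_ext (is_logderiv_mul r0 h IHn) _ _ => z _; first by rewrite exprS.
by rewrite -[in LHS]natr1; ring.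
Qed.

Lemma is_logderiv_const r f l z : is_logderiv r f l -> (forall z, cmod z < r -> l z = 0) ->
  cmod z < r -> f z = f 0.
Proof.
move=> [f' hf [_ hl]] l0; apply: (qdiff_const hf) => w wr.
by rewrite hl// l0// mul0r.
Qed.

End LogarithmicDerivative.

Section PolarizedKernel.
Context {R : realType}.
Implicit Types (X Y H P : R[i] -> nat -> R[i]) (z w x : R[i]) (r : R).

(** The polarization of <X, Y>, holomorphic in both variables. *)
Definition pkernel X Y z w : R[i] := bilin (X z) (star Y w).

Lemma pkernel_bar X Y z w : pkernel X Y z w^bar = bilin (X z) (conj_seq (Y w)).
Proof. by rewrite /pkernel /star cJK. Qed.

Lemma pkernel_hol r r0 X X' Y Y' a b a' b' : 0 < r0 -> l2diff r X X' -> l2diff r Y Y' ->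
  (forall x, cmod x < r0 -> cmod (a * x + b) < r) ->
  (forall x, cmod x < r0 -> cmod (a' * x + b') < r) ->
  hol r0 (fun x => pkernel X Y (a * x + b) (a' * x + b')).
Proof.
move=> r00 hX hY ab ab'; eexists.
exact: (qdiff_bilin r00 (l2diff_affine ab hX) (l2diff_affine ab' (l2diff_star hY))).
Qed.

Lemma l2diff_l2 r X X' z : l2diff r X X' -> cmod z < r -> exists a, l2 (X z) a.
Proof. by move=> [C _ h] zr; exists C; have [] := h z z zr zr. Qed.

Lemma l2diff_cst r (x : nat -> R[i]) a : l2 x a -> l2diff r (fun=> x) (fun=> 0).
Proof.
move=> xa; have a0 := l2_ge0 xa; exists a => // z w _ _; split=> //.
- exact: l2_0.
- rewrite subrr scaler0 subr0; apply: l2_0.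
  by rewrite mulr_ge0 ?exprn_ge0 ?cmod_ge0.
Qed.

Lemma pkernel_dz r X X' Y Y' w : 0 < r -> l2diff r X X' -> l2diff r Y Y' -> cmod w < r ->
  qdiff r (fun z => pkernel X Y z w) (fun z => pkernel X' Y z w).
Proof.
move=> r0 hX hY wr; have wr' : cmod w^bar < r by rewrite cmodJ.
have [a ha] := l2diff_l2 hY wr'.
apply: qdiff_ext (qdiff_bilin r0 hX (l2diff_cst r (l2_conj_seq ha))) => // z zr.
have [b hb] := l2diff_l2 hX zr.
rewrite /pkernel (_ : bilin (X z) 0 = 0) ?addr0//.
by rewrite -(scale0r (conj_seq (Y w^bar))) (bilinZr _ hb (l2_conj_seq ha)) mul0r.
Qed.

Lemma pkernel_dw r X X' Y Y' z : 0 < r -> l2diff r X X' -> l2diff r Y Y' -> cmod z < r ->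
  qdiff r (fun w => pkernel X Y z w) (fun w => pkernel X Y' z w).
Proof.
move=> r0 hX hY zr; have [a ha] := l2diff_l2 hX zr.
apply: qdiff_ext (qdiff_bilin r0 (l2diff_cst r ha) (l2diff_star hY)) => // w wr.
have [b hb] := l2diff_l2 (l2diff_star hY) wr.
rewrite /pkernel (_ : bilin 0 _ = 0) ?add0r//.
by rewrite -(scale0r (X z)) (bilinZl _ ha hb) mul0r.
Qed.

(** A curve in l2 with its first two derivatives, in homogeneous coordinates
    one of which is normalized to 1. *)
Definition curve r H H1 H2 := [/\ l2diff r H H1, l2diff r H1 H2 &
  exists k, forall z, cmod z < r -> H z k = 1].

(** The Fubini-Study metric pulls back to beta times lam, the conformal factor
    of a metric on the disc. *)
Definition pulls_back (lam : R[i] -> R) (beta : R) r H H1 := forall z, cmod z < r ->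
  sqnorm (H1 z) * sqnorm (H z) - cmod (bilin (H1 z) (conj_seq (H z))) ^+ 2 = beta * lam z * sqnorm (H z) ^+ 2.

Lemma curve_le r r' H H1 H2 : r' <= r -> curve r H H1 H2 -> curve r' H H1 H2.
Proof.
move=> rr [h1 h2 [k hk]]; split; [exact: l2diff_le h1|exact: l2diff_le h2|].
by exists k => z zr; apply: hk; exact: lt_le_trans rr.
Qed.

(** The metric identity lives on the diagonal w = conj z, where the function lam,
    which is not holomorphic, appears as a common factor of all curves. *)
Lemma pulls_back_diag lam beta r H H1 H2 z : curve r H H1 H2 ->
  pulls_back lam beta r H H1 -> cmod z < r ->
  pkernel H1 H1 z z^bar * pkernel H H z z^bar - pkernel H1 H z z^bar * pkernel H H1 z z^bar =
  (beta * lam z)%:C * pkernel H H z z^bar ^+ 2.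
Proof.
move=> [hH hH1 _] fs zr; rewrite !pkernel_bar.
have [a ha] := l2diff_l2 hH zr; have [b hb] := l2diff_l2 hH1 zr.
have -> : bilin (H z) (conj_seq (H1 z)) = (bilin (H1 z) (conj_seq (H z)))^bar.
  by rewrite -(bilin_conj hb (l2_conj_seq ha)) conj_seqK bilinC.
rewrite mulcJ (bilin_sqnorm ha) (bilin_sqnorm hb) -!rmorphM -rmorphB -rmorphXn -rmorphM.
by congr (_%:C); exact: fs.
Qed.

(** Eliminating lam between the metric identities of the two curves leaves an
    identity between holomorphic functions of (z, w) on the diagonal, which
    polarizes. *)
Lemma pulls_back_polar lam beta r H H1 H2 P P1 P2 : 0 < r ->
  curve r H H1 H2 -> curve r P P1 P2 ->
  pulls_back lam beta r H H1 -> pulls_back lam 1 r P P1 ->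
  forall z w, cmod z < r / 16 -> cmod w < r / 16 ->
  (pkernel H1 H1 z w * pkernel H H z w - pkernel H1 H z w * pkernel H H1 z w) * pkernel P P z w ^+ 2 =
  beta%:C * (pkernel P1 P1 z w * pkernel P P z w - pkernel P1 P z w * pkernel P P1 z w) * pkernel H H z w ^+ 2.
Proof.
move=> r0 cH cP fH fP z w zr wr; have [hH hH1 _] := cH; have [hP hP1 _] := cP.
apply/eqP; rewrite -subr_eq0; apply/eqP.
pose T z w := (pkernel H1 H1 z w * pkernel H H z w - pkernel H1 H z w * pkernel H H1 z w) * pkernel P P z w ^+ 2 -
  beta%:C * (pkernel P1 P1 z w * pkernel P P z w - pkernel P1 P z w * pkernel P P1 z w) * pkernel H H z w ^+ 2.
apply: (@polarize R T r) => // [a b a' b' ab ab'|x xr].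
  have r2 : 0 < r / 2 by lra.
  have P_ X X' Y Y' hX hY := @pkernel_hol r _ X X' Y Y' a b a' b' r2 hX hY ab ab'.
  have hHH := P_ _ _ _ _ hH hH; have hPP := P_ _ _ _ _ hP hP.
  have h11 := P_ _ _ _ _ hH1 hH1; have p11 := P_ _ _ _ _ hP1 hP1.
  have h10 := P_ _ _ _ _ hH1 hH; have p10 := P_ _ _ _ _ hP1 hP.
  have h01 := P_ _ _ _ _ hH hH1; have p01 := P_ _ _ _ _ hP hP1.
  apply: (holB r2).
    by apply: (holM r2); [apply: (holB r2); exact: (holM r2)|exact: (holM r2)].
  apply: (holM r2); last exact: (holM r2).
  by apply: (holM r2); [exact: hol_cst|apply: (holB r2); exact: (holM r2)].
rewrite /T (pulls_back_diag cH fH xr) (pulls_back_diag cP fP xr).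
by rewrite mul1r rmorphM; ring.
Qed.

(** The normalized coordinate gives K(0, 0) >= 1, and K is continuous. *)
Lemma pkernel_lb r H H1 H2 : 0 < r -> curve r H H1 H2 -> exists s, [/\ 0 < s, s <= r &
  forall z w, cmod z < s -> cmod w < s -> 2^-1 <= cmod (pkernel H H z w)].
Proof.
move=> r0 [[C C0 hH] _ [k hk]].
pose L := C * (1 + 2 * r); have L0 : 0 <= L by rewrite mulr_ge0//; lra.
have LC : 0 <= L * C by rewrite mulr_ge0.
pose s := Num.min r (4 * (L * C + 1))^-1.
have s0 : 0 < s by rewrite lt_min r0 invr_gt0; lra.
have sr : s <= r by rewrite ge_min lexx.
have sLC : s * (L * C) <= 1 / 4.
  have h : s <= (4 * (L * C + 1))^-1 by rewrite ge_min lexx orbT.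
  have : s * (4 * (L * C + 1)) <= 1 by rewrite -ler_pdivlMr ?div1r//; lra.
  lra.
exists s; split=> // z w zs ws.
have zr : cmod z < r by lra. have wr : cmod w^bar < r by rewrite cmodJ; lra.
have o0 : cmod (0 : R[i]) < r by rewrite cmod0.
have [hz _ _] := hH z z zr zr; have [hw _ _] := hH _ _ wr wr; have [h0 _ _] := hH 0 0 o0 o0.
have dz := l2diff_by_lip hH o0 zr; have dw := l2_conj_seq (l2diff_by_lip hH o0 wr).
rewrite !subr0 -/L in dz dw; rewrite cmodJ in dw.
have E : pkernel H H z w = bilin (H 0) (conj_seq (H 0)) + (bilin (H z - H 0) (star H w) + bilin (H 0) (conj_seq (H w^bar - H 0))).
  rewrite conj_seqD conj_seqN (bilinBl hz h0 (l2_conj_seq hw)) (bilinBr h0 (l2_conj_seq hw) (l2_conj_seq h0)) /pkernel /star.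
  by ring.
have b1 := bilin_le dz (l2_conj_seq hw); have b2 := bilin_le h0 dw.
have N : 1 <= cmod (bilin (H 0) (conj_seq (H 0))).
  rewrite (bilin_sqnorm h0) cmod_real ger0_norm ?(sqnorm_ge0 h0)//.
  apply: le_trans (psum_le_sqnorm k.+1 h0); rewrite big_ord_recr /= hk// cmod1 expr1n lerDr.
  by apply: sumr_ge0 => i _; rewrite exprn_ge0 ?cmod_ge0.
have A : cmod (bilin (H z - H 0) (star H w)) <= 1 / 4.
  rewrite (le_trans b1)//; have : cmod z * (L * C) <= s * (L * C) by rewrite ler_wpM2r// ltW.
  by move: sLC; lra.
have B : cmod (bilin (H 0) (conj_seq (H w^bar - H 0))) <= 1 / 4.
  rewrite (le_trans b2)//; have : cmod w * (L * C) <= s * (L * C) by rewrite ler_wpM2r// ltW.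
  by move: sLC; lra.
move: E A B N; set u := bilin (H 0) (conj_seq (H 0)).
set x := bilin (H z - H 0) _; set y := bilin (H 0) (conj_seq (_ - _)) => E A B N.
have := cmodB (u + (x + y)) (x + y); rewrite addrK -E; have := cmodD x y; lra.
Qed.

(** The logarithmic derivative in z of the kernel normalized to be 1 on the
    axes (Calabi's diastasis in Bochner's gauge). *)
Definition bochner_logder H H1 z w := pkernel H1 H z w / pkernel H H z w - pkernel H1 H z 0 / pkernel H H z 0.

(** The w-derivative is the mixed second derivative of log K, that is, the
    polarized metric. *)
Lemma pkernel_quot_dw r s H H1 H2 z : 0 < s -> s <= r -> curve r H H1 H2 ->
  (forall z w, cmod z < s -> cmod w < s -> 2^-1 <= cmod (pkernel H H z w)) -> cmod z < s ->
  qdiff s (fun w => pkernel H1 H z w / pkernel H H z w)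
    (fun w => (pkernel H1 H1 z w * pkernel H H z w - pkernel H1 H z w * pkernel H H1 z w) / pkernel H H z w ^+ 2).
Proof.
move=> s0 sr /(curve_le sr)[hH hH1 _] lb zs.
have h1 := pkernel_dw s0 hH1 hH zs; have h2 := pkernel_dw s0 hH hH zs.
apply: qdiff_ext (qdiffM s0 h1 (qdiffV s0 (_ : 0 < 2^-1) (fun w => lb z w zs) h2)) => // w ws.
by field; rewrite -cmod_gt0; apply: lt_le_trans (lb z w zs ws).
Qed.

(** Both sides vanish at w = 0 and have the same w-derivative, by the polarized
    metric identity. *)
Lemma bochner_logder_eq lam beta r s H H1 H2 P P1 P2 z w : 0 < s -> s <= r / 16 ->
  curve r H H1 H2 -> curve r P P1 P2 ->
  pulls_back lam beta r H H1 -> pulls_back lam 1 r P P1 ->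
  (forall z w, cmod z < s -> cmod w < s -> 2^-1 <= cmod (pkernel H H z w)) ->
  (forall z w, cmod z < s -> cmod w < s -> 2^-1 <= cmod (pkernel P P z w)) ->
  cmod z < s -> cmod w < s -> bochner_logder H H1 z w = beta%:C * bochner_logder P P1 z w.
Proof.
move=> s0 sr cH cP fH fP lH lP zs ws.
have r0 : 0 < r by lra. have sr' : s <= r by lra.
have h := qdiffB s0 (pkernel_quot_dw s0 sr' cH lH zs)
  (qdiffM s0 (qdiff_cst s beta%:C) (pkernel_quot_dw s0 sr' cP lP zs)).
have := qdiff_const h _ ws => /= /(_ _) E.
suff /E : forall w, cmod w < s -> (pkernel H1 H1 z w * pkernel H H z w - pkernel H1 H z w * pkernel H H1 z w) / pkernel H H z w ^+ 2 -
   (0 * (pkernel P1 P z w / pkernel P P z w) + beta%:C *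
   ((pkernel P1 P1 z w * pkernel P P z w - pkernel P1 P z w * pkernel P P1 z w) / pkernel P P z w ^+ 2)) = 0.
  have key (a b c d : R[i]) : a - b = c - d -> a - c = b - d.
    by move=> e; have -> : a = c - d + b by [rewrite -e subrK]; ring.
  by rewrite /bochner_logder mulrBr; exact: key.
move=> u us.
have Hn : pkernel H H z u != 0 by rewrite -cmod_gt0; apply: lt_le_trans (lH z u zs us).
have Pn : pkernel P P z u != 0 by rewrite -cmod_gt0; apply: lt_le_trans (lP z u zs us).
have := pulls_back_polar r0 cH cP fH fP (_ : cmod z < r / 16) (_ : cmod u < r / 16).
move=> /(_ ltac:(lra) ltac:(lra)) F.
rewrite mul0r add0r; apply/eqP; rewrite subr_eq0 mulrA eqr_div ?expf_neq0//.
by rewrite F.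
Qed.

(** The kernel of h is 1 on the axes, and its logarithmic derivative in the
    first variable is beta times e; this determines it from beta and e. *)
Definition normalized_kernel (e : R[i] -> R[i] -> R[i]) (beta : R) r (h : R[i] -> nat -> R[i]) :=
  [/\ 0 < r, forall z, cmod z < r -> exists a, l2 (h z) a,
      forall z, cmod z < r -> bilin (h z) (conj_seq (h 0)) = 1 &
      forall w, cmod w < r -> is_logderiv r (fun z => bilin (h z) (conj_seq (h w))) (fun z => beta%:C * e z w)].

(** With K the kernel of H, rescale H(z) by K(0, 0)^(1/2) / K(z, 0): in
    K(z, w) K(0, 0) / (K(z, 0) K(0, w)) the factor that depends on z changes the
    logarithmic derivative of K into [bochner_logder]. *)
Lemma normalized_kernel_of_curve lam beta r H H1 H2 P P1 P2 : 0 < r ->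
  curve r H H1 H2 -> curve r P P1 P2 ->
  pulls_back lam beta r H H1 -> pulls_back lam 1 r P P1 ->
  exists s (a : R[i] -> R[i]), normalized_kernel (fun z w => bochner_logder P P1 z w^bar) beta s (fun z => a z *: H z).
Proof.
move=> r0 cH cP fH fP.
have [s1 [s10 s1r lH]] := pkernel_lb r0 cH; have [s2 [s20 s2r lP]] := pkernel_lb r0 cP.
pose s := Num.min (Num.min s1 s2) (r / 16).
have s0 : 0 < s by rewrite !lt_min s10 s20; lra.
have ss1 : s <= s1 by rewrite !ge_min lexx.
have ss2 : s <= s2 by rewrite !ge_min lexx !orbT.
have sr : s <= r / 16 by rewrite ge_min lexx orbT.
have {}lH z w : cmod z < s -> cmod w < s -> 2^-1 <= cmod (pkernel H H z w).
  by move=> zs ws; apply: lH; lra.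
have {}lP z w : cmod z < s -> cmod w < s -> 2^-1 <= cmod (pkernel P P z w).
  by move=> zs ws; apply: lP; lra.
have eqe z w := @bochner_logder_eq lam beta r s H H1 H2 P P1 P2 z w s0 sr cH cP fH fP lH lP.
have srr : s <= r by lra.
have [hH hH1 _] := curve_le srr cH.
have o0 : cmod (0 : R[i]) < s by rewrite cmod0.
have Hn z w : cmod z < s -> cmod w < s -> pkernel H H z w != 0.
  by move=> zs ws; rewrite -cmod_gt0; apply: lt_le_trans (lH z w zs ws).
have bar0 : (0 : R[i])^bar = 0 by exact: conjc0.
have [b0 hb0] := l2diff_l2 hH o0.
have K00 : pkernel H H 0 0 = (sqnorm (H 0))%:C by rewrite -(bilin_sqnorm hb0) -pkernel_bar bar0.
have q0 : sqnorm (H 0) != 0.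
  by have := Hn 0 0 o0 o0; rewrite K00; apply: contraNneq => ->.
have q1 : 0 < sqnorm (H 0) by rewrite lt0r q0 (sqnorm_ge0 hb0).
pose k := (Num.sqrt (sqnorm (H 0)))%:C : R[i].
have kk : k * k = pkernel H H 0 0.
  by rewrite K00 -rmorphM -expr2 sqr_sqrtr// ltW.
have k0 : k != 0 by have := Hn 0 0 o0 o0; rewrite -kk; apply: contraNneq => ->; rewrite mul0r.
have kJ : k^bar = k by exact: conjc_real.
pose a z := k / pkernel H H z 0.
have sym z w : cmod z < s -> cmod w < s -> (pkernel H H z w^bar)^bar = pkernel H H w z^bar.
  move=> zs ws; have [c hc] := l2diff_l2 hH zs; have [d hd] := l2diff_l2 hH ws.
  by rewrite !pkernel_bar -(bilin_conj hc (l2_conj_seq hd)) conj_seqK bilinC.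
have bilinE z w : cmod z < s -> cmod w < s ->
    bilin (a z *: H z) (conj_seq (a w *: H w)) = a z * (a w)^bar * pkernel H H z w^bar.
  move=> zs ws; have [c hc] := l2diff_l2 hH zs; have [d hd] := l2diff_l2 hH ws.
  rewrite conj_seqZ (bilinZl _ hc (l2Z _ (l2_conj_seq hd))) (bilinZr _ hc (l2_conj_seq hd)) pkernel_bar.
  by rewrite mulrA.
exists s, a; split=> // [z zs|z zs|w ws].
- by have [c hc] := l2diff_l2 hH zs; eexists; exact: l2Z hc.
- rewrite bilinE// bar0.
  have -> : (a 0)^bar = a 0.
    by have S := sym 0 0 o0 o0; rewrite !bar0 in S; rewrite /a cJM cJV S kJ.
  rewrite /a -kk; have := Hn z 0 zs o0; move=> h; field.
  by rewrite h k0.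
have wbs : cmod w^bar < s by rewrite cmodJ.
have dLD u : cmod u < s -> is_logderiv s (fun z => pkernel H H z u) (fun z => pkernel H1 H z u / pkernel H H z u).
  move=> us; exists (fun z => pkernel H1 H z u); first exact: (pkernel_dz s0 hH hH us).
  split; first by exists 2^-1; [rewrite invr_gt0|move=> z zs; exact: lH].
  by move=> z zs; rewrite divfK// Hn.
have aw : (a w)^bar != 0.
  by rewrite conjc_eq0 /a mulf_neq0// invr_neq0// Hn.
have := is_logderiv_mul s0 (is_logderiv_mul s0 (is_logderiv_cst s (mulf_neq0 k0 aw)) (is_logderiv_inv s0 (dLD 0 o0))) (dLD _ wbs).
move=> /is_logderiv_ext; apply=> z zs.
  by rewrite bilinE// /a; ring.
by rewrite -eqe// /bochner_logder; ring.
Qed.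

(** If it vanished near 0, so would the metric at 0, its w-derivative there. *)
Lemma bochner_logder_neq0 lam r P P1 P2 : 0 < r -> curve r P P1 P2 ->
  pulls_back lam 1 r P P1 -> lam 0 != 0 ->
  forall s, 0 < s -> exists z w, [/\ cmod z < s, cmod w < s & bochner_logder P P1 z w != 0].
Proof.
move=> r0 cP fP lam0 s s0; apply: contrapT => no.
have [s1 [s10 s1r lP]] := pkernel_lb r0 cP.
pose t := Num.min s s1; have t0 : 0 < t by rewrite lt_min s0.
have ts : t <= s by rewrite ge_min lexx.
have ts1 : t <= s1 by rewrite ge_min lexx orbT.
have o0 : cmod (0 : R[i]) < t by rewrite cmod0.
have {}lP z w : cmod z < t -> cmod w < t -> 2^-1 <= cmod (pkernel P P z w).
  by move=> zs ws; apply: lP; lra.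
have tr : t <= r by lra.
have [C C0 hC] := pkernel_quot_dw t0 tr cP lP o0.
have bar0 : (0 : R[i])^bar = 0 by exact: conjc0.
have or0 : cmod (0 : R[i]) < r by rewrite cmod0.
have D := pulls_back_diag cP fP or0; rewrite mul1r bar0 in D.
have Pn : pkernel P P 0 0 != 0 by rewrite -cmod_gt0; apply: lt_le_trans (lP 0 0 o0 o0).
have lamE : (lam 0)%:C = 0 :> R[i].
  apply: (@cmod_eq0_quad R _ C t) => // x x0 xt.
  have nx : cmod (x%:C : R[i]) = x by rewrite cmod_real gtr0_norm.
  have xt' : cmod (x%:C : R[i]) < t by rewrite nx.
  have [_ _] := hC 0 x%:C o0 xt'.
  rewrite D mulfK ?expf_neq0// subr0 nx.
  have -> : pkernel P1 P 0 x%:C / pkernel P P 0 x%:C - pkernel P1 P 0 0 / pkernel P P 0 0 = 0.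
    apply: contrapT => /eqP ne; apply: no; exists 0, x%:C.
    by rewrite nx cmod0; split=> //; lra.
  by rewrite sub0r cmodN cmodM nx.
by move/eqP: lam0; apply; exact: (congr1 (@Rec R) lamE).
Qed.

End PolarizedKernel.

(** * Positivity of products of kernels *)

Section FiniteCombinations.
Context {R : realType}.
Implicit Types (x y w : nat -> R[i]).

Definition isl2 x := exists a : R, l2 x a.

Lemma isl2_conj_seq x : isl2 x -> isl2 (conj_seq x).
Proof. by move=> [a h]; exists a; exact: l2_conj_seq. Qed.

Lemma isl2_sub x y : isl2 x -> isl2 y -> isl2 (x - y).
Proof. by move=> [a h] [b k]; exists (a + b); exact: l2B. Qed.

Variables (n : nat).
Implicit Types (v u : 'I_n -> R[i]) (X Y : 'I_n -> nat -> R[i]).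

Lemma bilin_lincomb v X : (forall l, isl2 (X l)) -> isl2 (\sum_l v l *: X l) /\
  forall w, isl2 w -> bilin (\sum_l v l *: X l) w = \sum_l v l * bilin (X l) w.
Proof.
move=> hX; have H (s : seq 'I_n) : isl2 (\sum_(l <- s) v l *: X l) /\
    forall w, isl2 w -> bilin (\sum_(l <- s) v l *: X l) w = \sum_(l <- s) v l * bilin (X l) w.
  elim: s => [|l s [[a ha] IHs]].
    rewrite big_nil; split; first by exists 0; exact: l2_0.
    move=> w [b hb]; rewrite big_nil -(scale0r w) (bilinZl _ hb hb).
    by rewrite mul0r.
  have [c hc] := hX l; have hl := l2Z (v l) hc.
  rewrite big_cons; split; first by eexists; exact: l2D hl ha.
  move=> w /[dup] hw [b hb]; rewrite big_cons (bilinDl hl ha hb) (bilinZl _ hc hb).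
  by rewrite IHs.
exact: H.
Qed.

Lemma bilin_gram v X : (forall l, isl2 (X l)) ->
  bilin (\sum_l v l *: X l) (conj_seq (\sum_l v l *: X l)) =
  \sum_l \sum_k v l * (v k)^bar * bilin (X l) (conj_seq (X k)).
Proof.
move=> hX; have [h1 h2] := bilin_lincomb v hX; rewrite h2; last exact: isl2_conj_seq.
apply: eq_bigr => l _.
have -> : conj_seq (\sum_l v l *: X l) = \sum_l (v l)^bar *: conj_seq (X l).
  rewrite (big_morph conj_seq conj_seqD (_ : conj_seq 0 = 0)); last first.
    by apply/funext => i; rewrite /conj_seq conjc0.
  by apply: eq_bigr => k _; rewrite conj_seqZ.
have [_ h3] := bilin_lincomb (fun k => (v k)^bar) (fun k => isl2_conj_seq (hX k)).
rewrite bilinC h3 ?mulr_sumr; last exact: hX.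
by apply: eq_bigr => k _; rewrite [bilin _ (X l)]bilinC; ring.
Qed.

(** Schur's product theorem: expanding the pairings of the X l in coordinates
    exhibits the sum as a limit of sums of squared norms. *)
Lemma schur_ge0 v X Y : (forall l, isl2 (X l)) -> (forall l, isl2 (Y l)) ->
  0 <= Rec (\sum_l \sum_k v l * (v k)^bar * (bilin (X l) (conj_seq (X k)) * bilin (Y l) (conj_seq (Y k)))).
Proof.
move=> hX hY.
pose S N := \sum_l \sum_k v l * (v k)^bar * (psum (X l) (conj_seq (X k)) N * bilin (Y l) (conj_seq (Y k))).
have SE N : S N = \sum_(i < N) (sqnorm (\sum_l (v l * X l i) *: Y l))%:C.
  transitivity (\sum_(i < N) \sum_l \sum_k (v l * X l i) * (v k * X k i)^bar * bilin (Y l) (conj_seq (Y k))).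
    rewrite /S exchange_big /=; under [RHS]eq_bigr do rewrite exchange_big /=.
    rewrite [RHS]exchange_big /=; apply: eq_bigr => k _.
    rewrite [RHS]exchange_big /=; apply: eq_bigr => l _.
    rewrite /psum mulr_suml mulr_sumr; apply: eq_bigr => i _.
    by rewrite cJM /conj_seq; ring.
  apply: eq_bigr => i _; have [[a ha] _] := bilin_lincomb (fun l => v l * X l i) hY.
  by rewrite -(bilin_sqnorm ha) bilin_gram.
have S0 N : 0 <= Rec (S N).
  rewrite SE cRe_sum sumr_ge0// => i _; rewrite cRe_real.
  by have [[a ha] _] := bilin_lincomb (fun l => v l * X l i) hY; exact: sqnorm_ge0 ha.
have cS : ccvg S (\sum_l \sum_k v l * (v k)^bar * (bilin (X l) (conj_seq (X k)) * bilin (Y l) (conj_seq (Y k)))).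
  apply: ccvg_sum => l; apply: ccvg_sum => k; apply: ccvgZ.
  have [a ha] := hX l; have [b hb] := hX k.
  exact: ccvgM (bilin_cvg ha (l2_conj_seq hb)) (ccvg_cst _).
apply/ler_addgt0Pr => e /cS[N /(_ N (leqnn N)) h].
have := le_trans (Re_le_cmod _) h; rewrite cReB ler_norml => /andP[_].
by have := S0 N; lra.
Qed.

(** If the second kernel is normalized along y0, then B - 1 is again a Gram
    matrix; so a vector isotropic for the product AB is isotropic for A. *)
Lemma isotropic_factor v X Y y0 : (forall l, isl2 (X l)) -> (forall l, isl2 (Y l)) ->
  isl2 y0 -> bilin y0 (conj_seq y0) = 1 -> (forall l, bilin (Y l) (conj_seq y0) = 1) ->
  \sum_l \sum_k v l * (v k)^bar * (bilin (X l) (conj_seq (X k)) * bilin (Y l) (conj_seq (Y k))) = 0 ->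
  forall w, isl2 w -> \sum_l v l * bilin (X l) w = 0.
Proof.
move=> hX hY hy0 y01 Y1 AB0 w hw.
have [[a ha] h] := bilin_lincomb v hX; rewrite -h//.
suff -> : \sum_l v l *: X l = 0.
  by have [b hb] := hw; rewrite -(scale0r w) (bilinZl _ hb hb) mul0r.
apply: (sqnorm_eq0 ha); rewrite /sqnorm bilin_gram//.
have hZ l : isl2 (Y l - y0) by exact: isl2_sub.
have := schur_ge0 v hX hZ.
have E l k : bilin (Y l - y0) (conj_seq (Y k - y0)) = bilin (Y l) (conj_seq (Y k)) - 1.
  have [c hc] := hY l; have [d hd] := hY k; have [b hb] := hy0.
  rewrite conj_seqD conj_seqN (bilinBl hc hb (l2B (l2_conj_seq hd) (l2_conj_seq hb))).
  rewrite (bilinBr hc (l2_conj_seq hd) (l2_conj_seq hb)) (bilinBr hb (l2_conj_seq hd) (l2_conj_seq hb)) Y1 y01.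
  have -> : bilin y0 (conj_seq (Y k)) = 1.
    by rewrite -[LHS]cJK -(bilin_conj hb (l2_conj_seq hd)) conj_seqK bilinC Y1 conjc1.
  by ring.
rewrite (_ : \sum_l \sum_k _ = - \sum_l \sum_k v l * (v k)^bar * bilin (X l) (conj_seq (X k))).
  by rewrite cReN; lra.
apply/eqP; rewrite -addr_eq0; apply/eqP; rewrite -[RHS]AB0 -big_split /=.
apply: eq_bigr => l _; rewrite -big_split /=; apply: eq_bigr => k _.
by rewrite E; ring.
Qed.

End FiniteCombinations.

(** * Incompatibility of a continuum of exponents *)

Section LinearAlgebra.
Context {R : realType}.

Lemma vandermonde_ker n (c q : 'I_n -> R[i]) : injective q ->
  (forall k : 'I_n, \sum_l c l * q l ^+ k = 0) -> forall l, c l = 0.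
Proof.
move=> qI h l; pose a := \row_l q l; pose V := Vandermonde n a.
have Vu : V \in unitmx.
  rewrite unitmxE unitfE det_Vandermonde; apply/prodf_neq0 => i _.
  apply/prodf_neq0 => j ij; rewrite !mxE subr_eq0; apply: contraTneq ij => /qI->.
  by rewrite ltnn.
have : V *m (\col_l c l) = 0.
  apply/colP => k; rewrite !mxE -[RHS](h k); apply: eq_bigr => j _.
  by rewrite !mxE mulrC.
move=> /(congr1 (mulmx (invmx V))); rewrite mulKmx// mulmx0 => /colP/(_ l).
by rewrite !mxE.
Qed.

Lemma exists_ker (T : finType) n (F : 'I_n -> T -> R[i]) : (#|T| < n)%N ->
  exists2 v : 'I_n -> R[i], (exists l, v l != 0) & forall t, \sum_l v l * F l t = 0.
Proof.
move=> Tn; pose A := \matrix_(l < n, t < #|T|) F l (enum_val t).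
have : kermx A != 0.
  rewrite -mxrank_eq0 mxrank_ker -lt0n subn_gt0.
  exact: leq_ltn_trans (rank_leq_col A) Tn.
case/rowV0Pn => v /sub_kermxP vA v0; exists (fun l => v 0 l).
  by apply: contrapT => /forallNP no; move/rV0Pn: v0 => [l]; move: (no l).
move=> t; have := congr1 (fun B : 'rV_(#|T|) => B 0 (enum_rank t)) vA.
rewrite !mxE => {2}<-; apply: eq_bigr => l _.
by rewrite !mxE enum_rankK.
Qed.

(** Near a point where the derivative does not vanish, the distances
    |f (z1 + t) - f z1| for t = tau, tau / 2, tau / 4, ... are distinct. *)
Lemma is_logderiv_many_values r (f l : R[i] -> R[i]) z1 n : is_logderiv r f l -> cmod z1 < r -> l z1 != 0 ->
  exists pt : 'I_n -> R[i], (forall i, cmod (pt i) < r) /\ injective (fun i => f (pt i)).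
Proof.
move=> hLD z1r l0; have f0 := is_logderiv_neq0 hLD z1r; have [f' [C C0 h] [_ hl]] := hLD.
pose D := cmod (f' z1); have D0 : 0 < D by rewrite cmod_gt0 hl// mulf_neq0.
pose tau := Num.min ((r - cmod z1) / 2) (D / (8 * (C + 1))).
have tau0 : 0 < tau by rewrite lt_min !divr_gt0 ?subr_gt0//; lra.
have taur : tau < r - cmod z1.
  by rewrite gt_min; apply/orP; left; have : 0 < r - cmod z1 by [rewrite subr_gt0]; lra.
have tauC : C * tau <= D / 8.
  have : tau <= D / (8 * (C + 1)) by rewrite ge_min lexx orbT.
  rewrite ler_pdivlMr; last by lra.
  by lra.
pose t (i : nat) : R := tau / 2 ^+ i.
have t0 i : 0 < t i by rewrite divr_gt0// exprn_gt0.
have tle i : t i <= tau.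
  by rewrite ler_pdivrMr ?exprn_gt0// ler_peMr ?(ltW tau0)// exprn_ege1// ler1n.
have nt i : cmod ((t i)%:C : R[i]) = t i by rewrite cmod_real gtr0_norm.
pose pt (i : nat) := z1 + (t i)%:C.
have ptr i : cmod (pt i) < r.
  by rewrite (le_lt_trans (cmodD _ _))// nt; have := tle i; lra.
have est i : cmod (f (pt i) - f z1 - (t i)%:C * f' z1) <= t i * (D / 8).
  have [_ _] := h z1 (pt i) z1r (ptr i).
  rewrite /pt [X in X * f' z1](_ : _ = (t i)%:C); last by ring.
  rewrite [X in cmod X ^+ 2](_ : _ = (t i)%:C); last by ring.
  rewrite nt => /le_trans; apply.
  rewrite expr2 mulrA mulrC ler_wpM2l// ?(ltW (t0 i))//.
  by apply: le_trans tauC; rewrite ler_wpM2l.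
have nD i : cmod ((t i)%:C * f' z1) = t i * D by rewrite cmodM nt.
have ub i : cmod (f (pt i) - f z1) <= t i * (9 / 8 * D).
  rewrite -[X in cmod X](subrK ((t i)%:C * f' z1)) (le_trans (cmodD _ _))// nD.
  by have := est i; lra.
have lb i : t i * (7 / 8 * D) <= cmod (f (pt i) - f z1).
  have := cmodB (f (pt i) - f z1) (f (pt i) - f z1 - (t i)%:C * f' z1).
  rewrite opprB addrC subrK nD; have := est i; lra.
have dist i j : (i < j)%N -> f (pt i) != f (pt j).
  move=> ij; apply/eqP => E; have := ub j; have := lb i; rewrite E => h1 h2.
  have tij : t j <= t i / 2.
    rewrite /t -mulrA -invfM -exprSr ler_wpM2l ?(ltW tau0)//.
    by rewrite lef_pV2 ?posrE ?exprn_gt0// ler_eXn2l// ltr1n.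
  have : t j * (9 / 8 * D) <= t i / 2 * (9 / 8 * D) by rewrite ler_wpM2r//; lra.
  have := mulr_gt0 (t0 i) D0; lra.
exists (fun i => pt i); split=> // i j /eqP E; apply/val_inj => /=.
have [ij|ij|//] := ltngtP i j; first by rewrite (negbTE (dist _ _ ij)) in E.
by rewrite eq_sym (negbTE (dist _ _ ij)) in E.
Qed.

Lemma common_radius (r : nat -> R) n : (forall q, (q < n)%N -> 0 < r q) ->
  exists2 s, 0 < s & forall q, (q < n)%N -> s <= r q.
Proof.
elim: n => [|n IHn] h; first by exists 1.
have [s s0 hs] := IHn (fun q qn => h q (ltnW qn)).
exists (Num.min s (r n)); first by rewrite lt_min s0 h.
move=> q; rewrite ltnS leq_eqVlt => /orP[/eqP->|qn]; first by rewrite ge_min lexx orbT.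
by rewrite ge_min hs.
Qed.

End LinearAlgebra.

Section Core.
Context {R : realType}.
Implicit Types (z w : R[i]) (h p g : R[i] -> nat -> R[i]) (e : R[i] -> R[i] -> R[i]).

Lemma normalized_kernel_le e beta r s h : 0 < s -> s <= r -> normalized_kernel e beta r h -> normalized_kernel e beta s h.
Proof.
move=> s0 sr [r0 h1 h2 h3]; split=> // z zs; [apply: h1|apply: h2|].
- exact: lt_le_trans sr.
- exact: lt_le_trans sr.
- by apply: (is_logderiv_le sr); apply: h3; exact: lt_le_trans sr.
Qed.

Lemma normalized_kernel_0 e beta r h w : normalized_kernel e beta r h -> cmod w < r -> bilin (h 0) (conj_seq (h w)) = 1.
Proof.
move=> [r0 h1 h2 _] wr; have [a ha] := h1 w wr.
have o0 : cmod (0 : R[i]) < r by rewrite cmod0.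
have [c hc] := h1 0 o0.
by rewrite -[LHS]cJK -(bilin_conj hc (l2_conj_seq ha)) conj_seqK bilinC h2// conjc1.
Qed.

(** Both sides have the same logarithmic derivative in z and agree at z = 0. *)
Lemma normalized_kernel_mul e r (b1 b2 b3 : R) h1 h2 h3 m z w : 
  normalized_kernel e b1 r h1 -> normalized_kernel e b2 r h2 -> normalized_kernel e b3 r h3 -> b1 + b2 = m%:R * b3 ->
  cmod z < r -> cmod w < r ->
  bilin (h1 z) (conj_seq (h1 w)) * bilin (h2 z) (conj_seq (h2 w)) = bilin (h3 z) (conj_seq (h3 w)) ^+ m.
Proof.
move=> g1 g2 g3 bE zr wr; have [r0 _ _ L1] := g1; have [_ _ _ L2] := g2; have [_ _ _ L3] := g3.
have L := is_logderiv_mul r0 (is_logderiv_mul r0 (L1 w wr) (L2 w wr)) (is_logderiv_inv r0 (is_logderiv_exp m r0 (L3 w wr))).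
have n3 : bilin (h3 z) (conj_seq (h3 w)) ^+ m != 0 by rewrite expf_neq0// (is_logderiv_neq0 (L3 w wr) zr).
suff H : bilin (h1 z) (conj_seq (h1 w)) * bilin (h2 z) (conj_seq (h2 w)) / bilin (h3 z) (conj_seq (h3 w)) ^+ m = 1.
  by rewrite -[RHS]mul1r -H divfK.
rewrite (is_logderiv_const L _ zr) => [|u ur].
  by rewrite (normalized_kernel_0 g1 wr) (normalized_kernel_0 g2 wr) (normalized_kernel_0 g3 wr) expr1n invr1 !mulr1.
have -> : b1 = m%:R * b3 - b2 by rewrite -bE; ring.
by rewrite rmorphB rmorphM rmorph_nat; ring.
Qed.

(** Expand the m-th power of a sum of n0 terms. *)
Lemma finite_rank p n0 m z w : isl2 (p z) -> isl2 (p w) ->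
  (forall i, (n0 <= i)%N -> p z i = 0) ->
  bilin (p z) (conj_seq (p w)) ^+ m = \sum_(f : {ffun 'I_m -> 'I_n0})
    (\prod_i p z (f i)) * (\prod_i p w (f i))^bar.
Proof.
move=> [a ha] [b hb] p0.
have -> : bilin (p z) (conj_seq (p w)) = \sum_(i < n0) p z i * (p w i)^bar.
  apply: (bilin_eq ha (l2_conj_seq hb)) => eps eps0; exists n0 => N nN.
  rewrite (_ : psum _ _ N = \sum_(i < n0) p z i * (p w i)^bar) ?subrr ?cmod0 ?ltW//.
  rewrite /psum -!(big_mkord xpredT (fun i => p z i * (p w i)^bar)).
  rewrite (big_cat_nat (leq0n n0) nN)/= [X in _ + X]big1_seq ?addr0// => i.
  by rewrite mem_index_iota => /andP[_ /andP[/p0-> _]]; rewrite mul0r.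
rewrite -[m in LHS]card_ord -prodr_const bigA_distr_bigA /=.
apply: eq_bigr => f _; rewrite rmorph_prod -big_split; exact: eq_bigr.
Qed.

(** The kernels A_beta are closed under products, so for
    beta + gamma = m the product A_beta A_gamma = A_1 ^ m has finite rank D and
    A_beta lives on the same D-dimensional space, for a whole interval of
    exponents beta; but the powers of a nonconstant function to D + 1
    different exponents are linearly independent. *)
Lemma no_continuum_of_exponents e (b : R) n0 : 0 < b ->
  (forall beta, b <= beta -> exists r h, normalized_kernel e beta r h) ->
  (exists r p, normalized_kernel e 1 r p /\ forall z i, (n0 <= i)%N -> p z i = 0) ->
  (forall s : R, 0 < s -> exists z w, [/\ cmod z < s, cmod w < s & e z w != 0]) ->
  False.
Proof.
move=> b0 hgood [r1 [p [gp p0]]] e0.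
(* m leaves room for exponents beta in [b, b + 1] with m - beta >= b *)
pose m := (Num.truncn (2 * b + 1)).+1.
have mb : 2 * b + 1 < m%:R by exact: truncnS_gt.
pose D := #|{ffun 'I_m -> 'I_n0}|.
pose del : R := D.+1%:R^-1.
have D1 : 0 < D.+1%:R :> R by rewrite ltr0n.
have del0 : 0 < del by rewrite invr_gt0.
pose beta (q : nat) := b + q%:R * del.
have beta_ge q : b <= beta q by rewrite lerDl mulr_ge0// ltW.
have beta_le q : (q <= D.+1)%N -> beta q <= b + 1.
  by move=> qD; rewrite lerD2l ler_pdivrMr// mul1r ler_nat.
have /choice[rh hrh] q : exists rh : R * (R[i] -> nat -> R[i]), normalized_kernel e (beta q) rh.1 rh.2.
  by have [r [h g]] := hgood _ (beta_ge q); exists (r, h).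
have /choice[rg hrg] q : exists rg : R * (R[i] -> nat -> R[i]),
    (q <= D.+1)%N -> normalized_kernel e (m%:R - beta q) rg.1 rg.2.
  have [qD|_] := leqP q D.+1; last by exists (0, fun _ _ => 0).
  have h1 : b <= m%:R - beta q by have := beta_le q qD; lra.
  by have [r [h g]] := hgood _ h1; exists (r, h).
have [s1 s10 hs1] := @common_radius R (fun q => (rh q).1) D.+2 (fun q _ => let: And4 a _ _ _ := hrh q in a).
have [s2 s20 hs2] := @common_radius R (fun q => (rg q).1) D.+2 (fun q qD => let: And4 a _ _ _ := hrg q qD in a).
have r10 : 0 < r1 by case: gp.
pose s := Num.min (Num.min s1 s2) r1.
have s0 : 0 < s by rewrite !lt_min s10 s20.
have gA q : (q <= D.+1)%N -> normalized_kernel e (beta q) s (rh q).2.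
  by move=> qD; apply: (normalized_kernel_le s0 _ (hrh q)); apply: le_trans (hs1 q qD); rewrite !ge_min lexx.
have gB q : (q <= D.+1)%N -> normalized_kernel e (m%:R - beta q) s (rg q).2.
  by move=> qD; apply: (normalized_kernel_le s0 _ (hrg q qD)); apply: le_trans (hs2 q qD); rewrite !ge_min lexx orbT.
have gP : normalized_kernel e 1 s p by apply: (normalized_kernel_le s0 _ gp); rewrite ge_min lexx orbT.
pose A q z w := bilin ((rh q).2 z) (conj_seq ((rh q).2 w)).
have [z1 [w1 [z1s w1s ez]]] := e0 s s0.
pose Q z := A 1%N z w1 / A 0%N z w1.
have ldA q : (q <= D.+1)%N -> is_logderiv s (fun z => A q z w1) (fun z => (beta q)%:C * e z w1).
  by move=> /gA[_ _ _]; apply.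
have LQ := is_logderiv_mul s0 (ldA 1%N isT) (is_logderiv_inv s0 (ldA 0%N isT)).
have lQ z : (beta 1%N)%:C * e z w1 + - ((beta 0%N)%:C * e z w1) = del%:C * e z w1.
  by rewrite -mulrBl -rmorphB /beta; congr (_%:C * _); ring.
have AQ q z : (q <= D.+1)%N -> cmod z < s -> A q z w1 = A 0%N z w1 * Q z ^+ q.
  move=> qD zs.
  have L := is_logderiv_mul s0 (is_logderiv_mul s0 (ldA q qD) (is_logderiv_inv s0 (ldA 0%N isT))) (is_logderiv_inv s0 (is_logderiv_exp q s0 LQ)).
  have A0n := is_logderiv_neq0 (ldA 0%N isT) zs.
  have Qn : Q z ^+ q != 0 by rewrite expf_neq0// (is_logderiv_neq0 LQ zs).
  have A0_1 k : (k <= D.+1)%N -> A k 0 w1 = 1 by move=> kD; exact: normalized_kernel_0 (gA k kD) w1s.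
  have H : A q z w1 / A 0%N z w1 / Q z ^+ q = 1.
    rewrite (is_logderiv_const L _ zs) => [|u us].
      by rewrite /Q !A0_1// !(invr1, mulr1, expr1n).
    by rewrite lQ /beta rmorphD rmorphM rmorph_nat mul0r addr0; ring.
  by rewrite -[RHS]mul1r -H; field; rewrite A0n Qn.
have [pt [pts ptI]] : exists pt : 'I_D.+1 -> R[i], (forall i, cmod (pt i) < s) /\ injective (fun i => Q (pt i)).
  apply: (is_logderiv_many_values D.+1 LQ z1s); rewrite lQ mulf_neq0//.
  by rewrite -cmod_gt0 cmod_real normr_gt0 gt_eqF.
pose mono (f : {ffun 'I_m -> 'I_n0}) z := \prod_i p z (f i).
have [v [l vl] vE] := @exists_ker R _ D.+1 (fun l f => mono f (pt l)) (ltnSn _).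
have main q : (q <= D.+1)%N -> \sum_l v l * A q (pt l) w1 = 0.
  move=> qD; have [_ a1 a2 _] := gA q qD; have [_ b1 b2 _] := gB q qD; have [_ p1 _ _] := gP.
  have o0 : cmod (0 : R[i]) < s by rewrite cmod0.
  apply: (@isotropic_factor R _ v (fun l => (rh q).2 (pt l)) (fun l => (rg q).2 (pt l)) ((rg q).2 0)).
  - by move=> i; exact: a1.
  - by move=> i; exact: b1.
  - exact: b1.
  - exact: b2.
  - by move=> i; exact: b2.
  - transitivity (\sum_f (\sum_l v l * mono f (pt l)) * (\sum_l v l * mono f (pt l))^bar).
      transitivity (\sum_l \sum_k \sum_f (v l * mono f (pt l)) * (v k * mono f (pt k))^bar).
        apply: eq_bigr => i _; apply: eq_bigr => k _.
        rewrite (normalized_kernel_mul (gA q qD) (gB q qD) gP (m := m) _ (pts i) (pts k)); last by ring.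
        rewrite (finite_rank m (p1 _ (pts i)) (p1 _ (pts k)) (p0 _)) mulr_sumr.
        by apply: eq_bigr => f _; rewrite cJM /mono; ring.
      under eq_bigr do rewrite exchange_big /=.
      rewrite exchange_big /=; apply: eq_bigr => f _.
      rewrite mulr_suml; apply: eq_bigr => i _.
      by rewrite rmorph_sum mulr_sumr.
    by apply: big1 => f _; rewrite vE mul0r.
  - by apply: isl2_conj_seq; exact: a1.
have := @vandermonde_ker R D.+1 (fun l => v l * A 0%N (pt l) w1) (fun l => Q (pt l)) ptI.
have V0 (k : 'I_D.+1) : \sum_l v l * A 0%N (pt l) w1 * Q (pt l) ^+ k = 0.
  rewrite -[RHS](main k (ltnW (ltn_ord k))); apply: eq_bigr => i _.
  by rewrite (AQ k)// ?(ltnW (ltn_ord k))// mulrA.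
move=> /(_ V0 l) /eqP; rewrite mulf_eq0 (negbTE vl) /=.
by rewrite (negbTE (is_logderiv_neq0 (ldA 0%N isT) (pts l))).
Qed.

End Core.

(** * The Fubini-Study metric *)

(** Coordinates indexed by I are read as sequences through an injection of I
    into nat, with zeros off its range. *)
Section Reindexing.
Context {R : realType} {I : choiceType}.
Variables (iota : I -> nat) (kappa : nat -> option I).
Hypotheses (iotaK : pcancel iota kappa) (kappaK : ocancel kappa iota).
Implicit Types (x y z u v : I -> R[i]).

Definition emb x : nat -> R[i] := fun n => if kappa n is Some i then x i else 0.

Lemma embE x i : emb x (iota i) = x i.
Proof. by rewrite /emb iotaK. Qed.

Lemma embD x y : emb (x + y) = emb x + emb y.
Proof. by apply/funext => n; rewrite /emb !fctE; case: kappa => //; rewrite addr0. Qed.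

Lemma embN x : emb (- x) = - emb x.
Proof. by apply/funext => n; rewrite /emb !fctE; case: kappa => //; rewrite oppr0. Qed.

Lemma embB x y : emb (x - y) = emb x - emb y.
Proof. by rewrite embD embN. Qed.

Lemma embZ (a : R[i]) x : emb (a *: x) = a *: emb x.
Proof. by apply/funext => n; rewrite /emb !fctE; case: kappa => //; rewrite scaler0. Qed.

Lemma esum_emb x : (\esum_(i in [set: I]) ((Normc.normc (x i) ^+ 2)%:E) =
  \sum_(n <oo) (cmod (emb x n) ^+ 2)%:E)%E.
Proof.
rewrite nneseries_esumT; last by move=> n; rewrite lee_fin exprn_ge0 ?cmod_ge0.
transitivity (\esum_(n in range iota) (cmod (emb x n) ^+ 2)%:E)%E.
  rewrite (@reindex_esum _ _ _ [set: I] (range iota) iota).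
  - by apply: eq_esum => i _; rewrite embE.
  - split; first by move=> i _; exists i.
    + by move=> i j _ _; exact: (pcan_inj iotaK).
    + by move=> n.
rewrite esum_mkcond; apply: eq_esum => n _; case: ifPn => // /negP nr.
rewrite /emb; have := kappaK n; case: kappa => [i /= E|_]; last by rewrite cmod0 expr0n.
by exfalso; apply: nr; rewrite inE; exists i.
Qed.

Lemma nneseries_sqnorm (x : nat -> R[i]) a : l2 x a ->
  (\sum_(n <oo) (cmod (x n) ^+ 2)%:E)%E = (sqnorm x)%:E.
Proof.
move=> hx; set L := limn _.
have pos n : (0 <= (cmod (x n) ^+ 2)%:E)%E by rewrite lee_fin exprn_ge0 ?cmod_ge0.
have part N : (\sum_(0 <= i < N) (cmod (x i) ^+ 2)%:E)%E = (\sum_(i < N) cmod (x i) ^+ 2)%:E.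
  by rewrite sumEFin big_mkord.
have Lle : (L <= (sqnorm x)%:E)%E.
  apply: lime_le; first by apply: is_cvg_nneseries.
  by apply: nearW => N; rewrite part lee_fin (psum_le_sqnorm N hx).
have Lge N : ((\sum_(i < N) cmod (x i) ^+ 2)%:E <= L)%E.
  by rewrite -part; apply: nneseries_lim_ge.
apply/eqP; rewrite eq_le Lle /=.
have L0 : (0 <= L)%E by apply: nneseries_ge0.
have Lfin : L \is a fin_num by rewrite ge0_fin_numE// (le_lt_trans Lle) ?ltry.
rewrite -(fineK Lfin) lee_fin.
have f0 : 0 <= fine L by rewrite fine_ge0.
rewrite -(sqr_sqrtr f0); apply: sqnorm_le; split; first exact: sqrtr_ge0.
by move=> N; rewrite sqr_sqrtr// -lee_fin fineK.
Qed.

Lemma ell2_emb x : ell2 x -> exists a : R, l2 (emb x) a.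
Proof.
rewrite /ell2 /= esum_emb; set L := limn _ => Loo.
have pos n : (0 <= (cmod (emb x n) ^+ 2)%:E)%E by rewrite lee_fin exprn_ge0 ?cmod_ge0.
have L0 : (0 <= L)%E by apply: nneseries_ge0.
have Lfin : L \is a fin_num by rewrite ge0_fin_numE.
have f0 : 0 <= fine L by rewrite fine_ge0.
exists (Num.sqrt (fine L)); split; first exact: sqrtr_ge0.
move=> N; rewrite sqr_sqrtr// -lee_fin fineK// -(big_mkord xpredT (fun i => cmod (emb x i) ^+ 2)) -sumEFin.
exact: nneseries_lim_ge.
Qed.

Lemma normsq_emb x a : l2 (emb x) a -> normsq x = sqnorm (emb x).
Proof. by move=> hx; rewrite /normsq esum_emb (nneseries_sqnorm hx). Qed.

Definition ip x y : R[i] := bilin (emb x) (conj_seq (emb y)).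

Lemma sqnormD x y a b : l2 (emb x) a -> l2 (emb y) b ->
  sqnorm (emb (x + y)) = sqnorm (emb x) + 2 * Rec (ip y x) + sqnorm (emb y).
Proof.
move=> hx hy; rewrite embD /sqnorm conj_seqD (bilinDl hx hy (l2D (l2_conj_seq hx) (l2_conj_seq hy))).
rewrite (bilinDr hx (l2_conj_seq hx) (l2_conj_seq hy)) (bilinDr hy (l2_conj_seq hx) (l2_conj_seq hy)) !cReD -/(ip y x).
have -> : bilin (emb x) (conj_seq (emb y)) = (ip y x)^bar.
  by rewrite /ip -(bilin_conj hy (l2_conj_seq hx)) conj_seqK bilinC.
rewrite cReJ; ring.
Qed.

Lemma sqnormZ (c : R[i]) y b : l2 (emb y) b -> sqnorm (emb (c *: y)) = cmod c ^+ 2 * sqnorm (emb y).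
Proof.
move=> hy; rewrite embZ /sqnorm conj_seqZ (bilinZl _ hy (l2Z _ (l2_conj_seq hy))) (bilinZr _ hy (l2_conj_seq hy)).
by rewrite mulrA mulcJ (bilin_sqnorm hy) -rmorphM.
Qed.

Lemma rderivE (psi : (I -> R[i]) -> R[i]) v x d :
  path_deriv (fun t : R => psi (x + t%:C *: v)) 0 d -> rderiv psi v x = d.
Proof.
by move=> [h1 h2]; apply: complex_ext; rewrite /= derive1E; [case: h1|case: h2].
Qed.

Lemma is_derive_quad (a b c : R) : is_derive (0 : R) (1 : R) (fun t : R => a + 2 * t * b + t ^+ 2 * c) (2 * b).
Proof.
apply/is_deriveP => e e0; have c1 : 0 < `|c| + 1 by rewrite ltr_pwDr.
exists (e / (`|c| + 1)); first exact: divr_gt0.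
move=> s; rewrite subr0 => sd.
have -> : a + 2 * s * b + s ^+ 2 * c - (a + 2 * 0 * b + 0 ^+ 2 * c) - s * (2 * b) = s ^+ 2 * c.
  by ring.
rewrite normrM normrX expr2 -mulrA [_ * `|c|]mulrC mulrA ler_wpM2r//.
have : (`|c| + 1) * `|s| <= e by rewrite mulrC -ler_pdivlMr ?ltW.
by have := normr_ge0 s; rewrite [`|s| * _]mulrC; lra.
Qed.

Section Potential.
Variables (x : I -> R[i]) (a : R).
Hypothesis hx : l2 (emb x) a.

Lemma normsq_line v b (t : R) : l2 (emb v) b ->
  normsq (x + t%:C *: v) = sqnorm (emb x) + 2 * t * Rec (ip v x) + t ^+ 2 * sqnorm (emb v).
Proof.
move=> hv; have htv : l2 (emb (t%:C *: v)) (cmod t%:C * b) by rewrite embZ; exact: l2Z.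
have hs : l2 (emb (x + t%:C *: v)) (a + cmod t%:C * b) by rewrite embD; exact: l2D.
rewrite (normsq_emb hs) (sqnormD hx htv) (sqnormZ _ hv) cmod_real real_normK ?num_real//.
congr (_ + _ + _); rewrite /ip embZ (bilinZl _ hv (l2_conj_seq hx)) cReZ; ring.
Qed.

Lemma den_gt0 : 0 < 1 + sqnorm (emb x).
Proof. by have := sqnorm_ge0 hx; lra. Qed.

Lemma rderiv_fs v b : l2 (emb v) b ->
  rderiv fs_potential v x = (2 * Rec (ip v x) / (1 + sqnorm (emb x)))%:C.
Proof.
move=> hv; apply: rderivE; split; last exact: is_derive_cst.
rewrite /fs_potential cRe_real; under eq_fun do rewrite cRe_real.
have -> : (fun s : R => ln (1 + normsq (x + s%:C *: v))) =
    (@ln R) \o (fun t : R => (1 + sqnorm (emb x)) + 2 * t * Rec (ip v x) + t ^+ 2 * sqnorm (emb v)).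
  by apply/funext => s; rewrite /comp (normsq_line _ hv); congr ln; ring.
rewrite mulrC; apply: is_derive1_comp; last exact: is_derive_quad.
have -> : 1 + sqnorm (emb x) + 2 * 0 * Rec (ip v x) + 0 ^+ 2 * sqnorm (emb v) = 1 + sqnorm (emb x) by ring.
exact: is_derive1_ln den_gt0.
Qed.

Lemma wderivbar_fs v b : l2 (emb v) b ->
  wderivbar fs_potential v x = ip x v / (1 + sqnorm (emb x))%:C.
Proof.
move=> hv; have hiv : l2 (emb (ci *: v)) (cmod ci * b) by rewrite embZ; exact: l2Z.
rewrite /wderivbar (rderiv_fs hv) (rderiv_fs hiv).
have -> : ip x v = (ip v x)^bar by rewrite /ip -(bilin_conj hv (l2_conj_seq hx)) conj_seqK bilinC.
have -> : ip (ci *: v) x = ci * ip v x by rewrite /ip embZ (bilinZl _ hv (l2_conj_seq hx)).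
rewrite cRe_i; have d0 : 1 + sqnorm (emb x) != 0 by rewrite gt_eqF// den_gt0.
have dC : (1 + sqnorm (emb x))%:C != 0 :> R[i] by rewrite -cmod_gt0 cmod_real normr_gt0.
move: (ip v x) => w.
have -> : w^bar = (Rec w)%:C - ci * (Imc w)%:C by apply: complex_ext; case: w => p q /=; ring.
rewrite !rcM rcV rcN !rc_nat.
by move: (Rec w)%:C (Imc w)%:C (1 + sqnorm (emb x))%:C dC => p q D D0; field.
Qed.

End Potential.

(** The derivatives along real lines are those of explicit functions of t, because
    1 + |x + t v| ^ 2 is a quadratic polynomial in t. *)
Lemma fubini_studyE x u v a b c : l2 (emb x) a -> l2 (emb u) b -> l2 (emb v) c ->
  fubini_study x u v = ip u v / (1 + sqnorm (emb x))%:C -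
    ip x v * ip u x / (1 + sqnorm (emb x))%:C ^+ 2.
Proof.
move=> hx hu hv; rewrite /fubini_study /ddbar.
have key w d : l2 (emb w) d -> rderiv (wderivbar fs_potential v) w x =
    ip w v / (1 + sqnorm (emb x))%:C - ip x v * (2 * Rec (ip w x))%:C / (1 + sqnorm (emb x))%:C ^+ 2.
  move=> hw; apply: rderivE.
  pose q (t : R) := (1 + sqnorm (emb x)) + 2 * t * Rec (ip w x) + t ^+ 2 * sqnorm (emb w).
  have qE t : 1 + sqnorm (emb (x + t%:C *: w)) = q t.
    have htw : l2 (emb (t%:C *: w)) (cmod t%:C * d) by rewrite embZ; exact: l2Z.
    have hs : l2 (emb (x + t%:C *: w)) (a + cmod t%:C * d) by rewrite embD; exact: l2D.
    by rewrite -(normsq_emb hs) (normsq_line hx _ hw) /q; ring.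
  have qn t : q t != 0.
    have htw : l2 (emb (t%:C *: w)) (cmod t%:C * d) by rewrite embZ; exact: l2Z.
    have hs : l2 (emb (x + t%:C *: w)) (a + cmod t%:C * d) by rewrite embD; exact: l2D.
    by rewrite -qE gt_eqF// (den_gt0 hs).
  have q0 : q 0 = 1 + sqnorm (emb x) by rewrite /q; ring.
  have dq : path_deriv (fun t => (q t)%:C) 0 (2 * Rec (ip w x))%:C.
    by split; [exact: is_derive_quad|exact: is_derive_cst].
  have qC t : (q t)%:C != 0 :> R[i] by rewrite -cmod_gt0 cmod_real normr_gt0.
  have dn := path_deriv_affine (ip w v) (ip x v) (path_deriv_real 0).
  have dV := @has_deriv_path R _ (fun t => (q t)%:C) 0 _ _ (has_deriv_inv (qC 0)) dq.
  have dd := path_derivM dn dV.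
  apply: (path_deriv_ext dd) => [s|]; last first.
    by move: (qC 0) => Q0; rewrite -q0; move: (q 0)%:C Q0 => D D0; field.
  have htw : l2 (emb (s%:C *: w)) (cmod s%:C * d) by rewrite embZ; exact: l2Z.
  have hs : l2 (emb (x + s%:C *: w)) (a + cmod s%:C * d) by rewrite embD; exact: l2D.
  rewrite (wderivbar_fs hs hv) qE; congr (_ / _).
  rewrite {1}/ip embD (bilinDl hx htw (l2_conj_seq hv)) embZ (bilinZl _ hw (l2_conj_seq hv)) -/(ip x v) -/(ip w v).
  by ring.
have hiu : l2 (emb (ci *: u)) (cmod ci * b) by rewrite embZ; exact: l2Z.
rewrite /wderiv (key u b hu) (key _ _ hiu).
have ipZ y d : l2 (emb y) d -> ip (ci *: u) y = ci * ip u y.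
  by move=> hy; rewrite /ip embZ (bilinZl _ hu (l2_conj_seq hy)).
rewrite (ipZ v c hv) (ipZ x a hx) cRe_i.
have dC : (1 + sqnorm (emb x))%:C != 0 :> R[i].
  by rewrite -cmod_gt0 cmod_real normr_gt0 gt_eqF// (den_gt0 hx).
move: (ip u v) (ip x v) (ip u x) => A B w.
have -> : w = (Rec w)%:C + ci * (Imc w)%:C by exact: complexE.
rewrite cReD cRe_real cRe_i cIm_real oppr0 addr0 cImD cIm_real add0r cIm_i cRe_real.
rewrite !rcM rcN !rc_nat.
move: (Rec w)%:C (Imc w)%:C (1 + sqnorm (emb x))%:C dC => p q D D0.
have i2 : ci * ci = -1 :> R[i] := mulii.
transitivity (2^-1 * ((1 - ci * ci) * A / D) - B * (p + ci * q) / D ^+ 2); first by field.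
by rewrite i2; field.
Qed.

End Reindexing.

(** * Immersions along a holomorphic disc *)

Section RealNorm.
Context {R : realType}.
Implicit Types (n m : nat).

(** Again the real value of a norm that belongs to R[i]. *)
Definition vnorm n (y : 'rV[R[i]]_n) : R := Rec `|y|.

Lemma vnormE n (y : 'rV[R[i]]_n) : `|y| = (vnorm y)%:C.
Proof. by apply: complex_ext => //; apply: ger0_Im. Qed.

Lemma vnorm_ge0 n (y : 'rV[R[i]]_n) : 0 <= vnorm y.
Proof. by rewrite -ler0c -vnormE. Qed.

Lemma vnormD n (x y : 'rV[R[i]]_n) : vnorm (x + y) <= vnorm x + vnorm y.
Proof. by rewrite -lecR rmorphD /= -!vnormE ler_normD. Qed.

Lemma vnormN n (y : 'rV[R[i]]_n) : vnorm (- y) = vnorm y.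
Proof. by rewrite /vnorm normrN. Qed.

Lemma vnormZ n (a : R[i]) (y : 'rV[R[i]]_n) : vnorm (a *: y) = cmod a * vnorm y.
Proof.
apply: (@complexI R); rewrite rmorphM /= -!vnormE; exact: normrZ.
Qed.

Lemma vnorm_coord n (y : 'rV[R[i]]_n) j : cmod (y 0 j) <= vnorm y.
Proof.
rewrite -lecR -vnormE -cmod_normr [leRHS]/Num.norm /= mx_normE.
rewrite -[leLHS]nngE num_le.
exact: (le_bigmax _ (fun i : 'I_1 * 'I_n => `|y i.1 i.2|%:nng) (0, j)).
Qed.

Lemma nbhs_cmod (t : R[i]) P : nbhs t P -> exists2 r : R, 0 < r &
  forall w, cmod (w - t) < r -> P w.
Proof.
move=> /nbhs_ballP[e /= e0 eP].
have eE : e = (Rec e)%:C.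
  by apply: complex_ext => //; apply: ger0_Im; exact: ltW.
exists (Rec e); first by rewrite -ltcR -eE.
move=> w wt; apply: eP; rewrite -ball_normE /=.
rewrite (_ : `|t - w| = (cmod (w - t))%:C); last by rewrite -cmodC; exact: cmod_normr.
by rewrite eE ltcR.
Qed.

Lemma nbhs_vnorm n (x : 'rV[R[i]]_n) P : nbhs x P -> exists2 r : R, 0 < r &
  forall y, vnorm (y - x) < r -> P y.
Proof.
move=> /nbhs_ballP[e /= e0 eP].
have eE : e = (Rec e)%:C.
  by apply: complex_ext => //; apply: ger0_Im; exact: ltW.
exists (Rec e); first by rewrite -ltcR -eE.
move=> y yx; apply: eP; rewrite -ball_normE /= vnormE -opprB vnormN.
by rewrite eE ltcR.
Qed.

Lemma nbhs_line n (x v : 'rV[R[i]]_n) (t : R[i]) P : nbhs (x + t *: v) P ->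
  exists2 r : R, 0 < r & forall w, cmod (w - t) < r -> P (x + w *: v).
Proof.
move=> /nbhs_vnorm[r r0 rP]; have v0 := vnorm_ge0 v.
exists (r / (vnorm v + 1)); first by rewrite divr_gt0//; lra.
move=> w wt; apply: rP.
have -> : x + w *: v - (x + t *: v) = (w - t) *: v by rewrite scalerBl opprD addrACA subrr add0r.
rewrite vnormZ; have : cmod (w - t) * (vnorm v + 1) < r by rewrite -ltr_pdivlMr//; lra.
by have := cmod_ge0 (w - t); lra.
Qed.

Lemma differentiable_line n m (Phi : 'rV[R[i]]_n -> 'rV[R[i]]_m) x v :
  differentiable Phi x -> forall e : R, 0 < e -> exists2 d : R, 0 < d &
  forall h : R[i], cmod h < d -> vnorm (Phi (x + h *: v) - Phi x - h *: 'd Phi x v) <= e * cmod h.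
Proof.
move=> dPhi e e0; have dv := diff_derivable (v := v) dPhi.
have : h^-1 *: (Phi (h *: v + x) - Phi x) @[h --> 0^'] --> 'd Phi x v.
  by rewrite -deriveE//; exact: dv.
have eC : 0 < (e%:C : R[i]) by rewrite ltcR.
move=> /cvgrPdist_le /(_ _ eC) H.
have [d d0 hd] := nbhs_cmod H.
exists d => // h hd'; have [->|h0] := eqVneq h 0.
  by rewrite !scale0r addr0 subrr subr0 cmod0 mulr0 /vnorm normr0.
have := hd h; rewrite subr0 => /(_ hd' h0).
rewrite distrC vnormE lecR (addrC (h *: v)) => Hh.
have -> : Phi (x + h *: v) - Phi x - h *: 'd Phi x v =
    h *: (h^-1 *: (Phi (x + h *: v) - Phi x) - 'd Phi x v).
  by rewrite scalerBr scalerA divff// scale1r.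
by rewrite vnormZ mulrC ler_wpM2r ?cmod_ge0//.
Qed.

Lemma l2_sum n (x : 'I_n -> nat -> R[i]) (a : 'I_n -> R) : (forall j, l2 (x j) (a j)) ->
  l2 (\sum_j x j) (\sum_j a j).
Proof.
move=> h; elim/big_ind2: _ => [|? ? ? ?|//]; first exact: l2_0.
exact: l2D.
Qed.

Definition basis_vector (K : nat) : nat -> R[i] := fun n => (n == K)%:R.

Lemma l2_basis_vector K : l2 (basis_vector K) 1.
Proof.
split=> // N; rewrite expr1n.
have -> : \sum_(i < N) cmod (basis_vector K i) ^+ 2 = (K < N)%:R.
  elim: N => [|N IHN]; first by rewrite big_ord0.
  have -> : (K < N.+1)%N = (N == K) || (K < N)%N by rewrite ltnS leq_eqVlt eq_sym.
  rewrite big_ord_recr /= IHN /basis_vector.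
  have [->|NK] := eqVneq N K; first by rewrite ltnn cmod1 expr1n add0r.
  by rewrite cmod0 expr0n addr0.
by case: ltnP.
Qed.

Lemma conj_seq_basis_vector K : conj_seq (basis_vector K) = basis_vector K.
Proof. by apply/funext => n; rewrite /conj_seq /basis_vector conjc_nat. Qed.

Lemma bilin_basis_vector x a K : l2 x a -> bilin x (basis_vector K) = x K.
Proof.
move=> hx; apply: (bilin_eq hx (l2_basis_vector K)) => e e0; exists K.+1 => N KN.
rewrite /psum (bigD1 (Ordinal KN))//= {1}/basis_vector eqxx mulr1 big1 ?addr0.
  by rewrite subrr cmod0 ltW.
move=> j; rewrite -val_eqE /= /basis_vector => /negbTE->.
by rewrite mulr0.
Qed.

End RealNorm.

Section ImmersedDisc.
Context {R : realType} {I : choiceType}.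
Variables (iota : I -> nat) (kappa : nat -> option I).
Hypotheses (iotaK : pcancel iota kappa) (kappaK : ocancel kappa iota).
Local Notation emb := (@emb R I kappa).

(** A linear map from C^n to square-summable sequences is bounded, its source
    having finite dimension. *)
Lemma linear_bound n (D : {linear 'rV[R[i]]_n -> (I -> R[i])}) :
  (forall v, ell2 (D v)) -> exists2 K : R, 0 <= K & forall y, l2 (emb (D y)) (K * vnorm y).
Proof.
move=> hD; have /choice[b hb] j := ell2_emb iotaK kappaK (hD (delta_mx 0 j)).
have b0 j := l2_ge0 (hb j).
exists (\sum_j b j); first by apply: sumr_ge0.
move=> y; rewrite {1}[y]row_sum_delta linear_sum /=.
rewrite (big_morph emb (embD kappa) (_ : emb 0 = 0)); last first.
  by apply/funext => k; rewrite /emb; case: kappa.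
apply: (l2_le (a := \sum_j cmod (y 0 j) * b j)).
  by rewrite mulr_suml; apply: ler_sum => j _; rewrite mulrC ler_wpM2l// vnorm_coord.
by apply: l2_sum => j; rewrite linearZ embZ; exact: l2Z.
Qed.

(* The common submanifold S is isometric into M for gM, while f is isometric for
   the multiple gM' of gM; the disc is a complex line of direction v in the chart
   c0 of S. *)
Variables (s m : nat) (S : complexManifold R s) (k : hmetric S)
  (M : complexManifold R m) (gM gM' : hmetric M) (i : S -> M) (U : set M)
  (f : M -> @cproj R I) (beta : R) (c0 : chart R S s) (p0 : S) (v : 'rV[R[i]]_s).
Hypotheses (c0A : atlas S c0) (c0p : cdom c0 p0) (beta0 : 0 <= beta)
  (i_hol : holomorphic i) (i_iso : isometric k gM i)
  (gMM : forall c p u, herm (gM' c p) u u = beta%:C * herm (gM c p) u u)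
  (Unbhs : nbhs (i p0) U) (f_imm : kahler_immersion_on gM' U f).

Let line (t : R[i]) := ccoord c0 p0 + t *: v.
Let sigma (t : R[i]) := Defs.cpoint c0 (line t).
Let lam (t : R[i]) : R := Rec (herm (k c0 (sigma t)) v v).

Hypotheses (k_pos : forall p, cdom c0 p -> 0 < herm (k c0 p) v v)
  (lam_bound : exists B r : R, [/\ 0 <= B, 0 < r & forall t, cmod t < r -> lam t <= B]).

Let c0chart : is_chart c0 := @atlas_chart _ _ S c0 c0A.

Let image_in x : image_of c0 x -> cdom c0 (Defs.cpoint c0 x) /\ ccoord c0 (Defs.cpoint c0 x) = x.
Proof. by move=> [p pc <-]; case: c0chart => _ _ h _ _; rewrite h. Qed.

Let cproj_dom_ex (L : @cproj R I) : exists kk, cproj_dom kk L.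
Proof.
have [Z [_ Z0 LE]] := clineP L.
have [kk Zk] : exists kk, Z kk <> 0.
  by apply: contrapT => no; apply: Z0; apply/funext => j; apply: contrapT => Zj; apply: no; exists j.
exists kk, Z => //; rewrite LE; exists 1 => //; by rewrite scale1r.
Qed.

Let nbhs_sigma V : nbhs (i p0) V -> exists2 r : R, 0 < r & forall t, cmod t < r ->
  image_of c0 (line t) /\ V (i (sigma t)).
Proof.
move=> Vn; have [_ oI ccK _ cP] := c0chart; have [i_cont _] := i_hol.
have I0 : image_of c0 (line 0) by exists p0; rewrite /line ?scale0r ?addr0.
have cp : {for line 0, continuous (Defs.cpoint c0)}.
  by move: cP; rewrite continuous_open_subspace// => /(_ (line 0)); apply; rewrite inE.
have s0 : Defs.cpoint c0 (line 0) = p0 by rewrite /line scale0r addr0 ccK.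
have n1 : nbhs (line 0) (image_of c0) by exact: open_nbhs_nbhs.
have n2 : nbhs (line 0) (fun x => V (i (Defs.cpoint c0 x))).
  have : nbhs (i (Defs.cpoint c0 (line 0))) V by rewrite s0.
  by move=> /i_cont /cp.
have [r r0 rP] := nbhs_line (filterI n1 n2); exists r => // t tr.
by apply: rP; rewrite subr0.
Qed.

(** The chain rule along the line, through a chart of M around the centre and
    affine coordinates around its image. *)
Lemma immersed_disc_pointwise : exists kk (r : R), 0 < r /\
  let G t := aff_coord kk (f (i (sigma t))) in
  forall t, cmod t < r -> exists d, [/\ isl2 (emb (G t)), isl2 (emb d),
    (beta * lam t)%:C = fubini_study (G t) d d &
    forall e : R, 0 < e -> exists2 del : R, 0 < del & forall w, cmod (w - t) < del ->
      l2 (emb (G w) - emb (G t) - (w - t) *: emb d) (e * cmod (w - t))].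
Proof.
have [e eA ep] := @atlas_cover _ _ M (i p0).
have [kk Lk] := cproj_dom_ex (f (i p0)).
have [oe _ eK _ _] := @atlas_chart _ _ M e eA.
have [nk _] := f_imm eA (nbhs_singleton Unbhs) ep Lk.
have Vn : nbhs (i p0) (fun q => [/\ cdom e q, U q & cproj_dom kk (f q)]).
  have n1 : nbhs (i p0) (cdom e) by exact: open_nbhs_nbhs.
  by apply: filterS (filterI n1 (filterI Unbhs nk)) => q [? []].
have [r r0 rP] := nbhs_sigma Vn.
exists kk, r; split=> // G t tr.
have [It [ec Uq kq]] := rP t tr; have [st cst_] := image_in It.
have [_ [D [[hD dD] mD]]] := f_imm eA Uq ec kq.
have [_ i_diff] := i_hol; have dPhi := i_diff c0 e (sigma t) c0A eA st ec.
rewrite cst_ in dPhi; set Phi := in_charts c0 e i in dPhi.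
have isoE := i_iso c0A eA st ec v v; rewrite cst_ -/Phi in isoE.
pose u := 'd Phi (line t) v; exists (D u).
have GE w : cmod w < r -> aff_coord kk (f (Defs.cpoint e (Phi (line w)))) = G w.
  by move=> /rP[_ [ew _ _]]; rewrite /G /Phi /in_charts /= eK.
have near1 e0 : 0 < e0 -> exists2 d : R, 0 < d & forall y, vnorm (y - Phi (line t)) < d ->
    ell2 (aff_coord kk (f (Defs.cpoint e y))) /\
    Num.sqrt (normsq (aff_coord kk (f (Defs.cpoint e y)) - G t - D (y - Phi (line t)))) <= e0 * vnorm (y - Phi (line t)).
  move=> e00; have [d d0 hd] := nbhs_vnorm (dD e0 e00); exists d => // y yd.
  have [h1 h2] := hd y yd; split=> //; move: h2.
  by rewrite /= (GE t tr) vnormE -rmorphM lecR.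
have El2 w : cmod w < r -> ell2 (aff_coord kk (f (Defs.cpoint e (Phi (line w))))) -> isl2 (emb (G w)).
  by move=> /GE-> /(ell2_emb iotaK kappaK).
have Gl2 : isl2 (emb (G t)).
  have [d d0 /(_ (Phi (line t)))] := near1 1 ltr01.
  by rewrite subrr /vnorm normr0 => /(_ d0)[/(El2 t tr)].
have [K K0 hK] := linear_bound hD.
split=> //; first by eexists; exact: hK.
  rewrite -mD -/u gMM -isoE rmorphM; congr (_ * _).
  have h0 := k_pos st; have /ger0_Im Im0 := ltW h0.
  by apply: complex_ext => //; rewrite cIm_real Im0.
move=> e0 e00; have N0 := vnorm_ge0 u; pose N := vnorm u + 1.
have NN : 0 < N by rewrite /N; lra.
have [d1 d10 hd1] := near1 (e0 / 2 / N) ltac:(by rewrite !divr_gt0//).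
pose e2 := Num.min 1 (e0 / 2 / (K + 1)).
have e20 : 0 < e2 by rewrite lt_min ltr01 !divr_gt0//; lra.
have [d2 d20 hd2] := differentiable_line v dPhi e20.
pose del := Num.min (Num.min d2 (d1 / N)) (r - cmod t).
exists del; first by rewrite !lt_min d20 subr_gt0 tr andbT divr_gt0.
move=> w; rewrite !lt_min => /andP[/andP[wd2 wd1] wr].
have {}wr : cmod w < r by have := cmodD (w - t) t; rewrite subrK; lra.
have h0 := cmod_ge0 (w - t).
have := hd2 _ wd2; have -> : line t + (w - t) *: v = line w.
  by rewrite /line -addrA -scalerDl [t + _]addrC subrK.
set rm := Phi (line w) - Phi (line t) - (w - t) *: _ => hrm.
have yE : Phi (line w) - Phi (line t) = rm + (w - t) *: u by rewrite /rm subrK.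
have ny : vnorm (Phi (line w) - Phi (line t)) <= N * cmod (w - t).
  rewrite yE (le_trans (vnormD _ _))// vnormZ /N.
  have : e2 * cmod (w - t) <= 1 * cmod (w - t) by rewrite ler_wpM2r// ge_min lexx.
  lra.
have yd : vnorm (Phi (line w) - Phi (line t)) < d1.
  by rewrite (le_lt_trans ny)// mulrC -ltr_pdivlMr.
have [Ey Fy] := hd1 _ yd; rewrite (GE w wr) in Fy.
have [a1 ha1] := El2 w wr Ey; have [a2 ha2] := Gl2.
set X := G w - G t - D (Phi (line w) - Phi (line t)) in Fy.
have hX : isl2 (emb X).
  by eexists; rewrite /X !embB; exact: l2B (l2B ha1 ha2) (hK _).
have -> : emb (G w) - emb (G t) - (w - t) *: emb (D u) = emb X + emb (D rm).
  rewrite -!embB -embZ -embB -embD; congr emb.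
  by rewrite /X yE linearD [D (_ *: _)]linearZ /= opprD addrA [_ - D rm - _]addrAC subrK.
have [a ha] := hX.
have b1 : l2 (emb X) (e0 / 2 * cmod (w - t)).
  apply: (l2_le _ (l2_sqrt ha)); rewrite -(normsq_emb iotaK kappaK ha) (le_trans Fy)//.
  apply: le_trans (_ : e0 / 2 / N * (N * cmod (w - t)) <= _).
    by rewrite ler_wpM2l// !divr_ge0// ltW.
  by rewrite mulrA divfK// gt_eqF.
have b2 : l2 (emb (D rm)) (e0 / 2 * cmod (w - t)).
  apply: (l2_le _ (hK rm)); apply: le_trans (ler_wpM2l K0 hrm) _.
  rewrite mulrA ler_wpM2r//.
  have : K * e2 <= K * (e0 / 2 / (K + 1)) by rewrite ler_wpM2l// ge_min lexx orbT.
  move/le_trans; apply; rewrite mulrCA ler_piMr//; first lra.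
  by rewrite ler_pdivrMr; lra.
by apply: (l2_le _ (l2D b1 b2)); lra.
Qed.

(** Homogeneous coordinates are obtained by putting 1 at the free index kk of the
    affine coordinates. The metric identity bounds the derivative of the curve
    in terms of lam and of the curve, which is all that the Cauchy estimates
    need. *)
Lemma immersed_curve : exists r H H1 H2, [/\ 0 < r, curve r H H1 H2,
  pulls_back lam beta r H H1 & forall n, kappa n = None -> forall z, H z n = 0].
Proof.
have [kk [r [r0 hG]]] := immersed_disc_pointwise.
move: hG; set G := fun t => _ => /= hG.
have /choice[dG hdG] t : exists d, cmod t < r -> [/\ isl2 (emb (G t)), isl2 (emb d),
    (beta * lam t)%:C = fubini_study (G t) d d &
    forall e : R, 0 < e -> exists2 del : R, 0 < del & forall w, cmod (w - t) < del ->
      l2 (emb (G w) - emb (G t) - (w - t) *: emb d) (e * cmod (w - t))].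
  have [tr|tr] := ltP (cmod t) r; last by exists 0.
  by have [d hd] := hG t tr; exists d.
pose K := iota kk; pose bv := @basis_vector R K.
have GK t : emb (G t) K = 0 by rewrite /K embE// /G /aff_coord eqxx.
have dGK t : cmod t < r -> emb (dG t) K = 0.
  move=> /hdG[_ _ _ h]; apply: cmod_eq0P => e /h[d d0 /(_ (t + (d / 2)%:C))].
  have d2 : 0 < d / 2 by lra.
  have -> : t + (d / 2)%:C - t = (d / 2)%:C by ring.
  have -> : cmod ((d / 2)%:C : R[i]) = d / 2 by rewrite cmod_real gtr0_norm.
  move=> /(_ ltac:(lra)) /(l2_coord K).
  rewrite -[X in cmod X]/(emb (G _) K - emb (G t) K - (d / 2)%:C * emb (dG t) K).
  by rewrite !GK subrr sub0r cmodN cmodM cmod_real gtr0_norm// mulrC ler_pM2r.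
have z0 : cmod (0 : R[i]) < r by rewrite cmod0.
have [[a0 ha0] [b0 hb0] _ /(_ 1 ltr01)[d0 d00 hd0]] := hdG 0 z0.
have [B [r2 [B0 r20 hB]]] := lam_bound.
pose rho := Num.min (Num.min r d0) (Num.min 1 r2).
have rho0 : 0 < rho by rewrite !lt_min r0 d00 r20 ltr01.
have rho_r z : cmod z < rho -> cmod z < r by rewrite !lt_min => /andP[/andP[]].
have rho_1 z : cmod z < rho -> cmod z <= 1 by rewrite !lt_min => /andP[_ /andP[/ltW]].
have rho_B z : cmod z < rho -> lam z <= B by rewrite !lt_min => /andP[_ /andP[_ /hB]].
have rho_d z : cmod z < rho -> cmod (z - 0) < d0.
  by rewrite subr0 !lt_min => /andP[/andP[]].
have a00 := l2_ge0 ha0; have b00 := l2_ge0 hb0.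
pose a := a0 + b0 + 1.
have Ga z : cmod z < rho -> l2 (emb (G z)) a.
  move=> zr; have z1 := rho_1 z zr; have := hd0 z (rho_d z zr); rewrite subr0 mul1r => h.
  have -> : emb (G z) = (emb (G z) - emb (G 0) - z *: emb (dG 0)) + (emb (G 0) + z *: emb (dG 0)).
    by rewrite -[X in _ = X + _]addrA -opprD subrK.
  apply: (l2_le _ (l2D h (l2D ha0 (l2Z z hb0)))).
  have : cmod z * b0 <= 1 * b0 by rewrite ler_wpM2r.
  by rewrite /a; lra.
have dGl2 z : cmod z < rho -> isl2 (emb (dG z)) by move=> /rho_r /hdG[].
pose N z := 1 + sqnorm (emb (G z)).
have FS z : cmod z < rho -> beta * lam z * N z ^+ 2 =
    sqnorm (emb (dG z)) * N z - cmod (bilin (emb (dG z)) (conj_seq (emb (G z)))) ^+ 2.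
  move=> zr; have [b hb] := dGl2 z zr; have hz := Ga z zr.
  have [_ _ E _] := hdG z (rho_r z zr); move: E.
  rewrite (fubini_studyE iotaK kappaK hz hb hb) /ip (bilin_sqnorm hb).
  have -> : bilin (emb (G z)) (conj_seq (emb (dG z))) = (bilin (emb (dG z)) (conj_seq (emb (G z))))^bar.
    by rewrite -(bilin_conj hb (l2_conj_seq hz)) conj_seqK bilinC.
  rewrite [X in _ - X / _]mulrC mulcJ -/(N z) -rcV -rcM -rmorphXn -rcV -rcM -rmorphB => /complexI ->.
  have N0 : N z != 0 by rewrite gt_eqF// /N; have := sqnorm_ge0 hz; lra.
  by field.
have dGle z : cmod z < rho -> sqnorm (emb (dG z)) <= beta * B * (1 + a ^+ 2) ^+ 2.
  move=> zr; have [b hb] := dGl2 z zr; have hz := Ga z zr.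
  have := cauchy_schwarz hb hz; have := FS z zr.
  have s0 := sqnorm_ge0 hz; have sa := sqnorm_le hz; have n0 : 0 <= N z by rewrite /N; lra.
  have : beta * lam z * N z ^+ 2 <= beta * B * (1 + a ^+ 2) ^+ 2.
    apply: (@le_trans _ _ (beta * B * N z ^+ 2)).
      by rewrite ler_wpM2r ?exprn_ge0// ler_wpM2l// rho_B.
    by rewrite ler_wpM2l ?mulr_ge0// lerXn2r// ?nnegrE /N ?addr_ge0 ?sqr_ge0//; lra.
  by rewrite /N mulrDr mulr1; lra.
pose C2 := beta * B * (1 + a ^+ 2) ^+ 2.
have C20 : 0 <= C2 by rewrite /C2 mulr_ge0 ?sqr_ge0// mulr_ge0.
pose C := a + 1 + (C2 + 1).
pose H z := emb (G z) + bv.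
have hbv : l2 bv 1 by exact: l2_basis_vector.
have Hl2 z : cmod z < rho -> l2 (H z) (a + 1) by move=> /Ga hz; exact: l2D.
have dHl2 z : cmod z < rho -> l2 (emb (dG z)) (C2 + 1).
  move=> zr; have [b hb] := dGl2 z zr; split; first by lra.
  move=> n; rewrite (le_trans (psum_le_sqnorm n hb))// (le_trans (dGle z zr))//.
  by rewrite -/C2; have := mulr_ge0 C20 C20; rewrite expr2; lra.
have a1 : 0 <= a by rewrite /a; lra.
have [H2 [hH hH1]] : exists H2, l2diff (rho / 8) H (fun z => emb (dG z)) /\ l2diff (rho / 8) (fun z => emb (dG z)) H2.
  apply: (curve_regularity (C := C) rho0).
  - by move=> z /Hl2; apply: l2_le; rewrite /C; lra.
  - by move=> z /dHl2; apply: l2_le; rewrite /C; lra.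
  - move=> z /rho_r /hdG[_ _ _ h] e /h[d dd hd]; exists d => // w /hd.
    by rewrite /H opprD addrACA subrr addr0.
have le8 z : cmod z < rho / 8 -> cmod z < rho by lra.
exists (rho / 8), H, (fun z => emb (dG z)), H2; split; first by lra.
- split=> //; exists K => z _.
  by rewrite -[LHS]/(emb (G z) K + bv K) GK add0r /bv /basis_vector eqxx.
- move=> z /le8 zr; have hz := Ga z zr; have [b hb] := dGl2 z zr.
  have GH x c : l2 x c -> x K = 0 -> bilin x (conj_seq (H z)) = bilin x (conj_seq (emb (G z))).
    move=> hx x0; rewrite /H conj_seqD (bilinDr hx (l2_conj_seq hz) (l2_conj_seq hbv)).
    by rewrite conj_seq_basis_vector (bilin_basis_vector K hx) x0 addr0.
  rewrite (GH _ _ hb (dGK z (rho_r z zr))).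
  have -> : sqnorm (H z) = N z.
    rewrite /sqnorm {1}/H (bilinDl hz hbv (l2_conj_seq (Hl2 z zr))) (GH _ _ hz (GK z)) cReD.
    rewrite [bilin bv _]bilinC /H conj_seqD (bilinDl (l2_conj_seq hz) (l2_conj_seq hbv) hbv) conj_seq_basis_vector.
    rewrite (bilin_basis_vector K (l2_conj_seq hz)) (bilin_basis_vector K hbv).
    by rewrite /conj_seq GK conjc0 add0r /bv /basis_vector eqxx /N addrC.
  by rewrite FS.
- move=> n kn z; rewrite -[LHS]/(emb (G z) n + bv n) /emb kn add0r /bv /basis_vector.
  by case: eqP => // nK; move: kn; rewrite nK /K iotaK.
Qed.

End ImmersedDisc.

(** * Common submanifolds *)

Section Assembly.
Context {R : realType}.

Lemma pulls_back_le (lam : R[i] -> R) beta (r r' : R) H H1 : r' <= r ->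
  pulls_back lam beta r H H1 -> pulls_back lam beta r' H H1.
Proof. by move=> rr h z zr; apply: h; exact: lt_le_trans rr. Qed.

Lemma herm_scale n (a : R) (A : 'M[R[i]]_n) u : herm (a%:C *: A) u u = a%:C * herm A u u.
Proof. by rewrite /herm -scalemxAr -scalemxAl mxE. Qed.

Lemma herm_basis n (A : 'M[R[i]]_n) j : herm A (delta_mx 0 j) (delta_mx 0 j) = A j j.
Proof.
rewrite /herm -rowE mxE (bigD1 j)//= big1 ?addr0; last first.
  by move=> l lj; rewrite !mxE (negbTE lj) andbF conjc_nat mulr0.
by rewrite !mxE !eqxx conjc_nat mulr1.
Qed.

Lemma bounded_on_line n (F : 'rV[R[i]]_n -> R[i]) x v : {for x, continuous F} ->
  exists B r : R, [/\ 0 <= B, 0 < r & forall t, cmod t < r -> cmod (F (x + t *: v)) <= B].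
Proof.
move=> Fc; have e1 : 0 < (1 : R)%:C by rewrite ltcR.
have H : nbhs (x + 0 *: v) (fun y => `|F x - F y| < 1%:C).
  by rewrite scale0r addr0; move/cvgrPdist_lt : Fc; exact.
have [r r0 rP] := nbhs_line H.
exists (cmod (F x) + 1), r; split=> //; first by rewrite addr_ge0 ?cmod_ge0.
move=> t tr; have := rP t; rewrite subr0 => /(_ tr).
rewrite (_ : `|_ - _| = (cmod (F x - F (x + t *: v)))%:C); last exact: cmod_normr.
rewrite ltcR => h; have := cmodB (F x) (F x - F (x + t *: v)).
by rewrite opprB addrC subrK; lra.
Qed.

(** The curve P in finitely many coordinates serves as the reference: its
    logarithmic derivative is the function e common to all exponents. *)
Lemma curves_contradiction (lam : R[i] -> R) (b : R) n0 : 0 < b -> lam 0 != 0 ->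
  (forall beta, b <= beta -> exists r H H1 H2,
     [/\ 0 < r, curve r H H1 H2 & pulls_back lam beta r H H1]) ->
  (exists r P P1 P2, [/\ 0 < r, curve r P P1 P2, pulls_back lam 1 r P P1 &
     forall n, (n0 <= n)%N -> forall z, P z n = 0]) ->
  False.
Proof.
move=> b0 lam0 hcurve [rP [P [P1 [P2 [rP0 cP fP Pn]]]]].
apply: (@no_continuum_of_exponents R (fun z w => bochner_logder P P1 z w^bar) b n0 b0).
- move=> beta /hcurve[r [H [H1 [H2 [r0 cH fH]]]]].
  pose r1 := Num.min r rP; have r10 : 0 < r1 by rewrite lt_min r0.
  have r1r : r1 <= r by rewrite ge_min lexx.
  have r1P : r1 <= rP by rewrite ge_min lexx orbT.
  have [s [a g]] := normalized_kernel_of_curve r10 (curve_le r1r cH) (curve_le r1P cP)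
    (pulls_back_le r1r fH) (pulls_back_le r1P fP).
  by exists s, (fun z => a z *: H z).
- have [s [a g]] := normalized_kernel_of_curve rP0 cP cP fP fP.
  exists s, (fun z => a z *: P z); split=> // z i /Pn Pi.
  by rewrite -[LHS]/(a z * P z i) Pi mulr0.
- move=> s s0; have [z [w [zs ws zw]]] := bochner_logder_neq0 rP0 cP fP lam0 s0.
  by exists z, w^bar; rewrite cmodJ cJK.
Qed.

End Assembly.

Theorem theorem2 (R : realType) (d : nat) (M : complexManifold R d)
  (g : hmetric M) (z : chart R M d)
  (gK : kahler g)
  (zM : global_coordinates z)
  (g_transversal : exists f, [/\ kahler_immersion_CPoo g f,
     full_on [set: M] f & transversally_full z f])
  (g_scaled : exists2 alpha0 : R, 0 < alpha0 &
     forall alpha : R, alpha0 <= alpha ->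
       infinite_projectively_induced (scale_metric alpha g)) :
  forall c : R, 0 < c ->
  forall (n : nat) (N : complexManifold R n) (h : hmetric N),
    projective_kahler h -> ~ relatives (scale_metric c g) h.
Proof.
move=> c c0 n N h [_ [N0 hproj]] [s [S [k [i1 [i2 [s0 kK [_ hol1 iso1] [_ hol2 iso2]]]]]]].
have [alpha0 alpha00 scaled] := g_scaled.
have [p0 _] := manifold_nonempty S.
have [e eA ep] := @atlas_cover _ _ S p0.
pose v : 'rV[R[i]]_s := delta_mx 0 (Ordinal s0).
pose lam (t : R[i]) : R := Rec (herm (k e (Defs.cpoint e (ccoord e p0 + t *: v))) v v).
have v0 : v != 0.
  apply/negP => /eqP/rowP/(_ (Ordinal s0)); rewrite !mxE !eqxx /= => /eqP.
  by rewrite oner_eq0.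
have k_pos p : cdom e p -> 0 < herm (k e p) v v by move=> pe; exact: kahler_posdef kK _ _ eA pe _ v0.
have [_ _ eK _ _] := atlas_chart eA.
have lam0 : lam 0 != 0.
  have := k_pos p0 ep; rewrite ltcE => /andP[_ h0].
  by rewrite /lam scale0r addr0 eK// gt_eqF.
have lam_bound : exists B r : R, [/\ 0 <= B, 0 < r & forall t, cmod t < r -> lam t <= B].
  have I0 : image_of e (ccoord e p0) by exists p0.
  have [kc _] := kahler_smooth kK eA (Ordinal s0) (Ordinal s0) [::] I0.
  have [B [r [B0 r0 rB]]] := bounded_on_line v kc.
  exists B, r; split=> // t /rB; apply: le_trans.
  by rewrite /lam herm_basis (le_trans (ler_norm _))// (le_trans (Re_le_cmod _)).
have b0 : 0 < alpha0 / c by rewrite divr_gt0.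
(* (M, alpha g) with alpha = beta c induces beta times the metric of S *)
apply: (@curves_contradiction R lam (alpha0 / c) N0.+1 b0 lam0).
- move=> beta bbeta; have beta0 : 0 <= beta by rewrite (le_trans (ltW b0)).
  have ab : alpha0 <= beta * c by rewrite -ler_pdivrMr.
  have [f [fi _]] := scaled _ ab.
  have idK : pcancel (@id nat) Some by [].
  have idK' : ocancel Some (@id nat) by [].
  have gMM cc p u : herm (scale_metric (beta * c) g cc p) u u = beta%:C * herm (scale_metric c g cc p) u u.
    by rewrite /scale_metric !herm_scale rcM mulrA.
  have [r [H [H1 [H2 [r0 cH fH _]]]]] := immersed_curve idK idK' eA ep beta0 hol1 iso1 gMM
    (filterT : nbhs (i1 p0) setT) fi k_pos lam_bound.
  by exists r, H, H1, H2.
- have [U [Uo Up] [f fi]] := hproj (i2 p0).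
  have ordK : pcancel (@nat_of_ord N0.+1) insub by exact: valK.
  have ordK' : ocancel insub (@nat_of_ord N0.+1) by exact: insubK.
  have gMM cc p u : herm (h cc p) u u = (1 : R)%:C * herm (h cc p) u u by rewrite mul1r.
  have Un : nbhs (i2 p0) U by exact: open_nbhs_nbhs.
  have [r [H [H1 [H2 [r0 cH fH Hn]]]]] := immersed_curve ordK ordK' eA ep ler01 hol2 iso2 gMM
    Un fi k_pos lam_bound.
  exists r, H, H1, H2; split=> // m Nm w; apply: Hn.
  by rewrite insubF// ltnNge Nm.
Qed.
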